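(* Let $q\geq3$ be an integer. Then, as $x\to\infty$, \[ \big|\mathcal{E}_{q}(x)\big|\ll x^{2q-2/3}, \] where the implied constant depends only on $q$.
   Context: For $(v,w)\in\mathbb{R}^{2q}\times\mathbb{R}$ let $\mathcal{N}(v,w)=\big(|v|_{2}^{4}+w^{2}\big)^{1/4}$ be the Cygan–Korányi norm ($|\cdot|_2$ the Euclidean norm), let $\mathcal{B}=\{(v,w)\in\mathbb{R}^{2q}\times\mathbb{R}:\mathcal{N}(v,w)\leq1\}$, and for $x>0$ let $\delta_{x}(v,w)=(xv,x^{2}w)$ be the Heisenberg dilation. Define \[ \mathcal{E}_{q}(x)=\big|\mathbb{Z}^{2q+1}\cap\delta_{x}\mathcal{B}\big|-\mathrm{vol}(\mathcal{B})\,x^{2q+2}, \] where $\mathrm{vol}$ is $(2q+1)$-dimensional Lebesgue measure. *)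

(* Defs.v *)
From HB Require Import structures.
From mathcomp Require Import all_boot all_order all_algebra finmap.
From mathcomp Require Import all_classical all_reals all_analysis.
From mathcomp Require Import measurable_realfun.
Set Implicit Arguments.
Unset Strict Implicit.
Unset Printing Implicit Defensive.
Import Order.TTheory GRing.Theory Num.Theory numFieldNormedType.Exports.

Local Open Scope classical_set_scope.
Local Open Scope ring_scope.

Section lebesgue_tuple.
Variable R : realType.
Local Notation T := (measurableTypeR R).

Definition tcons n (p : n.-tuple T * T) : n.+1.-tuple T :=
  [tuple of p.2 :: p.1].

(* n-dimensional Lebesgue measure, as the n-fold product of the
   one-dimensional one; lebesgue_tuple_box characterizes it on boxes. *)
Fixpoint lebesgue_tuple n : set (n.-tuple T) -> \bar R :=
  match n with
  | 0 => \d_([tuple] : 0.-tuple T)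
  | m.+1 => pushforward (@lebesgue_tuple m \x @lebesgue_measure R)%E (@tcons m)
  end.

Lemma measurable_tcons n : measurable_fun [set: n.-tuple T * T] (@tcons n).
Proof.
by apply: measurable_cons; [exact: measurable_snd|exact: measurable_fst].
Qed.

Lemma lebesgue_tuple_measure n :
  {m : {measure set (n.-tuple T) -> \bar R} |
    @lebesgue_tuple n = m :> (_ -> _)}.
Proof.
elim: n => [|n [m mE]]; first by exists (\d_([tuple] : 0.-tuple T)).
have F := @measurable_tcons n.
pose mm := [the {measure set (n.-tuple T * T) -> \bar R} of
  (m \x @lebesgue_measure R)%E].
exists (measure_function_pushforward__canonical__measure_function_Measure mm F).
by rewrite /= mE.
Qed.

Let lt0 n : @lebesgue_tuple n set0 = 0%E.
Proof. by have [m ->] := lebesgue_tuple_measure n; rewrite measure0. Qed.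

Let lt_ge0 n (A : set (n.-tuple T)) : (0 <= lebesgue_tuple A)%E.
Proof. by have [m ->] := lebesgue_tuple_measure n; rewrite measure_ge0. Qed.

Let lt_sigma_additive n : semi_sigma_additive (@lebesgue_tuple n).
Proof.
have [m ->] := lebesgue_tuple_measure n.
exact: measure_semi_sigma_additive.
Qed.

HB.instance Definition _ n := isMeasure.Build _ _ _ (@lebesgue_tuple n)
  (@lt0 n) (@lt_ge0 n) (@lt_sigma_additive n).

Lemma measurable_box n (A : 'I_n -> set T) : (forall i, measurable (A i)) ->
  measurable [set t : n.-tuple T | forall i, A i (tnth t i)].
Proof.
move=> mA; rewrite (_ : [set _ | _] =
    \bigcap_(i in [set: 'I_n]) ((fun t : n.-tuple T => tnth t i) @^-1` A i)).
  apply: fin_bigcap_measurable => // i _.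
  by rewrite -[X in measurable X]setTI; exact: measurable_tnth.
by apply/seteqP; split => [t h i _|t h i]; apply: h.
Qed.

Lemma lebesgue_tuple_box n (A : 'I_n -> set T) : (forall i, measurable (A i)) ->
  lebesgue_tuple [set t : n.-tuple T | forall i, A i (tnth t i)] =
  (\prod_(i < n) lebesgue_measure (A i))%E.
Proof.
elim: n A => [|n IH] A mA.
  rewrite big_ord0 /= diracE.
  by rewrite mem_set //= => -[].
rewrite big_ord_recl /= /pushforward.
have -> : @tcons n @^-1` [set t | forall i, A i (tnth t i)] =
   [set t : n.-tuple T | forall i, A (lift ord0 i) (tnth t i)] `*` A ord0.
  apply/seteqP; split => [[t x] /= h|[t x] /= [h hx] i].
    split=> [i|]; last by have := h ord0.
    by have := h (lift ord0 i); rewrite /tcons/= tnthS.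
  by case: (unliftP ord0 i) => [j ->|-> //]; rewrite tnthS.
rewrite (product_measure1E [the measure _ _ of @lebesgue_tuple n]
  [the {sigma_finite_measure set _ -> \bar _} of @lebesgue_measure R])//.
  by rewrite muleC; congr (_ * _)%E; exact: IH.
apply: (@measurable_box n (fun i => A (lift ord0 i))) => i; exact: mA.
Qed.

End lebesgue_tuple.

Section heisenberg.
Variables (R : realType) (q : nat).

Definition hspace : Type := ((2 * q).-tuple R * R)%type.

Definition euclid_norm n (v : n.-tuple R) : R :=
  Num.sqrt (\sum_(i < n) tnth v i ^+ 2).

Definition cygan_koranyi_norm (p : hspace) : R :=
  (euclid_norm p.1 ^+ 4 + p.2 ^+ 2) `^ 4^-1.

Definition hball : set hspace := [set p | cygan_koranyi_norm p <= 1].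

Definition hdilation (x : R) (p : hspace) : hspace :=
  ([tuple x * tnth p.1 i | i < 2 * q], x ^+ 2 * p.2).

Definition hlattice : set hspace :=
  [set p | (forall i, tnth p.1 i \is a Num.int) /\ p.2 \is a Num.int].

Definition hvol : set hspace -> \bar R :=
  (@lebesgue_tuple R (2 * q) \x @lebesgue_measure R)%E.

(* fset_set and fine return junk on infinite sets and infinite volumes;
   finite_lattice_points and hvol_ball_fin_num exclude both. *)
Definition hcount (x : R) : nat :=
  #|` fset_set (hlattice `&` hdilation x @` hball) |.

Definition hdiscrepancy (x : R) : R :=
  (hcount x)%:R - fine (hvol hball) * x ^+ (2 * q + 2).

Lemma hball_bounded (p : hspace) : hball p ->
  (forall i, `|tnth p.1 i| <= 1) /\ `|p.2| <= 1.
Proof.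
rewrite /hball /= /cygan_koranyi_norm => h.
set s := euclid_norm p.1 in h.
have s0 : 0 <= s by exact: sqrtr_ge0.
have s4 : 0 <= s ^+ 4 by rewrite exprn_ge0.
have h1 : s ^+ 4 + p.2 ^+ 2 <= 1.
  rewrite leNgt; apply/negP => h2.
  have : 1 < (s ^+ 4 + p.2 ^+ 2) `^ 4^-1.
    have e1 : (1 : R) = 1 `^ 4^-1 by rewrite powR1.
    rewrite [ltLHS]e1; apply: gt0_ltr_powR => //.
    - by rewrite nnegrE.
    - by rewrite nnegrE addr_ge0// sqr_ge0.
  by rewrite ltNge h.
have s1 : s <= 1.
  rewrite -(@expr_le1 _ 4)//.
  by apply: le_trans h1; rewrite lerDl sqr_ge0.
split => [i|]; last first.
  rewrite -(@expr_le1 _ 2)// real_normK ?num_real//.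
  by apply: le_trans h1; rewrite lerDr.
rewrite -sqrtr_sqr; apply: le_trans s1.
rewrite /s /euclid_norm ler_wsqrtr// (bigD1 i)//= lerDl.
by apply: sumr_ge0 => j _; rewrite sqr_ge0.
Qed.

Lemma finite_lattice_points (x : R) :
  finite_set (hlattice `&` hdilation x @` hball).
Proof.
set K := Num.truncn (`|x| + x ^+ 2).
have HK : `|x| + x ^+ 2 < K.+1%:R by exact: truncnS_gt.
pose f (g : {ffun 'I_(2 * q) -> 'I_(2 * K).+3} * 'I_(2 * K).+3) : hspace :=
  ([tuple (g.1 i)%:R - K.+1%:R | i < 2 * q], g.2%:R - K.+1%:R).
apply: (@sub_finite_set _ _ (f @` setT)); last first.
  exact/finite_image/finite_finset.
have key (y : R) : y \is a Num.int -> `|y| <= `|x| + x ^+ 2 ->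
    {k : 'I_(2 * K).+3 | k%:R - K.+1%:R = y}.
  move=> yint ylt.
  have : `|y| < K.+1%:R by exact: le_lt_trans ylt HK.
  rewrite ltr_norml => /andP[y1 y2].
  have z0 : y + K.+1%:R \is a Num.nat.
    rewrite natrEint rpredD ?rpred_nat//= ?intr_nat//.
    by rewrite -lerBlDr sub0r ltW.
  have [n nE] : {n : nat | y + K.+1%:R = n%:R}.
    by exists (Num.truncn (y + K.+1%:R)); rewrite truncnK.
  have nlt : (n < (2 * K).+3)%N.
    rewrite -(ltr_nat R) -nE.
    have -> : (2 * K).+3 = ((K.+1 + K.+1).+1)%N by rewrite mul2n -addnn addnS addSn.
    by rewrite -[in ltRHS]addn1 !natrD ltr_wpDr// ltrD2r.
  by exists (Ordinal nlt) => /=; rewrite -nE addrK.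
move=> p [[p1int p2int] [r rB rp]].
have [r1 r2] := hball_bounded rB.
have p1le i : `|tnth p.1 i| <= `|x| + x ^+ 2.
  rewrite -rp /= tnth_mktuple normrM.
  apply: (@le_trans _ _ `|x|); last by rewrite lerDl sqr_ge0.
  by rewrite ler_piMr.
have p2le : `|p.2| <= `|x| + x ^+ 2.
  rewrite -rp /= normrM ger0_norm ?sqr_ge0//.
  apply: (@le_trans _ _ (x ^+ 2)); last by rewrite lerDr.
  by rewrite ler_piMr// sqr_ge0.
exists ([ffun i => sval (key _ (p1int i) (p1le i))], sval (key _ p2int p2le)) => //.
rewrite /f /= [RHS]surjective_pairing; congr pair; last by case: key.
apply: eq_from_tnth => i; rewrite tnth_mktuple ffunE.
by case: key.
Qed.

Local Notation T := (measurableTypeR R).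

Lemma measurable_hball :
  measurable (hball : set ((2 * q).-tuple T * T)).
Proof.
have mc i : measurable_fun [set: (2 * q).-tuple T * T]
    (fun p => tnth p.1 i : R).
  have mi : measurable_fun [set: (2 * q).-tuple T] (fun t => tnth t i).
    exact: measurable_tnth.
  exact: (measurableT_comp mi measurable_fst).
have m2 : measurable_fun [set: (2 * q).-tuple T * T] (fun p => p.2 : R).
  exact: measurable_snd.
have mN : measurable_fun [set: (2 * q).-tuple T * T]
    (fun p => cygan_koranyi_norm p).
  rewrite /cygan_koranyi_norm.
  apply: (measurableT_comp (measurable_powR (4^-1))).
  apply: measurable_funD; last exact: measurable_funX.
  apply: measurable_funX.
  rewrite (_ : (fun _ => _) =
    (fun p : (2 * q).-tuple T * T =>
      (\sum_(i < 2 * q) (tnth p.1 i : R) ^+ 2) `^ 2^-1)); last first.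
    apply/funext => p; rewrite powR12_sqrt//.
    by apply: sumr_ge0 => i _; rewrite sqr_ge0.
  apply: (measurableT_comp (measurable_powR (2^-1))).
  by apply: measurable_sum => i; exact: measurable_funX.
rewrite (_ : hball = (fun p => cygan_koranyi_norm p) @^-1` `]-oo, 1]).
  by rewrite -[X in measurable X]setTI; exact: mN.
by apply/seteqP; split => p; rewrite /= in_itv.
Qed.

Lemma hvol_ball_fin_num : hvol hball \is a fin_num.
Proof.
pose I1 : set T := [set` `[(-1 : R), 1]].
pose Bx := [set t : (2 * q).-tuple T | forall i, I1 (tnth t i)] `*` I1.
have mBx1 : measurable [set t : (2 * q).-tuple T | forall i, I1 (tnth t i)].
  by apply: (@measurable_box _ _ (fun=> I1)) => i; exact: measurable_itv.
have mI1 : measurable I1 by exact: measurable_itv.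
have I1fin : @lebesgue_measure R I1 \is a fin_num.
  by rewrite lebesgue_measure_itv/=; case: ifP.
have le : (hvol hball <= hvol Bx)%E.
  apply: le_measure; rewrite ?inE.
  - exact: measurable_hball.
  - exact: measurableX.
  - move=> p /hball_bounded[h1 h2]; split => [i|]; rewrite /I1 /= in_itv/= -ler_norml//.
rewrite ge0_fin_numE; last exact: measure_ge0.
apply: (le_lt_trans le).
rewrite /hvol product_measure1E//.
have box := @lebesgue_tuple_box R (2 * q) (fun=> I1) (fun=> mI1).
rewrite [X in (X * _)%E]box.
rewrite -ge0_fin_numE; last by rewrite mule_ge0// prode_ge0.
rewrite fin_numM//.
by apply: (big_ind (fun y => y \is a fin_num)) => // u v; exact: fin_numM.
Qed.

End heisenberg.

(* Main.v *)
(** Slice the ball by its last coordinate: the number of lattice points is the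
    sum over [|w| <= X = x^2] of [A(s_w)], where [s_w = sqrt (X^2 - w^2)] and
    [A(t)] counts the [v] in [Z^(2q)] with [|v|^2 <= t].

    In dimension six, Jacobi's formula
    [r_6(n) = \sum_(d e = n) (16 chi(e) - 4 chi(d)) d^2], [chi] being the
    nontrivial character mod 4, gives [A_6(t)] as [c t^3] plus [t^2] times a
    combination of sawtooth terms [psi (t / b + g) / b^2] with [b <= y], up to
    an error of order [y^5]; here [y = x^(2/3)].  Both sides of Jacobi's formula
    satisfy the recursion [\sum_z (n - 7 z^2) r(n - z^2) = 0]: for the count of
    representations by symmetry of the sphere in dimension seven, for the divisor
    sum by sign-reversing involutions on the solutions of [i^2 + d e = n] in the
    manner of Liouville.

    The other [2q - 6] coordinates are added one at a time by the operator
    [theta : g |-> (t |-> \sum_z g (t - z^2))].  On the main term this is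
    Euler-Maclaurin summation.  The oscillating terms are first summed over [w]:
    van der Corput's second derivative test bounds the sums of
    [psi (s_w / b + g)] along the arc [w |-> s_w] by a multiple of [y^2], and
    every further application of [theta] costs only a factor of order [x].  All
    errors are then of order [x^(2q) / y].

    This yields [c x^(2q+2)] with an unspecified constant [c], which must be the
    volume of the ball because the ball is squeezed between unions of cells of a
    fine lattice. *)
Require Import Defs.
From HB Require Import structures.
From mathcomp Require Import all_boot all_order all_algebra finmap.
From mathcomp Require Import all_classical all_reals all_analysis.
From mathcomp Require Import ring lra zify.
Set Implicit Arguments.
Unset Strict Implicit.
Unset Printing Implicit Defensive.
Import Order.TTheory GRing.Theory Num.Theory numFieldNormedType.Exports.
Local Open Scope classical_set_scope.
Local Open Scope ring_scope.

(* Tries lra without the nonlinear hypotheses first, which is much faster in large contexts. *)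
Ltac qlra := first [
  solve [repeat match goal with H : ?T |- _ =>
      match T with
      | context [GRing.exp] => idtac
      | context [Num.norm] => idtac
      | context [bigop] => idtac
      end; clear H end; lra]
  | lra].

(** The cutoff y equalizes two errors. Truncating the sawtooth series at b <= y costs X^2 / y at
    each of about X values of w, while the arc sums cost X^2 y^2; with X = x^2 both totals are x^6 /
    y exactly when X = y^3.

    The order of summation shapes the proof. At a single t of size X the oscillating term may be as
    large as X^2, which is too much by a factor y; the saving appears only in the sum over w. Since
    [theta] merely translates its argument, the arc bound is proved uniformly over all translates
    s_w - a with a >= 0, and in this form it passes through every application of [theta].

    In dimension six the weights b^(-2) are summable, so adding the arc bounds over b loses no
    logarithm. *)

Lemma big_bij (R : zmodType) (T T' : eqType) (s : seq T) (s' : seq T')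
    (P : pred T) (P' : pred T') (f : T -> T') (g : T' -> T) (F : T' -> R) :
  uniq s -> uniq s' ->
  {in s, forall t, P t -> [/\ f t \in s', P' (f t) & g (f t) = t]} ->
  {in s', forall t, P' t -> [/\ g t \in s, P (g t) & f (g t) = t]} ->
  \sum_(t <- s | P t) F (f t) = \sum_(t <- s' | P' t) F t.
Proof.
move=> us us' fP gP.
rewrite -big_filter -[RHS]big_filter -(big_map f xpredT F).
apply: perm_big; apply: uniq_perm; rewrite ?filter_uniq //.
  rewrite map_inj_in_uniq ?filter_uniq // => a b.
  rewrite !mem_filter => /andP[Pa sa] /andP[Pb sb] ab.
  by have [_ _ <-] := fP _ sa Pa; have [_ _ <-] := fP _ sb Pb; rewrite ab.
move=> t; apply/mapP/idP => [[u]|].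
  by rewrite !mem_filter => /andP[Pu su] ->; have [-> ->] := fP _ su Pu.
rewrite mem_filter => /andP[Pt st]; have [gs Pg fg] := gP _ st Pt.
by exists (g t); rewrite ?mem_filter ?Pg.
Qed.

Lemma big_antisym (T : eqType) (s : seq T) (P : pred T) (f : T -> T)
    (F : T -> int) :
  uniq s ->
  {in s, forall t, P t -> [/\ f t \in s, P (f t), f (f t) = t & F (f t) = - F t]} ->
  \sum_(t <- s | P t) F t = 0.
Proof.
move=> us fP.
have : \sum_(t <- s | P t) F (f t) = \sum_(t <- s | P t) F t.
  by apply: (@big_bij _ _ _ _ _ _ _ f f) => // t st Pt; have [] := fP t st Pt.
have -> : \sum_(t <- s | P t) F (f t) = - \sum_(t <- s | P t) F t.
  rewrite -sumrN big_seq_cond [RHS]big_seq_cond.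
  by apply: eq_bigr => t /andP[st Pt]; have [] := fP t st Pt.
by move: (\sum_(t <- s | P t) F t) => S; lia.
Qed.

(** * Jacobi's six-square formula by Liouville's method *)

Definition chi (m : int) : int :=
  if (m %% 4)%Z == 1 then 1 else if (m %% 4)%Z == 3 then -1 else 0.

Lemma chi4 k m : chi (m + 4 * k) = chi m.
Proof. by rewrite /chi addrC mulrC modzMDl. Qed.

Lemma chiE m : exists k r : int, [/\ m = k * 4 + r, 0 <= r < 4 &
  chi m = if r == 1 then 1 else if r == 3 then -1 else 0].
Proof.
exists (m %/ 4)%Z, (m %% 4)%Z; split => //; first exact: divz_eq.
by rewrite modz_ge0 //= ltz_pmod.
Qed.

Lemma chiN m : chi (- m) = - chi m.
Proof.
have [k [r [-> r4 ->]]] := chiE m; have [k' [r' [h r4' ->]]] := chiE (- (k * 4 + r)).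
by do ![case: eqP => ?]; lia.
Qed.

Definition zrange (K : nat) : seq int :=
  [seq k%:Z - K%:Z | k <- iota 0 (2 * K).+1].

Lemma mem_zrange K z : (z \in zrange K) = (`|z| <= K%:Z).
Proof.
apply/mapP/idP => [[k]|zK]; first by rewrite mem_iota => kK ->; lia.
by exists (absz (z + K%:Z)); rewrite ?mem_iota; lia.
Qed.

Lemma zrange_uniq K : uniq (zrange K).
Proof. by rewrite map_inj_uniq ?iota_uniq // => a b; lia. Qed.

Lemma mem_allpairs_pair (S T : eqType) (s : seq S) (t : seq T) p :
  (p \in [seq (x, y) | x <- s, y <- t]) = (p.1 \in s) && (p.2 \in t).
Proof.
case: p => x y; apply/allpairsP/andP => [[[a b] /= [? ? [-> ->]]] //|[? ?]].
by exists (x, y).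
Qed.

Definition pairs (K : nat) : seq (int * int) :=
  [seq (d, e) | d <- zrange K, e <- zrange K].

Lemma mem_pairs K p : (p \in pairs K) = (`|p.1| <= K%:Z) && (`|p.2| <= K%:Z).
Proof. by rewrite mem_allpairs_pair !mem_zrange. Qed.

Lemma pairs_uniq K : uniq (pairs K).
Proof. by apply: allpairs_uniq; rewrite ?zrange_uniq // => -[a b] [c d] _ _ [-> ->]. Qed.

Definition isfact (m : int) (p : int * int) : bool :=
  [&& 0 < p.1, 0 < p.2 & p.1 * p.2 == m].

(** Liouville's solutions of i^2 + d e = n with d, e > 0. Positivity of d and e confines them to
    |i|, d, e <= n, so for n <= K the window cuts nothing off. *)
Definition trip (K : nat) (n : int) : seq (int * (int * int)) :=
  [seq t <- [seq (i, p) | i <- zrange K, p <- pairs K]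
     | isfact (n - t.1 ^+ 2) t.2].

Lemma trip_uniq K n : uniq (trip K n).
Proof.
apply: filter_uniq; apply: allpairs_uniq; rewrite ?zrange_uniq ?pairs_uniq //.
by move=> -[a b] [c d] _ _ [-> ->].
Qed.

Lemma mem_trip (K n : nat) i d e : (n <= K)%N ->
  ((i, (d, e)) \in trip K n%:Z) = [&& 0 < d, 0 < e & i ^+ 2 + d * e == n%:Z].
Proof.
move=> nK; rewrite mem_filter mem_allpairs_pair mem_zrange mem_pairs /isfact /=.
apply/andP/and3P => [[/and3P[-> -> /eqP h] _]|[d0 e0 /eqP h]].
  by split=> //; apply/eqP; lia.
split; first by apply/and3P; split => //; apply/eqP; lia.
by apply/and3P; split; nia.
Qed.

(** Odd in e - 2 i, which the involution of [sum_Phi_pos] negates while fixing e and d + i. Its part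
    even in i is the summand that the recursion for Jacobi's divisor sum requires. *)
Definition Phi (t : int * (int * int)) : int :=
  let: (i, (d, e)) := t in
  chi e * (e - 2 * i) * (d + i) * (4 * (d + i) ^+ 2 - (e - 2 * i) ^+ 2).

(** [Phi] transported along (i, d, e) |-> (i + d, d, e - 2 i - d): in the new variables the old e -
    2 i, d + i and e are d + e, y and e - d + 2 y. *)
Definition Psi (t : int * (int * int)) : int :=
  let: (y, (d, e)) := t in
  chi (e - d + 2 * y) * (d + e) * y * (4 * y ^+ 2 - (d + e) ^+ 2).

Section Involution.
Variables K n : nat.
Hypothesis nK : (n <= K)%N.

Let dp (t : int * (int * int)) : int := t.2.1 + 2 * t.1 - t.2.2.

(** The map (i, d, e) |-> (e - i, d + 2 i - e, e) is an involution preserving i^2 + d e. The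
    condition [0 < dp t] is exactly positivity of the new d, and the new [dp] is the old d, so the
    region is stable. *)
Lemma sum_Phi_pos : \sum_(t <- trip K n%:Z | 0 < dp t) Phi t = 0.
Proof.
apply: (@big_antisym _ _ _
  (fun t => (t.2.2 - t.1, (t.2.1 + 2 * t.1 - t.2.2, t.2.2)))).
  exact: trip_uniq.
move=> [i [d e]]; rewrite mem_trip // /dp /= => /and3P[d0 e0 /eqP h] dp0.
split.
- by rewrite mem_trip //; apply/and3P; split => //; apply/eqP; rewrite -h; ring.
- lia.
- by congr (_, (_, _)); ring.
- by rewrite /Phi; ring.
Qed.

Let eps (t : int * (int * int)) : int := t.2.2 - t.2.1 + 2 * t.1.

(** Exchanging d and e turns the argument m of [chi] into - m + 4 y, and [chi] is odd of period 4;
    the other factors are symmetric in d and e. *)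
Lemma sum_Psi_eq0 : \sum_(t <- trip K n%:Z) Psi t = 0.
Proof.
apply: (@big_antisym _ _ _ (fun t => (t.1, (t.2.2, t.2.1)))).
  exact: trip_uniq.
move=> [y [d e]]; rewrite mem_trip // /= => /and3P[d0 e0 /eqP h] _.
split => //.
  by rewrite mem_trip //; apply/and3P; split => //; apply/eqP; rewrite -h; ring.
rewrite /Psi (_ : d - e + 2 * y = - (e - d + 2 * y) + 4 * y); last by ring.
by rewrite chi4 chiN; ring.
Qed.

(** The map (y, d, e) |-> (- y, e, d) preserves [Psi] and negates [eps], so the two half sums agree.
    The terms with [eps t] = 0 vanish because [chi 0] = 0, hence twice the half sum is the full sum,
    which is zero. *)
Lemma sum_Psi_pos : \sum_(t <- trip K n%:Z | 0 < eps t) Psi t = 0.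
Proof.
have h : \sum_(t <- trip K n%:Z | 0 < eps t) Psi t =
         \sum_(t <- trip K n%:Z | eps t < 0) Psi t.
  pose f (t : int * (int * int)) := (- t.1, (t.2.2, t.2.1)).
  rewrite -(@big_bij _ _ _ (trip K n%:Z) (trip K n%:Z) (fun t => 0 < eps t)
    (fun t => eps t < 0) f f Psi); rewrite ?trip_uniq //.
  - apply: eq_bigr => -[y [d e]] _; rewrite /f /Psi /=.
    rewrite (_ : d - e + 2 * - y = - (e - d + 2 * y)); last by ring.
    by rewrite chiN; ring.
  - move=> [y [d e]]; rewrite mem_trip // /f /eps /= => /and3P[d0 e0 /eqP h] ep.
    split; last by rewrite opprK.
      by rewrite mem_trip //; apply/and3P; split => //; apply/eqP; rewrite -h; ring.
    lia.
  - move=> [y [d e]]; rewrite mem_trip // /f /eps /= => /and3P[d0 e0 /eqP h] ep.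
    split; last by rewrite opprK.
      by rewrite mem_trip //; apply/and3P; split => //; apply/eqP; rewrite -h; ring.
    lia.
have := sum_Psi_eq0; rewrite (bigID (fun t => 0 < eps t)) /=.
rewrite [X in _ + X](bigID (fun t => eps t < 0)) /=.
rewrite [X in _ + (_ + X)]big1 ?addr0; last first.
  move=> [y [d e]]; rewrite /eps /= => ep; rewrite /Psi.
  by rewrite (_ : e - d + 2 * y = 0) ?mul0r //; lia.
rewrite [X in _ + X](eq_bigl (fun t => eps t < 0)); last by move=> t; lia.
rewrite -h; by move: (\sum_(t <- _ | _) _) => S; lia.
Qed.

(** Under the substitution relating [Phi] to [Psi], the new e is - [dp t] and the new [eps] is the
    old e; thus [dp t < 0] corresponds to [0 < eps t]. *)
Lemma sum_Phi_neg : \sum_(t <- trip K n%:Z | dp t < 0) Phi t = 0.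
Proof.
pose f (t : int * (int * int)) := (t.1 + t.2.1, (t.2.1, t.2.2 - 2 * t.1 - t.2.1)).
pose g (t : int * (int * int)) := (t.1 - t.2.1, (t.2.1, t.2.2 - t.2.1 + 2 * t.1)).
transitivity (\sum_(t <- trip K n%:Z | 0 < eps t) Psi t); last exact: sum_Psi_pos.
rewrite -(@big_bij _ _ _ (trip K n%:Z) (trip K n%:Z) (fun t => dp t < 0)
  (fun t => 0 < eps t) f g Psi); rewrite ?trip_uniq //.
- apply: eq_bigr => -[i [d e]] _; rewrite /f /Psi /Phi /=.
  rewrite (_ : e - 2 * i - d - d + 2 * (i + d) = e); last by ring.
  ring.
- move=> [i [d e]]; rewrite mem_trip // /f /g /eps /dp /= => /and3P[d0 e0 /eqP h] ep.
  split.
  + by rewrite mem_trip //; apply/and3P; split; [lia|lia|apply/eqP; rewrite -h; ring].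
  + lia.
  + by congr (_, (_, _)); ring.
- move=> [i [d e]]; rewrite mem_trip // /f /g /eps /dp /= => /and3P[d0 e0 /eqP h] ep.
  split.
  + by rewrite mem_trip //; apply/and3P; split; [lia|lia|apply/eqP; rewrite -h; ring].
  + lia.
  + by congr (_, (_, _)); ring.
Qed.

Lemma sum_Phi : \sum_(t <- trip K n%:Z) Phi t =
  \sum_(t <- trip K n%:Z | dp t == 0) Phi t.
Proof.
rewrite (bigID (fun t => 0 < dp t)) /= sum_Phi_pos add0r.
rewrite (bigID (fun t => dp t < 0)) /=.
rewrite (eq_bigl (fun t => dp t < 0)); last by move=> t; lia.
rewrite sum_Phi_neg add0r; apply: eq_bigl => t; lia.
Qed.

(** On the surviving set d = e - 2 i, so that n = i^2 + d e = (e - i)^2. *)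
Lemma sum_Phi_nonsquare : (forall k : nat, n <> (k * k)%N) ->
  \sum_(t <- trip K n%:Z) Phi t = 0.
Proof.
move=> nsq; rewrite sum_Phi big_seq_cond big1 // => -[i [d e]].
rewrite mem_trip // /dp /= => /andP[/and3P[d0 e0 /eqP h] /eqP d'].
case: (nsq (absz (e - i))).
have : n%:Z = (e - i) * (e - i) by rewrite -h (_ : d = e - 2 * i); [ring|lia].
nia.
Qed.

End Involution.

(** The parameter c stays independent of k so that induction on k applies. At c = k the coefficient
    of (-1)^k vanishes and only 6 k remains. *)
Lemma sum_chi_cubic (c : int) (k : nat) :
  2 * \sum_(0 <= j < 2 * k) chi j%:Z * (j%:Z ^+ 3 - 6 * c * j%:Z ^+ 2 + 8 * c ^+ 2 * j%:Z) =
  - (-1) ^+ k * (2 * (4 * k%:Z ^+ 3 - 3 * k%:Z) - 6 * c * (4 * k%:Z ^+ 2 - 1)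
      + 16 * c ^+ 2 * k%:Z) + 6 * c.
Proof.
elim: k => [|k IH]; first by rewrite muln0 big_nil expr0; ring.
rewrite (_ : (2 * k.+1)%N = (2 * k).+2); last by lia.
rewrite big_nat_recr //= big_nat_recr //= mulrDr mulrDr IH.
rewrite (_ : chi (2 * k)%N%:Z = 0); last by have [j [r [h r4 ->]]] := chiE (2 * k)%N%:Z; do ![case: eqP => ?]; lia.
rewrite (_ : chi (2 * k).+1%:Z = (-1) ^+ k); last first.
  rewrite -signr_odd; have [j [r [h r4 ->]]] := chiE (2 * k).+1%:Z.
  by case: (boolP (odd k)) => ok /=; rewrite ?expr1 ?expr0; do ![case: eqP => ?]; lia.
rewrite [(-1) ^+ k.+1]exprS (_ : (2 * k).+1%:Z = 2 * k%:Z + 1); last by lia.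
rewrite (_ : k.+1%:Z = k%:Z + 1); last by lia.
ring.
Qed.

Lemma sum_Phi_square (K k : nat) : (0 < k)%N -> (k * k <= K)%N ->
  \sum_(t <- trip K (k * k)%N%:Z) Phi t = 3 * (k * k)%N%:Z.
Proof.
move=> k0 kK; rewrite sum_Phi //.
pose f (t : int * (int * int)) := t.2.2.
pose g (j : int) : int * (int * int) := (j - k%:Z, (2 * k%:Z - j, j)).
(* The value of [Phi] at i = j - k, d = 2 k - j, e = j, the parametrization of the set [dp] = 0. *)
pose F (j : int) : int := k%:Z * chi j * j * (2 * k%:Z - j) * (4 * k%:Z - j).
pose s := [seq j%:Z | j <- iota 0 (2 * k)].
have us : uniq s by rewrite map_inj_uniq ?iota_uniq // => a b; lia.
have ms z : (z \in s) = (0 <= z < (2 * k)%N%:Z).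
  apply/mapP/idP => [[j]|]; first by rewrite mem_iota => ? ->; lia.
  by move=> h; exists (absz z); rewrite ?mem_iota; lia.
transitivity (\sum_(j <- s | 0 < j) F j).
  rewrite -(@big_bij _ _ _ (trip K (k * k)%N%:Z) s
     (fun t => t.2.1 + 2 * t.1 - t.2.2 == 0) (fun j => 0 < j) f g F) ?trip_uniq //.
  - rewrite big_seq_cond [RHS]big_seq_cond; apply: eq_bigr => -[i [d e]] /andP[].
    rewrite mem_trip // /f /F /= => /and3P[d0 e0 /eqP h] /eqP h'.
    have {}h' : d = e - 2 * i by lia.
    have {}h : (e - i) ^+ 2 = k%:Z ^+ 2 by move: h; rewrite PoszM h' => h; rewrite (expr2 k%:Z) -h; ring.
    have {}h : e - i = k%:Z.
      move/eqP: h; rewrite eqf_sqr => /orP[/eqP //|/eqP h]; lia.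
    have -> : i = e - k%:Z by lia.
    rewrite h'; have -> : i = e - k%:Z by lia.
    ring.
  - move=> [i [d e]]; rewrite mem_trip // /f /g ms /= => /and3P[d0 e0 /eqP h] /eqP h'.
    have {}h' : d = e - 2 * i by lia.
    have {}h : (e - i) ^+ 2 = k%:Z ^+ 2 by move: h; rewrite PoszM h' => h; rewrite (expr2 k%:Z) -h; ring.
    have {}h : e - i = k%:Z.
      move/eqP: h; rewrite eqf_sqr => /orP[/eqP //|/eqP h]; lia.
    split => //; first by lia.
    by congr (_, (_, _)); lia.
  - move=> j; rewrite ms /f /g /= => hj j0; split => //; last by lia.
    rewrite mem_trip //; apply/and3P; split => //; first by lia.
    by apply/eqP; rewrite PoszM; ring.
rewrite -[RHS](_ : \sum_(j <- s) F j = _); last first.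
  rewrite /s big_map -{1}[(2 * k)%N]subn0 -/(index_iota 0 (2 * k)).
  have hc := sum_chi_cubic k%:Z k.
  rewrite (eq_bigr (fun j => k%:Z * (chi j%:Z * (j%:Z ^+ 3 - 6 * k%:Z * j%:Z ^+ 2 + 8 * k%:Z ^+ 2 * j%:Z)))); last by move=> j _; rewrite /F; ring.
  rewrite -mulr_sumr; move: hc; move: (\sum_(0 <= j < _) _) => S.
  move: ((-1) ^+ k) => sg h.
  have {}h : S = 3 * k%:Z.
    apply: (@mulfI _ (2 : int)) => //; rewrite h; ring.
  by rewrite h PoszM; ring.
rewrite big_mkcond /= big_seq [RHS]big_seq; apply: eq_bigr => j.
rewrite ms => hj; case: ifP => // j0; rewrite /F (_ : j = 0) ?mulr0 ?mul0r //; lia.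
Qed.

(** The solution set is invariant under i |-> - i, so only the part of [Phi] even in i
    contributes. *)
Lemma sum_Phi_even (K n : nat) : (n <= K)%N ->
  \sum_(t <- trip K n%:Z) Phi t =
  \sum_(t <- trip K n%:Z)
     chi t.2.2 * (t.2.1 * t.2.2 - 6 * t.1 ^+ 2) * (4 * t.2.1 ^+ 2 - t.2.2 ^+ 2).
Proof.
move=> nK.
pose f (t : int * (int * int)) := (- t.1, t.2).
have h : \sum_(t <- trip K n%:Z) Phi (f t) = \sum_(t <- trip K n%:Z) Phi t.
  apply: (@big_bij _ _ _ (trip K n%:Z) (trip K n%:Z) xpredT xpredT f f Phi);
    rewrite ?trip_uniq //.
    move=> [i [d e]]; rewrite !mem_trip // sqrrN => -> _.
    by rewrite /f /= opprK.
  move=> [i [d e]]; rewrite !mem_trip // sqrrN => -> _.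
  by rewrite /f /= opprK.
apply: (@mulfI _ (2 : int)) => //.
rewrite [LHS](_ : _ = \sum_(t <- trip K n%:Z) Phi (f t) + \sum_(t <- trip K n%:Z) Phi t); last first.
  by rewrite h; ring.
rewrite -big_split mulr_sumr; apply: eq_bigr => -[i [d e]] _.
by rewrite /f /Phi /=; ring.
Qed.

(** The first summand supplies the value 1 at m = 0, where no factorization into positive integers
    exists. *)
Definition e6 (K : nat) (m : int) : int :=
  (m == 0)%:R + \sum_(p <- pairs K | isfact m p) (16 * chi p.2 - 4 * chi p.1) * p.1 ^+ 2.

Lemma sum_trip_swap (K n : nat) (F : int -> int -> int -> int) : (n <= K)%N ->
  \sum_(t <- trip K n%:Z) F t.1 t.2.1 t.2.2 =
  \sum_(t <- trip K n%:Z) F t.1 t.2.2 t.2.1.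
Proof.
move=> nK; pose f (t : int * (int * int)) := (t.1, (t.2.2, t.2.1)).
rewrite -(@big_bij _ _ _ (trip K n%:Z) (trip K n%:Z) xpredT xpredT f f
  (fun t => F t.1 t.2.1 t.2.2)) ?trip_uniq //.
  by move=> [i [d e]]; rewrite !mem_trip // (mulrC e) => /and3P[-> -> ->].
by move=> [i [d e]]; rewrite !mem_trip // (mulrC e) => /and3P[-> -> ->].
Qed.

Lemma sum_eq1 (T : eqType) (s : seq T) (a : T) :
  uniq s -> a \in s -> \sum_(z <- s) (z == a)%:R = 1 :> int.
Proof.
by move=> us sa; rewrite (bigD1_seq a) //= eqxx big1 ?addr0 // => i /negPf ->.
Qed.

(** For d e = n - z^2 the weight n - 7 z^2 is d e - 6 z^2, and exchanging d and e in the terms with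
    chi(d) makes the sum 4 times that of [Phi]. When n = k^2, the two roots z = k and z = - k
    contribute - 6 n each through the value 1 at 0, against 4 * 3 n from [sum_Phi_square]. *)
Lemma e6_rec (K n : nat) : (0 < n)%N -> (n <= K)%N ->
  \sum_(z <- zrange K) (n%:Z - 7 * z ^+ 2) * e6 K (n%:Z - z ^+ 2) = 0.
Proof.
move=> n0 nK.
have -> : \sum_(z <- zrange K) (n%:Z - 7 * z ^+ 2) * e6 K (n%:Z - z ^+ 2) =
    - 6 * n%:Z * \sum_(z <- zrange K) (z ^+ 2 == n%:Z)%:R +
    4 * \sum_(t <- trip K n%:Z) Phi t.
  transitivity (\sum_(z <- zrange K) (n%:Z - 7 * z ^+ 2) * (n%:Z - z ^+ 2 == 0)%:R +
     \sum_(t <- trip K n%:Z) (t.2.1 * t.2.2 - 6 * t.1 ^+ 2) *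
        ((16 * chi t.2.2 - 4 * chi t.2.1) * t.2.1 ^+ 2)).
    rewrite [X in _ + X]big_filter [X in _ + X]big_mkcond big_allpairs_dep -big_split /=.
    apply: eq_bigr => z _; rewrite /e6 mulrDr; congr (_ + _).
    rewrite -big_mkcond mulr_sumr; apply: eq_bigr => -[d e] /= /and3P[_ _ /eqP ->].
    by congr (_ * _); ring.
  congr (_ + _).
    rewrite mulr_sumr; apply: eq_bigr => z _; rewrite subr_eq0 eq_sym.
    by case: eqP => [->|]; rewrite ?mulr0 //=; ring.
  rewrite sum_Phi_even //.
  transitivity (16 * \sum_(t <- trip K n%:Z) (t.2.1 * t.2.2 - 6 * t.1 ^+ 2) * chi t.2.2 * t.2.1 ^+ 2
     - 4 * \sum_(t <- trip K n%:Z) (t.2.1 * t.2.2 - 6 * t.1 ^+ 2) * chi t.2.1 * t.2.1 ^+ 2).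
    rewrite !mulr_sumr -sumrB; apply: eq_bigr => t _; ring.
  rewrite (@sum_trip_swap _ _ (fun i d e => (d * e - 6 * i ^+ 2) * chi d * d ^+ 2)) //.
  rewrite !mulr_sumr -sumrB; apply: eq_bigr => t _; ring.
have [[k hk]|nsq] := pselect (exists k : nat, n = (k * k)%N); last first.
  rewrite sum_Phi_nonsquare // => [|k hk]; last by apply: nsq; exists k.
  rewrite big1 ?mulr0 ?addr0 // => z _; case: eqP => // hz; case: nsq.
  by exists (absz z); nia.
rewrite hk sum_Phi_square; [|lia|lia].
have -> : \sum_(z <- zrange K) (z ^+ 2 == (k * k)%N%:Z)%:R = 2 :> int.
  have kK : (k <= K)%N by nia.
  have k0 : (0 < k)%N by lia.
  rewrite (eq_bigr (fun z => (z == k%:Z)%:R + (z == - k%:Z)%:R)); last first.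
    move=> z _; rewrite PoszM -expr2 eqf_sqr.
    by do ![case: eqP => ?] => //; lia.
  by rewrite big_split /= !sum_eq1 ?zrange_uniq ?mem_zrange //; lia.
by rewrite PoszM; ring.
Qed.

(* The number of v in [-K, K]^d with |v|^2 = m. *)
Fixpoint nsq (K d : nat) (m : int) : int :=
  if d is d'.+1 then \sum_(z <- zrange K) nsq K d' (m - z ^+ 2) else (m == 0)%:R.

Lemma nsq_lt0 K d m : m < 0 -> nsq K d m = 0.
Proof.
elim: d m => [|d IH] m m0 /=; first by case: eqP => //; lia.
by rewrite big1 // => z _; apply: IH; nia.
Qed.

Lemma nsq_0 K d : nsq K d 0 = 1.
Proof.
elim: d => [|d IH] //=.
rewrite (bigD1_seq 0) ?zrange_uniq ?mem_zrange //= expr0n /= subr0 IH.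
by rewrite big1 ?addr0 // => z z0; apply: nsq_lt0; nia.
Qed.

(* Symmetry of the sphere in its coordinates. *)
Lemma nsq_moment K d m :
  m * nsq K d.+1 m = d.+1%:Z * \sum_(z <- zrange K) z ^+ 2 * nsq K d (m - z ^+ 2).
Proof.
elim: d m => [|d IH] m.
  rewrite /= mul1r mulr_sumr; apply: eq_bigr => z _; rewrite subr_eq0.
  by case: eqP => [->|]; rewrite ?mulr0.
rewrite -[nsq K d.+2 m]/(\sum_(z <- zrange K) nsq K d.+1 (m - z ^+ 2)).
transitivity (\sum_(z <- zrange K) (z ^+ 2 * nsq K d.+1 (m - z ^+ 2)) +
   d.+1%:Z * \sum_(z <- zrange K) \sum_(y <- zrange K)
      y ^+ 2 * nsq K d (m - z ^+ 2 - y ^+ 2)).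
  rewrite [LHS]mulr_sumr [in RHS]mulr_sumr -big_split; apply: eq_bigr => z _.
  by rewrite -IH; move: (nsq K d.+1 (m - z ^+ 2)) => u /=; ring.
rewrite exchange_big /=.
rewrite [X in _ + _ * X](_ : _ = \sum_(z <- zrange K) (z ^+ 2 * nsq K d.+1 (m - z ^+ 2))).
  by rewrite (_ : d.+2%:Z = d.+1%:Z + 1); [ring|lia].
apply: eq_bigr => y _; rewrite -mulr_sumr; congr (_ * _) => /=.
by apply: eq_bigr => z _; congr nsq; ring.
Qed.

(** In the common recursion z = 0 has the nonzero coefficient n and every other z leads to a smaller
    argument, so the value at 0 determines all others. *)
Theorem six_squares (K n : nat) : (n <= K)%N -> nsq K 6 n%:Z = e6 K n%:Z.
Proof.
elim/ltn_ind: n => n IH nK; case: (posnP n) => [->|n0].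
  rewrite nsq_0 /e6 eqxx big1 ?addr0 // => -[d e] /= /and3P[/= d0 e0 /eqP]; nia.
have h : \sum_(z <- zrange K) (n%:Z - 7 * z ^+ 2) *
   (nsq K 6 (n%:Z - z ^+ 2) - e6 K (n%:Z - z ^+ 2)) = 0.
  rewrite (eq_bigr _ (fun z _ => mulrBr _ _ _)) sumrB e6_rec // subr0.
  have := nsq_moment K 6 n%:Z.
  rewrite -[nsq K 7 n%:Z]/(\sum_(z <- zrange K) nsq K 6 (n%:Z - z ^+ 2)) => h.
  rewrite (eq_bigr _ (fun z _ => mulrBl _ _ _)) sumrB -mulr_sumr h mulr_sumr.
  by rewrite -sumrB big1 // => z _; ring.
move: (nsq K 6) (@nsq_lt0 K 6) IH h => N N0 IH.
rewrite (bigD1_seq 0) ?zrange_uniq ?mem_zrange //= big1 => [|z z0].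
  rewrite expr0n /= addr0 mulr0 !subr0 => /eqP; rewrite mulf_eq0 => /orP[|].
    by move/eqP; lia.
  by rewrite subr_eq0 => /eqP.
have [zn|zn] := leP (z ^+ 2) n%:Z.
  rewrite (_ : n%:Z - z ^+ 2 = (absz (n%:Z - z ^+ 2))%:Z); last by lia.
  by rewrite IH ?subrr ?mulr0 //; nia.
rewrite N0; last by lia.
rewrite /e6 (_ : _ == 0 = false); last by apply/eqP; lia.
rewrite big1 ?addr0 ?subr0 ?mulr0 // => -[d e] /= /and3P[/= d0 e0 /eqP]; nia.
Qed.

Ltac nlia := repeat match goal with H : ?T |- _ =>
    lazymatch T with
    | nat => fail
    | is_true (leq _ _) => fail
    | is_true (andb (leq _ _) (leq _ _)) => fail
    | @eq nat _ _ => fail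
    | _ => clear H
    end end; lia.

(** * The Kusmin-Landau inequality and van der Corput's second derivative test *)

Section KusminLandau.
Variable R : realType.
Implicit Types (a u k : nat -> R) (x y t : R).

Lemma sin_le_id x : 0 <= x -> sin x <= x.
Proof.
rewrite le_eqVlt => /predU1P[<-|x0]; first by rewrite sin0.
have [c _ h] : exists2 c, c \in `]0, x[%R & sin x - sin 0 = cos c * (x - 0).
  apply: MVT => //.
  by apply: continuous_subspaceT => y; exact: continuous_sin.
have := cos_le1 c; move: h; rewrite sin0 !subr0 => ->; nra.
Qed.

Lemma cos_ge_quadratic x : 0 <= x -> 1 - x ^+ 2 / 2 <= cos x.
Proof.
move=> x0; have h : cos x = 1 - 2 * sin (x / 2) ^+ 2.
  rewrite {1}(_ : x = x / 2 + x / 2); last by field.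
  by rewrite cosD -!expr2 cos2sin2; ring.
have s1 : sin (x / 2) <= x / 2 by apply: sin_le_id; qlra.
have [s0|s0] := leP 0 (sin (x / 2)).
  have : sin (x / 2) ^+ 2 <= (x / 2) ^+ 2 by rewrite !expr2; nra.
  rewrite h; nra.
have := cos_le1 x.
(* A negative sine forces x >= 2 pi, where the claimed lower bound lies below -1. *)
have x4 : pi <= x / 2.
  rewrite leNgt; apply/negP => xp; have := @sin_ge0_pi R (x / 2).
  by rewrite (ltW xp) andbT divr_ge0 // => /(_ isT); qlra.
have := @pi_ge2 R; have := cos_geN1 x; nra.
Qed.

Lemma sin_ge_half x : 0 <= x <= 1 -> x / 2 <= sin x.
Proof.
move=> /andP[]; rewrite le_eqVlt => /predU1P[<- _|x0 x1]; first by rewrite sin0 mul0r.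
have [c] : exists2 c, c \in `]0, x[%R & sin x - sin 0 = cos c * (x - 0).
  apply: MVT => //.
  by apply: continuous_subspaceT => y; exact: continuous_sin.
rewrite in_itv /= sin0 !subr0 => /andP[c0 cx] ->.
have := @cos_ge_quadratic c (ltW c0); have : c ^+ 2 <= 1 by nra.
by move=> h1 h2; rewrite mulrC ler_pM2r //; qlra.
Qed.

Lemma cosD2piz x (m : int) : cos (x + 2 * pi * m%:~R) = cos x.
Proof.
have per n y : cos (y + 2 * pi * n%:R) = cos y :> R.
  by rewrite mulr_natr (_ : 2 * pi = pi *+ 2) ?mulr_natl // (periodicn (@cosD2pi R)).
case: m => n; first exact: per.
rewrite NegzE mulrNz mulrN -[LHS](per n.+1); congr cos.
by rewrite -pmulrn; ring.
Qed.

(** Summation by parts; since k is monotone, its total variation telescopes to k n - k 0. *)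
Lemma abel_monotone k u n :
  (forall i, (i < n)%N -> k i <= k i.+1) -> (forall i, `|u i| <= 1) ->
  `|\sum_(0 <= i < n.+1) k i * (u i.+1 - u i) - k n * u n.+1|
    <= `|k 0%N| + (k n - k 0%N).
Proof.
move=> mk u1; elim: n mk => [|n IH] mk.
  rewrite big_nat1 (_ : _ - _ = - (k 0%N * u 0%N)); last by ring.
  by rewrite normrN normrM subrr addr0 ler_piMr.
rewrite big_nat_recr //=.
have /IH {}IH : forall i, (i < n)%N -> k i <= k i.+1 by move=> i hi; apply: mk; nlia.
have kn := mk n (ltnSn n).
set S := \sum_(0 <= i < n.+1) _ in IH *.
rewrite (_ : _ - _ = (S - k n * u n.+1) - (k n.+1 - k n) * u n.+1); last by ring.
apply: (le_trans (ler_normB _ _)).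
have : `|(k n.+1 - k n) * u n.+1| <= k n.+1 - k n.
  by rewrite normrM (ger0_norm (_ : 0 <= k n.+1 - k n)) ?subr_ge0 // ler_piMr ?subr_ge0.
by move: IH; qlra.
Qed.

Definition cothalf x : R := cos (x / 2) / sin (x / 2).

(** The real part of e^(ix) = (e^(i(x+d)) - e^(ix)) / (e^(id) - 1), using 1 / (e^(id) - 1) = - 1/2 -
    (i/2) cot (d/2). *)
Lemma cos_cothalf x d : sin (d / 2) != 0 ->
  cos x = - 2^-1 * (cos (x + d) - cos x)
          + 2^-1 * (cothalf d * (sin (x + d) - sin x)).
Proof.
move=> s0; set m := x + d / 2.
have -> : x + d = m + d / 2 by rewrite /m; field.
have -> : x = m - d / 2 by rewrite /m; ring.
by rewrite cosB sinB cosD sinD /cothalf; field.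
Qed.

Lemma sin_ge_mid t x : 0 <= t <= 1 -> t <= x <= pi - t -> t / 2 <= sin x.
Proof.
move=> t01 /andP[tx xt]; apply: (le_trans (sin_ge_half t01)).
have p2 := @pi_ge2 R; move: t01 => /andP[t0 t1].
have mono y : t <= y <= pi / 2 -> sin t <= sin y.
  move=> /andP[ty yp]; rewrite leNgt; apply/negP.
  by rewrite ltr_sin ?in_itv /=; [qlra|apply/andP; split; qlra|apply/andP; split; qlra].
have [xp|xp] := leP x (pi / 2); first by apply: mono; rewrite tx.
rewrite (_ : sin x = sin (pi - x)); last by rewrite sinB sinpi cospi; ring.
by apply: mono; apply/andP; split; qlra.
Qed.

(** Each cosine is a difference weighted by the cotangent of half the increment. These cotangents
    increase, because the increments decrease inside (0, 2 pi), and are at most 4 / t because sin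
    (d/2) >= t / 4; summation by parts then gives 1 + 8 / t. *)
Lemma kusmin_landau0 a n t : 0 < t <= 1 ->
  (forall i, (i < n)%N -> t <= a i.+1 - a i <= 2 * pi - t) ->
  (forall i, (i.+1 < n)%N -> a i.+2 - a i.+1 <= a i.+1 - a i) ->
  `|\sum_(0 <= i < n) cos (a i)| <= 9 / t.
Proof.
move=> /andP[t0 t1] ran mono.
have tV : 1 <= t^-1 by rewrite -[leLHS]invr1 lef_pV2 ?posrE //; qlra.
case: n ran mono => [|n] ran mono; first by rewrite big_nil normr0 divr_ge0 // ltW.
pose d i := a i.+1 - a i.
have sinlow i : (i < n.+1)%N -> t / 4 <= sin (d i / 2).
  move=> /ran /andP[r1 r2]; rewrite (_ : t / 4 = (t / 2) / 2); last by field.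
  by apply: sin_ge_mid; apply/andP; split; rewrite /d; qlra.
have s0 i : (i < n.+1)%N -> 0 < sin (d i / 2) by move=> /sinlow; qlra.
pose K i := if (i < n.+1)%N then cothalf (d i) else cothalf (d n).
have Kb i : `|K i| <= 4 / t.
  wlog iN : i / (i < n.+1)%N.
    move=> h; case: (ltnP i n.+1) => iN; first exact: h.
    by rewrite /K ltnNge iN /= -/(cothalf (d n)); have := h n (ltnSn n); rewrite /K ltnSn.
  rewrite /K iN /cothalf normrM normfV (gtr0_norm (s0 _ iN)).
  rewrite ler_pdivrMr ?s0 //; apply: (le_trans (cos_max _)).
  have := sinlow _ iN => h.
  by rewrite -[leLHS](@divff _ t) ?gt_eqF // -mulrA (mulrC t^-1) mulrA ler_pM2r ?invr_gt0 //; qlra.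
have mK i : (i < n)%N -> K i <= K i.+1.
  move=> iN; rewrite /K !ifT; [|nlia|nlia].
  have s1 := s0 i (ltnW iN : (i < n.+1)%N); have s2 := s0 i.+1 iN.
  rewrite -subr_ge0 /cothalf.
  rewrite (_ : _ - _ = sin (d i / 2 - d i.+1 / 2) / (sin (d i / 2) * sin (d i.+1 / 2))).
    apply: divr_ge0; last by rewrite mulr_ge0 // ltW.
    have := mono i iN; have /andP[] := ran i (ltnW iN : (i < n.+1)%N).
    have /andP[] := ran i.+1 iN; rewrite /d => *; apply: sin_ge0_pi.
    by apply/andP; split; qlra.
  by rewrite sinB; field; rewrite !gt_eqF.
have -> : \sum_(0 <= i < n.+1) cos (a i) =
    - 2^-1 * (cos (a n.+1) - cos (a 0%N)) +
    2^-1 * \sum_(0 <= i < n.+1) K i * (sin (a i.+1) - sin (a i)).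
  rewrite -(telescope_sumr (fun i => cos (a i))) // !mulr_sumr -big_split /=.
  rewrite !big_nat; apply: eq_bigr => i /andP[_ iN].
  rewrite {1}(cos_cothalf (a i) (d := d i)); last by rewrite gt_eqF ?s0.
  by rewrite /K iN (_ : a i + d i = a i.+1) // /d; ring.
have := @abel_monotone K (fun i => sin (a i)) n mK (fun i => sin_max (a i)).
set S := \sum_(0 <= i < n.+1) _ => hS.
have h1 : `|cos (a n.+1) - cos (a 0%N)| <= 2.
  by apply: (le_trans (ler_normB _ _)); have := cos_max (a n.+1); have := cos_max (a 0%N); qlra.
have h2 : `|S| <= 16 / t.
  rewrite (_ : S = (S - K n * sin (a n.+1)) + K n * sin (a n.+1)); last by ring.
  apply: (le_trans (ler_normD _ _)).
  have : `|K n * sin (a n.+1)| <= 4 / t.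
    by rewrite normrM; apply: (le_trans _ (Kb n)); rewrite ler_piMr // sin_max.
  have /andP[? ?] : - (4 / t) <= K n <= 4 / t by rewrite -ler_norml.
  have /andP[? ?] : - (4 / t) <= K 0%N <= 4 / t by rewrite -ler_norml.
  have := Kb 0%N; qlra.
apply: (le_trans (ler_normD _ _)); rewrite !normrM normrN.
rewrite (ger0_norm (_ : 0 <= 2^-1)) //; qlra.
Qed.

(** Subtracting 2 pi m i from the i-th phase leaves the cosines unchanged and brings the increments
    back to (0, 2 pi). *)
Lemma kusmin_landau a p r t (m : int) : 0 < t <= 1 ->
  (forall i, (p <= i < r)%N ->
     2 * pi * m%:~R + t <= a i.+1 - a i <= 2 * pi * (m%:~R + 1) - t) ->
  (forall i, (p <= i)%N -> (i.+1 < r)%N -> a i.+2 - a i.+1 <= a i.+1 - a i) ->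
  `|\sum_(p <= i < r) cos (a i)| <= 9 / t.
Proof.
move=> t01 ran mono.
pose b i := a (i + p)%N + 2 * pi * ((- m * i%:Z)%:~R).
rewrite -{1}[p]add0n big_addn (eq_bigr (fun i => cos (b i))); last first.
  by move=> i _; rewrite cosD2piz.
have bE i : b i.+1 - b i = a (i + p).+1 - a (i + p)%N - 2 * pi * m%:~R.
  by rewrite /b addSn intS !mulrDr !intrM !intrD !mulrNz; ring.
apply: kusmin_landau0 => // i iN.
  rewrite bE; have /ran /andP[h1 h2] : (p <= i + p < r)%N by nlia.
  by apply/andP; split; qlra.
rewrite !bE; have := mono (i + p)%N; rewrite addSn => /(_ ltac:(nlia) ltac:(nlia)); qlra.
Qed.


Lemma nonincreasing_split (d : nat -> R) p n c : (p <= n)%N ->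
  (forall i, (p <= i)%N -> (i.+1 < n)%N -> d i.+1 <= d i) ->
  exists r, [/\ (p <= r <= n)%N, (forall i, (p <= i < r)%N -> c < d i) &
                (forall i, (r <= i < n)%N -> d i <= c)].
Proof.
elim: n => [|n IH] pn mono; first by exists 0%N; split => [|i|i]; nlia.
case: (ltnP n p) => np; first by exists p; split => // [|i|i]; nlia.
have [|r [/andP[pr rn] h1 h2]] := IH np; first by move=> i hi hn; apply: mono; nlia.
case: (ltnP r n) => rn'.
  exists r; split => // [|i /andP[ri iN]]; first by nlia.
  case: (ltnP i n) => iN'; first by apply: h2; nlia.
  have -> : i = n.-1.+1 by nlia.
  apply: (le_trans (mono _ _ _)); [nlia|nlia|]; apply: h2; nlia.
have rE : r = n by nlia.
have [dn|dn] := leP (d n) c.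
  by exists n; split => [|i hi|i hi]; [nlia|apply: h1; nlia|have -> : i = n by nlia].
exists n.+1; split => [|i hi|i hi]; [nlia| |nlia].
by case: (ltnP i n) => iN; [apply: h1; nlia|have -> : i = n by nlia].
Qed.

(** Counts the terms whose increments are too close to a multiple of 2 pi for the Kusmin-Landau
    inequality. *)
Lemma steep_count (d : nat -> R) c p n m l : 0 < m -> 0 <= l ->
  (forall i, (p <= i)%N -> (i.+1 < n)%N -> d i.+1 + m <= d i) ->
  (forall i, (p <= i < n)%N -> c <= d i <= c + l) ->
  (n - p)%:R <= l / m + 1.
Proof.
move=> m0 l0 steep ran.
case: (leqP n p) => np.
  rewrite (_ : (n - p)%N = 0%N); last by nlia.
  by rewrite addr_ge0 // divr_ge0 // ltW.
have key j : (p + j < n)%N -> d (p + j)%N + j%:R * m <= d p.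
  elim: j => [|j IH] hj; first by rewrite addn0 mul0r addr0.
  have := steep (p + j)%N; rewrite -addnS => /(_ ltac:(nlia) ltac:(nlia)).
  have := IH ltac:(nlia); rewrite -natr1; qlra.
have := key (n - p).-1 ltac:(nlia).
have /ran /andP[] : (p <= p + (n - p).-1 < n)%N by nlia.
have /ran /andP[] : (p <= p < n)%N by nlia.
move=> h1 h2 h3 h4 h5.
rewrite -lerBlDr ler_pdivlMr // (_ : (n - p)%:R - 1 = (n - p).-1%:R); first qlra.
by rewrite -[in LHS](@prednK (n - p)) ?subn_gt0 // -natr1 addrK.
Qed.

Lemma norm_sum_cos_le a p n : `|\sum_(p <= i < n) cos (a i)| <= (n - p)%:R.
Proof.
apply: (le_trans (ler_norm_sum _ _ _)).
rewrite -sumr_const_nat; apply: ler_sum => i _; exact: cos_max.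
Qed.

(** The increments start in [2 pi k, 2 pi (k + 1)[ and lose at most pi, so 2 pi (k + 1) and 2 pi k
    are the only multiples they can come near. With t = sqrt m, at most 1 / t + 1 of them lie within
    t below the first and at most 2 / t + 1 within t of the second; the two remaining stretches cost
    9 / t each. The total 21 / t + 2 is at most 23 / t. *)
Lemma vdc_block a p n m : 0 < m <= 1 -> (p <= n)%N ->
  (forall i, (p <= i)%N -> (i.+1 < n)%N ->
      a i.+2 - a i.+1 + m <= a i.+1 - a i) ->
  (forall i, (p <= i < n)%N -> a p.+1 - a p - pi <= a i.+1 - a i) ->
  `|\sum_(p <= i < n) cos (a i)| <= 23 / Num.sqrt m.
Proof.
move=> /andP[m0 m1] pn steep ran.
set t := Num.sqrt m.
have t0 : 0 < t by rewrite sqrtr_gt0.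
have t2 : t ^+ 2 = m by rewrite sqr_sqrtr // ltW.
have t1 : t <= 1 by rewrite -(@ler_pXn2r _ 2) ?nnegrE // ?t2 ?expr1n // ltW.
have t01 : 0 < t <= 1 by rewrite t0.
have p2 := @pi_ge2 R.
pose d i := a i.+1 - a i.
have mono i : (p <= i)%N -> (i.+1 < n)%N -> d i.+1 <= d i.
  by move=> h1 h2; have := steep i h1 h2; rewrite /d; qlra.
pose k := Num.floor (d p / (2 * pi)).
have pi0 : 0 < 2 * pi :> R by qlra.
have k1 : 2 * pi * k%:~R <= d p by rewrite mulrC -ler_pdivlMr // floor_le.
have k2 : d p < 2 * pi * (k%:~R + 1).
  by rewrite mulrC -ltr_pdivrMr // -[1]/(1%:~R) -intrD; exact: floorD1_gt.
have dp i : (p <= i < n)%N -> d i <= d p.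
  move=> /andP[]; elim: i => [|i IH] h1 h2; first by have -> : p = 0%N by nlia.
  case: (ltnP i p) => ip; first by have -> : p = i.+1 by nlia.
  by apply: (le_trans (mono i ip h2)); apply: IH => //; nlia.
have tV : 1 <= t^-1 by rewrite -[leLHS]invr1 lef_pV2 ?posrE //; qlra.
have tm : t / m = t^-1 by rewrite -t2; field; rewrite gt_eqF.
have [r1 [/andP[pr1 r1n] A1 A2]] :=
  @nonincreasing_split d p n (2 * pi * (k%:~R + 1) - t) pn mono.
have [r2 [/andP[r12 r2n] B1 B2]] := @nonincreasing_split d r1 n (2 * pi * k%:~R + t) r1n
  (fun i hi hn => mono i (leq_trans pr1 hi) hn).
have [r3 [/andP[r23 r3n] C1 C2]] := @nonincreasing_split d r2 n (2 * pi * k%:~R - t) r2n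
  (fun i hi hn => mono i (leq_trans pr1 (leq_trans r12 hi)) hn).
rewrite (@big_cat_nat _ _ _ r1) //= (@big_cat_nat _ _ _ r2 r1) //= (@big_cat_nat _ _ _ r3 r2) //=.
have hA : `|\sum_(p <= i < r1) cos (a i)| <= t^-1 + 1.
  apply: (le_trans (norm_sum_cos_le _ _ _)); rewrite -tm.
  apply: (@steep_count d (2 * pi * (k%:~R + 1) - t)) => //; first exact: ltW.
    by move=> i hi hn; rewrite -lerBrDr lerBrDr; apply: steep => //; nlia.
  move=> i hi; have := A1 i hi; have := dp i ltac:(nlia); move=> *; apply/andP; split; qlra.
have hB : `|\sum_(r1 <= i < r2) cos (a i)| <= 9 / t.
  apply: (@kusmin_landau a _ _ t k) => //.
    move=> i hi; have := A2 i ltac:(nlia); have := B1 i hi; rewrite /d => *.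
    by apply/andP; split; qlra.
  by move=> i h1 h2; have := mono i ltac:(nlia) ltac:(nlia); rewrite /d.
have hC : `|\sum_(r2 <= i < r3) cos (a i)| <= 2 * t^-1 + 1.
  apply: (le_trans (norm_sum_cos_le _ _ _)).
  rewrite -tm mulrA.
  apply: (@steep_count d (2 * pi * k%:~R - t)) => //; first by qlra.
    by move=> i hi hn; apply: steep; nlia.
  move=> i hi; have := C1 i hi; have := B2 i ltac:(nlia); move=> *; apply/andP; split; qlra.
have hD : `|\sum_(r3 <= i < n) cos (a i)| <= 9 / t.
  apply: (@kusmin_landau a _ _ t (k - 1)) => //.
    move=> i hi; have := C2 i ltac:(nlia); have := ran i ltac:(nlia).
    rewrite intrB (_ : 1%:~R = 1 :> R) // => h1 h2.
    have k1' : 2 * pi * k%:~R <= a p.+1 - a p := k1.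
    by apply/andP; split; rewrite /d in h2; qlra.
  by move=> i h1 h2; have := mono i ltac:(nlia) ltac:(nlia); rewrite /d.
apply: (le_trans (ler_normD _ _)).
apply: (le_trans (lerD hA (le_trans (ler_normD _ _)
  (lerD hB (le_trans (ler_normD _ _) (lerD hC hD)))))).
qlra.
Qed.

Lemma vdc_second a n m M : 0 < m -> 1 <= M ->
  (forall i, (i.+1 < n)%N ->
     m <= (a i.+1 - a i) - (a i.+2 - a i.+1) <= M * m) ->
  `|\sum_(0 <= i < n) cos (a i)| <= 23 * M * (n%:R * Num.sqrt m + (Num.sqrt m)^-1).
Proof.
move=> m0 M1 curv; have s0 : 0 < Num.sqrt m by rewrite sqrtr_gt0.
have s2 : Num.sqrt m ^+ 2 = m by rewrite sqr_sqrtr // ltW.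
have [m1|m1] := leP m 1; last first.
  apply: (le_trans (norm_sum_cos_le _ _ _)); rewrite subn0.
  have s1 : 1 <= Num.sqrt m by rewrite -sqrtr1 ler_sqrt // ltW.
  have : 0 <= n%:R * Num.sqrt m by rewrite mulr_ge0 // ltW.
  have : n%:R * 1 <= n%:R * Num.sqrt m by rewrite ler_wpM2l.
  have : 0 < (Num.sqrt m)^-1 by rewrite invr_gt0.
  by move: (n%:R * Num.sqrt m) (_^-1) => u v; nra.
(* On a block of length l the increments fall by at most (l - 1) M m <= 1 <= pi, and n M m + 1
   blocks suffice. *)
pose l := (Num.truncn (M * m)^-1).+1.
have Mm : 0 < M * m by nra.
have l1 : 1 <= l%:R * (M * m).
  by rewrite -ler_pdivrMr // div1r ltW // truncnS_gt.
have l2 : l.-1%:R * (M * m) <= 1.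
  by rewrite -ler_pdivlMr // div1r truncn_le // invr_ge0 ltW.
have p2 := @pi_ge2 R.
have block p r : (p <= r)%N -> (r <= n)%N -> (r - p <= l)%N ->
    `|\sum_(p <= i < r) cos (a i)| <= 23 / Num.sqrt m.
  move=> pr rn rpl; apply: vdc_block => //; first by rewrite m0.
    move=> i hi ir; have /curv /andP[h1 h2] : (i.+1 < n)%N by nlia.
    qlra.
  move=> i /andP[hpi ir].
  have key j : (p + j < r)%N ->
      a p.+1 - a p - j%:R * (M * m) <= a (p + j).+1 - a (p + j)%N.
    elim: j => [|j IH] hj; first by rewrite addn0; qlra.
    have h1 := IH ltac:(nlia); have /curv /andP[_ h2] : ((p + j).+1 < n)%N by nlia.
    rewrite addnS -natr1; qlra.
  have := key (i - p)%N ltac:(nlia); rewrite subnKC //.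
  suff : (i - p)%:R * (M * m) <= 1 by qlra.
  by apply: le_trans l2; rewrite ler_pM2r // ler_nat; nlia.
have main (N : nat) p : (n - p <= N)%N -> (p <= n)%N ->
    `|\sum_(p <= i < n) cos (a i)| <= ((n - p)%:R * (M * m) + 1) * (23 / Num.sqrt m).
  have c0 : 0 <= 23 / Num.sqrt m by rewrite divr_ge0 // ltW.
  elim: N p => [|N IH] p hk pn.
    apply: (le_trans (block _ _ _ _ _)) => //; first by nlia.
    by rewrite ler_peMl // lerDr mulr_ge0 // ltW.
  case: (leqP (n - p) l) => hl.
    apply: (le_trans (block _ _ _ _ _)) => //.
    by rewrite ler_peMl // lerDr mulr_ge0 // ltW.
  have plp : (p <= p + l)%N by nlia.
  have pln : (p + l <= n)%N by nlia.
  rewrite (@big_cat_nat _ _ _ (p + l)) //=.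
  apply: (le_trans (ler_normD _ _)).
  have := block p (p + l)%N plp pln ltac:(nlia).
  have := IH (p + l)%N ltac:(rewrite /l in hl *; nlia) pln.
  have -> : (n - p)%:R = (n - (p + l))%:R + l%:R :> R by rewrite -natrD; congr _%:R; nlia.
  move: (23 / _) c0 => c c0; move: (n - (p + l))%:R => u; nra.
apply: (le_trans (main n 0%N _ _)) => //; first by rewrite subn0.
rewrite subn0 (_ : _ * (23 / _) = 23 * (n%:R * M * Num.sqrt m + (Num.sqrt m)^-1)); last first.
  by rewrite -{1}s2; field; rewrite gt_eqF.
have : 0 < (Num.sqrt m)^-1 by rewrite invr_gt0.
by move: (n%:R) (Num.sqrt m) (_^-1) => u v w; nra.
Qed.

End KusminLandau.

(** * Fourier expansion of the second Bernoulli polynomial *)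

Section Fourier.
Variable R : realType.
Implicit Types (x y t s d : R) (N : nat).

Definition fr x : R := x - (Num.floor x)%:~R.
Definition psi x : R := fr x - 2^-1.
Definition bern x : R := fr x ^+ 2 - fr x.

Lemma frE x (m : int) : m%:~R <= x < m%:~R + 1 -> fr x = x - m%:~R.
Proof. by move=> h; rewrite /fr (@floor_def _ _ m) // intrD. Qed.

Lemma fr_itv x : 0 <= fr x < 1.
Proof.
have := floor_itv x; rewrite intrD (_ : 1%:~R = 1 :> R) // => /andP[h1 h2].
by rewrite /fr; apply/andP; split; qlra.
Qed.

Lemma fr_add x d : 0 <= d <= 1 ->
  (fr x + d < 1 /\ fr (x + d) = fr x + d) \/ (1 <= fr x + d /\ fr (x + d) = fr x + d - 1).
Proof.
move=> /andP[d0 d1]; have /andP[f0 f1] := fr_itv x.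
have xE : x = fr x + (Num.floor x)%:~R by rewrite /fr; ring.
have [h|h] := ltP (fr x + d) 1; [left|right]; split => //.
  rewrite (@frE _ (Num.floor x)); first by rewrite /fr; ring.
  by apply/andP; split; qlra.
rewrite (@frE _ (Num.floor x + 1)); rewrite intrD (_ : 1%:~R = 1 :> R) //.
  by rewrite /fr; ring.
by apply/andP; split; qlra.
Qed.

(** [bern] is a primitive of 2 [psi], and [psi] jumps only downwards, so psi (x + s) <= psi x + s
    for s >= 0. With [bern_left] this encloses [psi] between two difference quotients of [bern],
    whose Fourier series converges absolutely. *)
Lemma bern_right x d : 0 <= d <= 1 -> bern (x + d) - bern x <= 2 * d * psi x + d ^+ 2.
Proof.
move=> d01; rewrite /bern /psi; have /andP[f0 f1] := fr_itv x.
case: (fr_add x d01) => -[h ->]; first by rewrite le_eqVlt; apply/orP; left; apply/eqP; field.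
have d0 : 0 <= d by case/andP: d01.
have d1 : d <= 1 by case/andP: d01.
rewrite !expr2; nra.
Qed.

Lemma bern_left x d : 0 <= d <= 1 -> 2 * d * psi x - d ^+ 2 <= bern x - bern (x - d).
Proof.
move=> d01; rewrite /bern /psi; have /andP[f0 f1] := fr_itv (x - d).
have := fr_add (x - d) d01; rewrite subrK.
have d0 : 0 <= d by case/andP: d01.
have d1 : d <= 1 by case/andP: d01.
case=> -[h ->].
  by rewrite le_eqVlt; apply/orP; left; apply/eqP; field.
rewrite !expr2; nra.
Qed.

Definition cosum N t : R := \sum_(1 <= h < N.+1) cos (2 * pi * h%:R * t) / h%:R ^+ 2.
Definition sinsum N t : R := \sum_(1 <= h < N.+1) sin (2 * pi * h%:R * t) / h%:R.

Lemma cosum_fr N t : cosum N t = cosum N (fr t).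
Proof.
apply: eq_bigr => h _; congr (_ / _).
rewrite /fr mulrBr -[RHS](cosD2piz _ (h%:Z * Num.floor t)) intrM -pmulrn.
by congr cos; ring.
Qed.

Lemma is_derive_cosum N t : is_derive t 1 (cosum N) (- 2 * pi * sinsum N t).
Proof.
elim: N => [|N IH].
  rewrite /sinsum big_nil mulr0 (_ : cosum 0 = cst 0); first exact: is_derive_cst.
  by apply/funext => s; rewrite /cosum big_nil.
have -> : cosum N.+1 = cosum N + (fun t => cos (2 * pi * N.+1%:R * t) / N.+1%:R ^+ 2).
  by apply/funext => s; rewrite /cosum big_nat_recr.
have N0 : N.+1%:R != 0 :> R by rewrite pnatr_eq0.
have dc : is_derive t 1 (fun t => cos (2 * pi * N.+1%:R * t) / N.+1%:R ^+ 2)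
    (- 2 * pi * sin (2 * pi * N.+1%:R * t) / N.+1%:R).
  apply: is_derive_eq; rewrite !scaler0 /GRing.scale /=.
  by rewrite add0r mulr1; field; rewrite -?natr1 -?nat1r.
apply: (is_derive_eq (is_deriveD IH dc)).
by rewrite {2}/sinsum big_nat_recr //= -/(sinsum N t); ring.
Qed.

Lemma is_derive_sinsum N t :
  is_derive t 1 (sinsum N) (2 * pi * \sum_(1 <= h < N.+1) cos (2 * pi * h%:R * t)).
Proof.
elim: N => [|N IH].
  rewrite big_nil mulr0 (_ : sinsum 0 = cst 0); first exact: is_derive_cst.
  by apply/funext => s; rewrite /sinsum big_nil.
have -> : sinsum N.+1 = sinsum N + (fun t => sin (2 * pi * N.+1%:R * t) / N.+1%:R).
  by apply/funext => s; rewrite /sinsum big_nat_recr.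
have N0 : N.+1%:R != 0 :> R by rewrite pnatr_eq0.
have dc : is_derive t 1 (fun t => sin (2 * pi * N.+1%:R * t) / N.+1%:R)
    (2 * pi * cos (2 * pi * N.+1%:R * t)).
  apply: is_derive_eq; rewrite !scaler0 /GRing.scale /=.
  by rewrite add0r mulr1; field; rewrite -?natr1 -?nat1r.
apply: (is_derive_eq (is_deriveD IH dc)).
by rewrite [in RHS]big_nat_recr //=; ring.
Qed.

Lemma dirichlet_kernel N t :
  sin (pi * t) * (1 + 2 * \sum_(1 <= h < N.+1) cos (2 * pi * h%:R * t)) =
  sin ((2 * N%:R + 1) * (pi * t)).
Proof.
elim: N => [|N IH]; first by rewrite big_nil !mulr0 addr0 add0r mulr1 mul1r.
rewrite big_nat_recr //=; set S := \sum_(1 <= h < N.+1) _ in IH *.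
rewrite (_ : sin _ * _ = sin (pi * t) * (1 + 2 * S) +
  2 * (sin (pi * t) * cos (2 * pi * N.+1%:R * t))); last by ring.
rewrite IH.
set u := pi * t; set v := (2 * N%:R + 2) * u.
have -> : 2 * pi * N.+1%:R * t = v by rewrite /v /u -natr1; ring.
have -> : (2 * N.+1%:R + 1) * u = v + u by rewrite /v -natr1; ring.
have -> : (2 * N%:R + 1) * u = v - u by rewrite /v; ring.
by rewrite sinB sinD; ring.
Qed.

Lemma sin_pi_ge (e t : R) : 0 < e <= 1/2 -> e <= t <= 1 - e ->
  sin (pi * e) <= sin (pi * t).
Proof.
move=> /andP[e0 e1] /andP[et te]; have p2 := @pi_ge2 R.
have mono y : e <= y <= 1/2 -> sin (pi * e) <= sin (pi * y).
  move=> /andP[ey yp]; rewrite leNgt; apply/negP.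
  rewrite ltr_sin ?in_itv /=; [by nra|apply/andP; split; nra|apply/andP; split; nra].
have [xp|xp] := leP t (1/2); first by apply: mono; rewrite et.
rewrite (_ : sin (pi * t) = sin (pi * (1 - t))).
  by apply: mono; apply/andP; split; qlra.
by rewrite mulrBr mulr1 [RHS]sinB sinpi cospi; ring.
Qed.

Lemma mvt_bound (f df : R -> R) (a b K : R) :
  (forall x, a <= x <= b -> is_derive x 1 f (df x)) ->
  (forall x, a <= x <= b -> `|df x| <= K) ->
  forall x y, a <= x <= b -> a <= y <= b -> `|f x - f y| <= K * `|x - y|.
Proof.
move=> fd Kb x y; wlog xy : x y / y <= x.
  move=> h hx hy; have [yx|xy] := leP y x; first exact: h.
  by rewrite distrC (distrC x); apply: h => //; exact: ltW.
move=> /andP[ax xb] /andP[ay yb].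
have sub z : z \in `[y, x] -> a <= z <= b.
  by rewrite in_itv /= => /andP[h1 h2]; apply/andP; split; qlra.
have [| |c hc ->] := @MVT_segment R f df y x xy.
- by move=> z hz; apply: fd; apply: sub; exact: subset_itv_oo_cc hz.
- apply: derivable_within_continuous => z hz.
  exact: (@ex_derive _ _ _ _ _ _ _ (fd z (sub z hz))).
by rewrite normrM ler_wpM2r //; apply: Kb; exact: sub.
Qed.

Lemma cos_lipschitz x y : `|cos x - cos y| <= `|x - y|.
Proof.
rewrite -[leRHS]mul1r.
apply: (@mvt_bound cos (fun z => - sin z) (Num.min x y) (Num.max x y)).
- by move=> z _; rewrite normrN sin_max.
- by rewrite ge_min le_max !lexx.
- by rewrite ge_min le_max !lexx !orbT.
Qed.

Lemma sin_natpi n : sin (pi * n%:R) = 0 :> R.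
Proof.
elim: n => [|n IH]; first by rewrite mulr0 sin0.
by rewrite -natr1 mulrDr mulr1 sinD IH sinpi mulr0 mul0r addr0.
Qed.

Lemma sinsum_half N : sinsum N (1/2) = 0.
Proof.
rewrite /sinsum big1 // => h _.
by rewrite (_ : 2 * pi * h%:R * (1/2) = pi * h%:R) ?sin_natpi ?mul0r //; field.
Qed.

Lemma sinsum_bound (e : R) : 0 < e <= 1/2 -> exists2 K : R, 0 <= K &
  forall N t, e <= t <= 1 - e ->
    `|sinsum N t + pi * (t - 1/2)| <= K / (2 * N%:R + 1).
Proof.
move=> e01; have p2 := @pi_ge2 R.
set g := sin (pi * e).
have g0 : 0 < g by case/andP: e01 => e0 e1; apply: sin_gt0_pi; apply/andP; split; nra.
exists (pi / g ^+ 2 + g^-1); first by rewrite addr_ge0 ?divr_ge0 ?invr_ge0 ?sqr_ge0 //; qlra.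
move=> N t te; set M : R := 2 * N%:R + 1.
have M0 : 0 < M by rewrite /M ltr_wpDl // mulr_ge0.
have sg s : e <= s <= 1 - e -> g <= sin (pi * s) by exact: sin_pi_ge.
(* By the Dirichlet kernel the first two summands have derivative pi sin (M pi t) / sin (pi t),
   where M = 2 N + 1. The third cancels it as in an integration by parts, leaving a derivative of
   order 1 / M. All three vanish at t = 1/2. *)
pose V := sinsum N + (fun t => pi * (t - 1/2)) +
  (fun t => cos (M * (pi * t)) / M) * (fun t => (sin (pi * t))^-1).
pose dV t := - (cos (M * (pi * t)) * cos (pi * t) * pi) / (M * sin (pi * t) ^+ 2).
have VE s : V s = sinsum N s + pi * (s - 1/2) + cos (M * (pi * s)) / M / sin (pi * s) by [].
have derV s : e <= s <= 1 - e -> is_derive s 1 V (dV s).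
  move=> hs; have s0 : sin (pi * s) != 0 by rewrite gt_eqF // (lt_le_trans g0) // sg.
  have d1 := is_derive_sinsum N s.
  have d2 : is_derive s 1 (fun t => sin (pi * t)) (cos (pi * s) * pi).
    by apply: is_derive_eq; rewrite /GRing.scale /= mulr1.
  have d3 := @is_deriveV R (fun t => sin (pi * t)) s _ _ s0 d2.
  have d4 : is_derive s 1 (fun t => cos (M * (pi * t)) / M) (- sin (M * (pi * s)) * pi).
    apply: is_derive_eq; rewrite !scaler0 /GRing.scale /= add0r mulr1.
    by field; rewrite gt_eqF.
  have d5 : is_derive s 1 (fun t => pi * (t - 1/2)) pi.
    by apply: is_derive_eq; rewrite subr0 /GRing.scale /= mulr1.
  have d6 := is_deriveD (is_deriveD d1 d5) (is_deriveM d4 d3).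
  apply: (is_derive_eq d6).
  rewrite /dV /GRing.scale /= -dirichlet_kernel.
  by field; rewrite ?s0 gt_eqF.
have h1 : e <= 1/2 <= 1 - e by case/andP: e01 => *; apply/andP; split; qlra.
have V0 : V (1/2) = 0.
  rewrite VE sinsum_half subrr mulr0 addr0.
  rewrite (_ : M * (pi * (1/2)) = pi * N%:R + pi / 2); last by rewrite /M; field.
  by rewrite cosDpihalf sin_natpi oppr0 !mul0r addr0.
have dVb s : e <= s <= 1 - e -> `|dV s| <= pi / g ^+ 2 / M.
  move=> hs; have gs := sg s hs.
  have s0 : 0 < sin (pi * s) by qlra.
  rewrite /dV normrM normfV normrN !normrM (ger0_norm (_ : 0 <= pi)) ?pi_ge0 //.
  rewrite (gtr0_norm M0) (gtr0_norm s0) -expr2.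
  rewrite [leRHS](_ : _ = pi / (M * g ^+ 2)); last by field; rewrite !gt_eqF.
  apply: ler_pM; rewrite ?mulr_ge0 ?invr_ge0 ?mulr_ge0 ?sqr_ge0 ?pi_ge0 ?(ltW M0) ?(ltW s0) //.
    rewrite ler_piMl ?pi_ge0 //; apply: mulr_ile1 => //; exact: cos_max.
  rewrite lef_pV2 ?posrE ?mulr_gt0 ?exprn_gt0 // ler_pM2l // ler_pXn2r ?nnegrE //; exact: ltW.
have := @mvt_bound V dV e (1 - e) _ derV dVb t (1/2) te h1.
rewrite V0 subr0 => hV.
have t1 : `|t - 1/2| <= 1.
  by case/andP: te e01 => ? ? /andP[? ?]; rewrite ler_norml; apply/andP; split; qlra.
have gt := sg t te.
have hc : `|cos (M * (pi * t)) / M / sin (pi * t)| <= g^-1 / M.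
  rewrite !normrM !normfV (gtr0_norm M0) (gtr0_norm (lt_le_trans g0 gt)).
  rewrite mulrAC; apply: ler_pM; rewrite ?invr_ge0 ?mulr_ge0 ?invr_ge0 ?(ltW M0) //.
    by rewrite (le_trans (ltW g0)).
  rewrite -[leRHS]mul1r; apply: ler_pM; rewrite ?invr_ge0 //.
  - by rewrite (le_trans (ltW g0)).
  - exact: cos_max.
  - by rewrite lef_pV2 ?posrE // (lt_le_trans g0).
rewrite (_ : _ + _ = V t - cos (M * (pi * t)) / M / sin (pi * t)); last by rewrite VE; ring.
apply: (le_trans (ler_normB _ _)); rewrite [leRHS]mulrDl; apply: lerD; last exact: hc.
apply: (le_trans hV); rewrite ler_piMr // mulr_ge0 ?divr_ge0 ?sqr_ge0 ?pi_ge0 //.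
by rewrite invr_ge0 ltW.
Qed.

(** Each frequency h <= M is Lipschitz with constant 2 pi / h <= 2 pi, and the frequencies beyond M
    add at most 2 / M in total; the bound is therefore uniform in N. *)
Lemma cosum_near M N t s : (0 < M)%N ->
  `|cosum N t - cosum N s| <= 2 * pi * M%:R * `|t - s| + 2 / M%:R.
Proof.
move=> M0; have p0 := @pi_ge0 R.
have term h : (0 < h)%N ->
   `|cos (2 * pi * h%:R * t) / h%:R ^+ 2 - cos (2 * pi * h%:R * s) / h%:R ^+ 2|
   <= 2 * pi * `|t - s|.
  move=> h0; have hR : 1 <= h%:R :> R by rewrite ler1n.
  have hp : 0 < h%:R :> R by qlra.
  rewrite -mulrBl normrM (ger0_norm (_ : 0 <= (h%:R ^+ 2)^-1)) ?invr_ge0 ?sqr_ge0 //.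
  rewrite ler_pdivrMr ?exprn_gt0 //; apply: (le_trans (cos_lipschitz _ _)).
  rewrite -mulrBr normrM ger0_norm; last by rewrite !mulr_ge0 // ltW.
  rewrite -!mulrA ler_wpM2l // ler_wpM2l // mulrC ler_wpM2l //.
  by rewrite expr2 ler_peMr // ltW.
have small n : `|cosum n t - cosum n s| <= 2 * pi * n%:R * `|t - s|.
  elim: n => [|n IH]; first by rewrite /cosum !big_nil subrr normr0 mulr0 mul0r.
  rewrite /cosum !(@big_nat_recr _ _ _ n.+1) //= -!/(cosum n _).
  rewrite opprD addrACA; apply: (le_trans (ler_normD _ _)).
  by have := term n.+1 isT; rewrite -!natr1; move: IH; qlra.
have MR : 0 < M%:R :> R by rewrite ltr0n.
case: (leqP N M) => NM.
  apply: (le_trans (small N)).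
  have : 0 <= 2 / M%:R :> R by rewrite divr_ge0.
  have : N%:R <= M%:R :> R by rewrite ler_nat.
  have : 0 <= pi * `|t - s| by rewrite mulr_ge0.
  by move: (_ / _) `|t - s| => u v; nra.
suff : `|cosum N t - cosum N s| <= 2 * pi * M%:R * `|t - s| + (2 / M%:R - 2 / N%:R).
  have : 0 <= 2 / N%:R :> R by rewrite divr_ge0.
  qlra.
have {NM} : (M <= N)%N by exact: ltnW.
elim: N => [|N IH]; first by rewrite leqn0; case: M M0 {MR}.
rewrite leq_eqVlt => /predU1P[<-|MN]; first by rewrite subrr addr0 small.
have N0 : (0 < N)%N by nlia.
have NR : 1 <= N%:R :> R by rewrite ler1n.
rewrite /cosum !(@big_nat_recr _ _ _ N.+1) //= -!/(cosum N _).
rewrite opprD addrACA; apply: (le_trans (ler_normD _ _)).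
have : `|cos (2 * pi * N.+1%:R * t) / N.+1%:R ^+ 2 - cos (2 * pi * N.+1%:R * s) / N.+1%:R ^+ 2|
   <= 2 / N%:R - 2 / N.+1%:R.
  rewrite -mulrBl normrM (ger0_norm (_ : 0 <= (N.+1%:R ^+ 2)^-1)) ?invr_ge0 ?sqr_ge0 //.
  rewrite (_ : 2 / N%:R - 2 / N.+1%:R = 2 / (N%:R * N.+1%:R)); last first.
    by rewrite -natr1; field; rewrite !gt_eqF //; qlra.
  apply: ler_pM; rewrite ?invr_ge0 ?sqr_ge0 //.
    apply: (le_trans (ler_normB _ _)).
    by have := cos_max (2 * pi * N.+1%:R * t); have := cos_max (2 * pi * N.+1%:R * s); qlra.
  by rewrite lef_pV2 ?posrE -?natr1; [nra|nra|nra].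
have h1 := IH ltac:(nlia) => h2.
apply: (le_trans (lerD h1 h2)).
by rewrite -addrA lerD2l subrKA.
Qed.

(* Only differences of the Fourier series of the second Bernoulli polynomial
   are used, so its constant term is not needed. *)
Lemma fourier_bern (e : R) : 0 < e -> exists N, forall t s,
  `|cosum N t - cosum N s - pi ^+ 2 * (bern t - bern s)| <= e.
Proof.
move=> e0; have p2 := @pi_ge2 R.
(* [M] makes the tail 2 / M at most e / 8, then [d] makes the Lipschitz part over a distance d at
   most e / 8. [N] comes last because the constant K of [sinsum_bound] depends on [d]. *)
pose M := (Num.truncn (16 / e)).+1.
have M1 : 16 / e <= M%:R by rewrite ltW // truncnS_gt.
have MR : 0 < M%:R :> R by rewrite ltr0n.
have M2 : 2 / M%:R <= e / 8.
  by move: M1; rewrite !ler_pdivrMr //; qlra.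
pose L : R := 2 * pi * M%:R + pi ^+ 2.
have L0 : 0 < L by rewrite ltr_pwDl ?sqr_ge0 // !mulr_gt0 //; qlra.
pose d := Num.min (1/2) (e / 8 / L).
have d0 : 0 < d by rewrite lt_min !divr_gt0.
have d2 : d <= 1/2 by rewrite ge_min lexx.
have dL : L * d <= e / 8 by rewrite mulrC -ler_pdivlMr // ge_min lexx orbT.
have d01 : 0 < d <= 1/2 by rewrite d0.
have [K K0 hK] := sinsum_bound d01.
pose N := (Num.truncn (16 * pi * K / e)).+1.
exists N => t s.
have NK : 2 * pi * (K / (2 * N%:R + 1)) <= e / 8.
  have h : 16 * pi * K / e < N%:R by exact: truncnS_gt.
  have NR : 0 < N%:R :> R by rewrite ltr0n.
  rewrite mulrA ler_pdivrMr; last by qlra.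
  by move: h; rewrite ltr_pdivrMr //; nra.
pose G (u : R) := cosum N u - pi ^+ 2 * (u ^+ 2 - u).
have GE u : cosum N u - pi ^+ 2 * bern u = G (fr u) by rewrite /G -cosum_fr.
have derG (u : R) : is_derive u 1 G (- 2 * pi * (sinsum N u + pi * (u - 1/2))).
  have d1 := is_derive_cosum N u.
  have d3 : is_derive u 1 (fun u => pi ^+ 2 * (u ^+ 2 - u)) (pi ^+ 2 * (2 * u - 1)).
    by apply: is_derive_eq; rewrite /GRing.scale /= !mulr1; ring.
  by apply: (is_derive_eq (is_deriveB d1 d3)); field.
have mid (u v : R) : d <= u <= 1 - d -> d <= v <= 1 - d -> `|G u - G v| <= e / 8.
  move=> hu hv; apply: (le_trans (@mvt_bound G _ d (1 - d) (e / 8) (fun z _ => derG z) _ u v hu hv)).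
    move=> z hz; rewrite normrM (_ : `|- 2 * pi| = 2 * pi :> R); last first.
      by rewrite mulNr normrN ger0_norm // mulr_ge0 // pi_ge0.
    by apply: le_trans NK; rewrite ler_wpM2l ?hK // mulr_ge0 // pi_ge0.
  rewrite ler_piMr; [by []|by rewrite divr_ge0 // ltW|].
  by case/andP: hu hv => ? ? /andP[? ?]; rewrite ler_norml; apply/andP; split; qlra.
(* The sine sums do not converge uniformly up to the integers, so an argument there is first moved
   to d or 1 - d by means of [cosum_near]. *)
have near (u : R) : 0 <= u < 1 -> exists2 v, d <= v <= 1 - d & `|G u - G v| <= e / 4.
  move=> /andP[u0 u1].
  have close v : `|u - v| <= d -> 0 <= v <= 1 -> `|G u - G v| <= e / 4.
    move=> uv /andP[v0 v1].
    rewrite (_ : G u - G v = cosum N u - cosum N v - pi ^+ 2 * ((u - v) * (u + v - 1))); last by rewrite /G; ring.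
    apply: (le_trans (ler_normB _ _)).
    have h1 := @cosum_near M N u v isT.
    have h2 : `|pi ^+ 2 * ((u - v) * (u + v - 1))| <= pi ^+ 2 * `|u - v|.
      rewrite normrM ger0_norm ?sqr_ge0 // ler_wpM2l ?sqr_ge0 // normrM ler_piMr //.
      by rewrite ler_norml; apply/andP; split; qlra.
    have h3 : L * `|u - v| <= L * d by rewrite ler_wpM2l // ltW.
    move: h3; rewrite {1}/L mulrDl; qlra.
  have [ud|ud] := ltP u d.
    exists d; first by apply/andP; split; qlra.
    by apply: close; [rewrite ler_norml; apply/andP; split; qlra|apply/andP; split; qlra].
  have [du|du] := ltP (1 - d) u.
    exists (1 - d); first by apply/andP; split; qlra.
    by apply: close; [rewrite ler_norml; apply/andP; split; qlra|apply/andP; split; qlra].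
  by exists u; [rewrite ud|rewrite subrr normr0 divr_ge0 // ltW].
rewrite (_ : _ - _ - _ = G (fr t) - G (fr s)); last by rewrite -!GE; ring.
have [t' ht' tt'] := near _ (fr_itv t).
have [s' hs' ss'] := near _ (fr_itv s).
have h := mid _ _ ht' hs'.
rewrite (_ : G _ - G _ = (G (fr t) - G t') + (G t' - G s') - (G (fr s) - G s')); last by ring.
apply: (le_trans (ler_normB _ _)); apply: (le_trans (lerD (ler_normD _ _) (lexx _))).
qlra.
Qed.

End Fourier.

(** * From exponential sums to sawtooth sums *)

Section PsiSums.
Variable R : realType.

Lemma sqrt_step (n : nat) : (0 < n)%N ->
  let a := Num.sqrt (n%:R : R) in let b := Num.sqrt (n.+1%:R : R) in
  [/\ 1 <= a, a <= b, a ^+ 2 = n%:R, b ^+ 2 = n.+1%:R & b ^+ 2 = a ^+ 2 + 1].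
Proof.
move=> n0 a b.
have a2 : a ^+ 2 = n%:R by rewrite sqr_sqrtr.
have b2 : b ^+ 2 = n.+1%:R by rewrite sqr_sqrtr.
split => //.
- by rewrite -[leLHS]sqrtr1 ler_sqrt // ler1n.
- by rewrite ler_sqrt // ler_nat.
- by rewrite a2 b2 -natr1.
Qed.

(** For a = sqrt h and b = sqrt (h + 1) this and [invr3_step] are telescoping majorants of (h +
    1)^(-1/2) and (h + 1)^(-3/2); both come from (b - a)(b + a) = 1. *)
Lemma invr_step (a b : R) : 0 <= a <= b -> 0 < b -> b ^+ 2 = a ^+ 2 + 1 ->
  b^-1 <= 2 * (b - a).
Proof.
move=> /andP[a0 ab] b0 h; rewrite -div1r ler_pdivrMr //; nra.
Qed.

Lemma invr3_step (a b : R) : 0 < a <= b -> b ^+ 2 = a ^+ 2 + 1 ->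
  b / (b ^+ 2 * b ^+ 2) <= 2 * (a^-1 - b^-1).
Proof.
move=> /andP[a0 ab] h; have b0 : 0 < b by qlra.
rewrite (_ : a^-1 - b^-1 = (b - a) / (a * b)); last by field; rewrite !gt_eqF.
rewrite [leRHS]mulrA ler_pdivlMr; last by rewrite mulr_gt0.
rewrite mulrAC ler_pdivrMr; last by rewrite !mulr_gt0 ?exprn_gt0.
have := @invr_step a b; rewrite ltW // ab => /(_ isT b0 h).
rewrite -div1r ler_pdivrMr // => k.
rewrite (_ : 2 * (b - a) * (b ^+ 2 * b ^+ 2) = 2 * (b - a) * b * b ^+ 3); last by ring.
have : 1 * b ^+ 3 <= 2 * (b - a) * b * b ^+ 3 by rewrite ler_wpM2r // exprn_ge0 // ltW.
apply: le_trans; rewrite mul1r (_ : b * (a * b) = b ^+ 2 * a); last by ring.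
by rewrite (_ : b ^+ 3 = b ^+ 2 * b); [rewrite ler_wpM2l // sqr_ge0|ring].
Qed.

(** The minimum of 1 / h and H / h^2. Up to a constant it majorizes H times the h-th Fourier
    coefficient of a difference of [bern] over a step 1 / H. *)
Definition wgt (H h : nat) : R :=
  if (h <= H)%N then h%:R^-1 else H%:R / h%:R ^+ 2.

Lemma sum_wgt_sqrt (H N : nat) : (0 < H)%N ->
  \sum_(1 <= h < N.+1) wgt H h * Num.sqrt h%:R <= 4 * Num.sqrt H%:R.
Proof.
move=> H0.
have small n : (n <= H)%N -> \sum_(1 <= h < n.+1) wgt H h * Num.sqrt h%:R <= 2 * Num.sqrt n%:R.
  elim: n => [|n IH] nH; first by rewrite big_nil mulr_ge0.
  rewrite big_nat_recr //= /wgt nH; move/(_ (ltnW nH)): IH.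
  set S := \sum_(1 <= h < n.+1) _.
  have b0 : 0 < Num.sqrt (n.+1%:R : R) by rewrite sqrtr_gt0.
  have h : Num.sqrt (n.+1%:R : R) ^+ 2 = Num.sqrt n%:R ^+ 2 + 1 by rewrite !sqr_sqrtr // natr1.
  have := @invr_step (Num.sqrt n%:R) (Num.sqrt n.+1%:R).
  rewrite sqrtr_ge0 ler_sqrt // ler_nat leqnSn => /(_ isT b0 h).
  rewrite (_ : n.+1%:R^-1 * Num.sqrt n.+1%:R = (Num.sqrt (n.+1%:R : R))^-1); first by qlra.
  rewrite -{1}(@sqr_sqrtr _ (n.+1%:R : R)) //; field; rewrite gt_eqF //.
have H1 := sqrt_step H0; set s := Num.sqrt H%:R in H1 *.
have [s1 _ s2 _ _] := H1.
have sH : 0 < s by qlra.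
case: (leqP N H) => NH.
  apply: (le_trans (small N NH)).
  have : Num.sqrt N%:R <= s by rewrite ler_sqrt // ler_nat.
  qlra.
(* Strengthened for the induction on N: beyond H the terms are H h^(-3/2), whose sum telescopes
   against the subtracted quantity. *)
suff h : \sum_(1 <= h < N.+1) wgt H h * Num.sqrt h%:R <= 4 * s - 2 * H%:R / Num.sqrt N%:R.
  by apply: (le_trans h); rewrite gerBl divr_ge0 // mulr_ge0.
have {NH} : (H <= N)%N by exact: ltnW.
elim: N => [|N IH]; first by move=> hH; exfalso; nlia.
rewrite leq_eqVlt => /predU1P[HN|HN].
  rewrite -HN; apply: (le_trans (small H (leqnn H))).
  rewrite -/s -s2 (_ : 2 * s ^+ 2 / s = 2 * s); first by qlra.
  by field; rewrite gt_eqF.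
have N0 : (0 < N)%N by nlia.
have [a1 ab a2 b2 h] := sqrt_step N0.
rewrite big_nat_recr //= {2}/wgt leqNgt HN /=.
have := IH ltac:(nlia); set S := \sum_(1 <= h < N.+1) _.
move: a1 ab a2 b2 h; set a := Num.sqrt N%:R; set b := Num.sqrt N.+1%:R => a1 ab a2 b2 h.
have := @invr3_step a b; rewrite ab (_ : 0 < a) //; last by qlra.
move=> /(_ isT h); rewrite -b2 => k1 k2.
have : H%:R * (b / (b ^+ 2 * b ^+ 2)) <= H%:R * (2 * (a^-1 - b^-1)) by rewrite ler_wpM2l.
rewrite (_ : H%:R / (b ^+ 2) ^+ 2 * b = H%:R * (b / (b ^+ 2 * b ^+ 2))); last by rewrite expr2; ring.
move: k2; rewrite -!mulrA; qlra.
Qed.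

Lemma sum_wgt_invsqrt (H N : nat) :
  \sum_(1 <= h < N.+1) wgt H h / Num.sqrt h%:R <= 3.
Proof.
apply: (@le_trans _ _ (\sum_(1 <= h < N.+1) (h%:R^-1 / Num.sqrt h%:R : R))).
  rewrite !big_nat; apply: ler_sum => h /andP[h0 _].
  rewrite ler_wpM2r ?invr_ge0 // /wgt; case: leqP => // Hh.
  have hR : 0 < h%:R :> R by rewrite ltr0n.
  rewrite expr2 invfM mulrA ler_piMl ?invr_ge0 // ler_pdivrMr // mul1r ler_nat ltnW //.
case: N => [|N]; first by rewrite big_nil.
suff : \sum_(1 <= h < N.+2) (h%:R^-1 / Num.sqrt h%:R : R) <= 3 - 2 / Num.sqrt N.+1%:R.
  by move/le_trans; apply; rewrite gerBl divr_ge0.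
elim: N => [|N IH]; first by rewrite big_nat1 invr1 sqrtr1; qlra.
rewrite big_nat_recr //=; move: IH; set S := \sum_(1 <= h < N.+2) _ => IH.
have [a1 ab a2 b2 h] := @sqrt_step N.+1 isT.
move: a1 ab a2 b2 h IH; set a := Num.sqrt N.+1%:R; set b := Num.sqrt N.+2%:R => a1 ab a2 b2 h IH.
have := @invr3_step a b; rewrite ab (_ : 0 < a) //; last by qlra.
move=> /(_ isT h); rewrite -b2 (_ : (b ^+ 2)^-1 / b = b / (b ^+ 2 * b ^+ 2)).
  by move: IH; qlra.
by field; rewrite gt_eqF //; qlra.
Qed.

Lemma norm_sin_le (x : R) : 0 <= x -> `|sin x| <= x.
Proof.
move=> x0; have [x1|x1] := leP 1 x; first exact: (le_trans (sin_max x)).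
rewrite ger0_norm ?sin_le_id //; apply: sin_ge0_pi.
by rewrite x0; have := @pi_ge2 R; qlra.
Qed.

Lemma add_inv_ge1 (u : R) : 0 < u -> 1 <= u + u^-1.
Proof. by move=> u0; rewrite -(@ler_pM2r _ u) // mulrDl mulVf ?gt_eqF //; nra. Qed.

Lemma psi_vdc_aux1 (M z1 z2 z : R) : 1 <= M -> z1 <= 23 * M * (3 * z) -> z2 <= 1 ->
  1 <= z -> z1 + z2 <= 70 * M * z.
Proof. nra. Qed.

Lemma psi_vdc_aux2 (M w Z Y : R) : 1 <= M -> 0 <= w -> 0 <= Z -> 0 <= Y ->
  w / 2 + 70 * 4 * M * (4 * Z + 3 * Y) + w / 2 <= 70 * 16 * M * (w + Z + Y).
Proof. nra. Qed.

Section PsiVdc.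
Variables (f : nat -> R) (n : nat) (lam M : R).
Hypotheses (lam0 : 0 < lam) (M1 : 1 <= M).
Hypothesis curv : forall i, (i.+2 < n)%N ->
  lam <= (f i.+1 - f i) - (f i.+2 - f i.+1) <= M * lam.

(** The phase p lets the cosine stand for a sine as well. The curvature hypothesis reaches only far
    enough to treat n - 1 terms by [vdc_second], so the last one is split off; with sqrt (2 pi) <= 3
    the constant is 23 * 3 + 1 = 70. *)
Lemma expsum_bound (h : nat) (p : R) : (0 < n)%N -> (0 < h)%N ->
  `|\sum_(0 <= i < n) cos (2 * pi * h%:R * f i + p)| <=
    70 * M * (n%:R * Num.sqrt lam * Num.sqrt h%:R + (Num.sqrt lam)^-1 / Num.sqrt h%:R).
Proof.
case: n curv => [//|n'] curv' _ h0.
rewrite big_nat_recr //=; set last := cos _.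
pose m : R := 2 * pi * h%:R * lam.
have p2 := @pi_ge2 R.
have hR : 1 <= h%:R :> R by rewrite ler1n.
have c0 : 0 < 2 * pi * h%:R :> R by rewrite !mulr_gt0 //; qlra.
have m0 : 0 < m by rewrite mulr_gt0.
have := @vdc_second R (fun i => 2 * pi * h%:R * f i + p) n' m M m0 M1.
set S := \sum_(0 <= i < n') _ => /(_ _)/Wrap[].
  move=> i iN; have /andP[h1 h2] := curv' i iN.
  rewrite (_ : _ - _ - _ = 2 * pi * h%:R * ((f i.+1 - f i) - (f i.+2 - f i.+1))); last by ring.
  by rewrite /m mulrCA !ler_pM2l // h1 h2.
set u : R := Num.sqrt lam * Num.sqrt h%:R.
have u0 : 0 < u by rewrite mulr_gt0 ?sqrtr_gt0 //; qlra.
have mE : Num.sqrt m = Num.sqrt (2 * pi) * u.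
  by rewrite /m /u (mulrC (Num.sqrt lam)) mulrA -!sqrtrM //; qlra.
have q1 : 1 <= Num.sqrt (2 * pi : R) by rewrite -[leLHS]sqrtr1 ler_sqrt; qlra.
have q3 : Num.sqrt (2 * pi : R) <= 3.
  rewrite -(@ler_pXn2r _ 2) ?nnegrE ?sqrtr_ge0 // sqr_sqrtr; last by qlra.
  by have := @pihalf_lt2 R; qlra.
rewrite mE invfM => hS.
have -> : (Num.sqrt lam)^-1 / Num.sqrt h%:R = u^-1 by rewrite /u invfM mulrC.
rewrite -(mulrA n'.+1%:R) -/u.
have hl : `|last| <= 1 by exact: cos_max.
have iq : (Num.sqrt (2 * pi : R))^-1 <= 1 by rewrite invf_le1 //; qlra.
have iu : 0 < u^-1 by rewrite invr_gt0.
have amgm : 1 <= n'.+1%:R * u + u^-1.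
  have := add_inv_ge1 u0.
  have hn : 1 * u <= n'.+1%:R * u by rewrite ler_pM2r // ler1n.
  by move: hn; rewrite mul1r; qlra.
have h1 : n'%:R * (Num.sqrt (2 * pi) * u) <= 3 * (n'.+1%:R * u).
  rewrite mulrCA; apply: ler_pM; rewrite ?sqrtr_ge0 ?mulr_ge0 ?(ltW u0) //.
  by rewrite ler_pM2r // ler_nat.
have h2 : (Num.sqrt (2 * pi))^-1 * u^-1 <= 3 * u^-1 by rewrite ler_pM2r //; qlra.
apply: (le_trans (ler_normD _ _)).
have h3 : 23 * M * (n'%:R * (Num.sqrt (2 * pi) * u) + (Num.sqrt (2 * pi))^-1 * u^-1) <=
   23 * M * (3 * (n'.+1%:R * u + u^-1)).
  by rewrite ler_pM2l; [rewrite [leRHS]mulrDr; exact: lerD|move: M1; qlra].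
have {h3}hS := le_trans hS h3.
exact: psi_vdc_aux1.
Qed.

(** By cos (a + d) - cos (a - d) = - 2 sin a sin d with d = pi h / H, frequency h enters with a
    coefficient of size at most (8 / H) [wgt H h]: from |sin d| <= d for h <= H and |sin d| <= 1
    beyond. The Fourier series is taken to accuracy 1 / H^2 per term. *)
Lemma bern_sum_bound (H : nat) (s1 s2 : R) : (0 < n)%N -> (0 < H)%N -> s1 - s2 = H%:R^-1 ->
  `|\sum_(0 <= i < n) (bern (f i + s1) - bern (f i + s2))| <=
    n%:R / H%:R ^+ 2 +
    8 / H%:R * (70 * M * (4 * (n%:R * (Num.sqrt lam * Num.sqrt H%:R)) + 3 * (Num.sqrt lam)^-1)).
Proof.
move=> n0 H0 s12; have HR : 0 < H%:R :> R by rewrite ltr0n.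
have p2 := @pi_ge2 R.
have e0 : 0 < (H%:R ^+ 2)^-1 :> R by rewrite invr_gt0 exprn_gt0.
have [N hN] := fourier_bern e0.
set E : R := 70 * M * _.
pose T := \sum_(0 <= i < n) (cosum N (f i + s1) - cosum N (f i + s2)).
have hT : `|T| <= 8 / H%:R * E.
  have TE : T = \sum_(1 <= h < N.+1) (- (2 * sin (pi * h%:R / H%:R) / h%:R ^+ 2) *
      \sum_(0 <= i < n) cos (2 * pi * h%:R * f i + (pi * h%:R * (s1 + s2) - pi / 2))).
    rewrite /T /cosum; under eq_bigr do rewrite -sumrB.
    rewrite exchange_big /=; apply: eq_bigr => h _.
    rewrite mulr_sumr; apply: eq_bigr => i _; rewrite -mulrBl.
    rewrite addrA cosBpihalf.
    set a := 2 * pi * h%:R * f i + _; set d : R := pi * h%:R / H%:R.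
    have -> : 2 * pi * h%:R * (f i + s1) = a + d.
      by rewrite /a /d -s12; ring.
    have -> : 2 * pi * h%:R * (f i + s2) = a - d.
      by rewrite /a /d -s12; ring.
    by rewrite cosB cosD; ring.
  rewrite TE; apply: (le_trans (ler_norm_sum _ _ _)).
  apply: (@le_trans _ _ (\sum_(1 <= h < N.+1) (8 / H%:R * (70 * M *
     (n%:R * Num.sqrt lam * (wgt H h * Num.sqrt h%:R) +
      (Num.sqrt lam)^-1 * (wgt H h / Num.sqrt h%:R)))))).
    rewrite !big_nat; apply: ler_sum => h /andP[h0 _].
    have hR : 0 < h%:R :> R by rewrite ltr0n.
    rewrite normrM normrN.
    rewrite (_ : 8 / H%:R * _ = 8 / H%:R * wgt H h * (70 * M * (n%:R * Num.sqrt lam * Num.sqrt h%:R +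
       (Num.sqrt lam)^-1 / Num.sqrt h%:R))); last by ring.
    apply: ler_pM => //; last exact: expsum_bound.
    rewrite !normrM normfV (ger0_norm (_ : 0 <= 2)) // (ger0_norm (sqr_ge0 (h%:R : R))).
    have hx : 0 <= pi * h%:R / H%:R :> R by rewrite divr_ge0 // mulr_ge0 ?pi_ge0.
    have hs := norm_sin_le hx; have hs1 := sin_max (pi * h%:R / H%:R : R).
    rewrite ler_pdivrMr ?exprn_gt0 // /wgt; case: leqP => hH.
      rewrite (_ : 8 / H%:R / h%:R * h%:R ^+ 2 = 2 * (4 * h%:R / H%:R)); last first.
        by field; rewrite !gt_eqF.
      rewrite ler_pM2l //; apply: (le_trans hs); rewrite ler_pM2r ?invr_gt0 //.
      by rewrite ler_pM2r //; have := @pihalf_lt2 R; qlra.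
    rewrite (_ : 8 / H%:R * (H%:R / h%:R ^+ 2) * h%:R ^+ 2 = 8); first by qlra.
    by field; rewrite !gt_eqF.
  rewrite -mulr_sumr ler_pM2l; last by rewrite divr_gt0.
  have k2 := sum_wgt_sqrt N H0; have k1 := sum_wgt_invsqrt H N.
  rewrite -mulr_sumr big_split /= -!mulr_sumr /E.
  rewrite ler_pM2l; last exact: (mulr_gt0 _ (lt_le_trans ltr01 M1)).
  apply: lerD.
    rewrite (_ : 4 * _ = n%:R * Num.sqrt lam * (4 * Num.sqrt H%:R)); last by ring.
    by rewrite ler_wpM2l // mulr_ge0.
  by rewrite mulrC ler_wpM2r // invr_ge0.
have hD : `|pi ^+ 2 * \sum_(0 <= i < n) (bern (f i + s1) - bern (f i + s2)) - T| <= n%:R / H%:R ^+ 2.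
  rewrite mulr_sumr -sumrB; apply: (le_trans (ler_norm_sum _ _ _)).
  rewrite (_ : n%:R / H%:R ^+ 2 = \sum_(0 <= i < n) (H%:R ^+ 2)^-1); last first.
    by rewrite sumr_const_nat subn0 mulr_natl.
  by apply: ler_sum => i _; rewrite distrC.
set B := \sum_(0 <= i < n) _ in hD *.
have : `|pi ^+ 2 * B| <= n%:R / H%:R ^+ 2 + 8 / H%:R * E.
  rewrite (_ : pi ^+ 2 * B = (pi ^+ 2 * B - T) + T); last by ring.
  by apply: (le_trans (ler_normD _ _)); exact: lerD.
apply: le_trans; rewrite normrM ger0_norm ?sqr_ge0 // ler_peMl //.
by apply: exprn_ege1; qlra.
Qed.

(** [psi] is enclosed between difference quotients of [bern] with step 1 / H, up to 1 / (2 H). The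
    integer H stays free, to balance n / H against n sqrt (lam H). *)
Theorem psi_vdc (H : nat) : (0 < H)%N ->
  `|\sum_(0 <= i < n) psi (f i)| <=
   70 * 16 * M * (n%:R / H%:R + n%:R * (Num.sqrt lam * Num.sqrt H%:R) + (Num.sqrt lam)^-1).
Proof.
move=> H0; case: (posnP n) => [->|n0].
  rewrite big_geq // normr0 !mul0r !add0r; apply: mulr_ge0; last by rewrite invr_ge0.
  by move: M1; qlra.
have HR : 1 <= H%:R :> R by rewrite ler1n.
have Hp : 0 < H%:R :> R by qlra.
pose d : R := H%:R^-1.
have d01 : 0 <= d <= 1 by rewrite invr_ge0 invf_le1 // HR; qlra.
have dp : 0 < d by rewrite invr_gt0.
have e1 : 0 - - d = H%:R^-1 by rewrite sub0r opprK.
have e2 : d - 0 = H%:R^-1 by rewrite subr0.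
have b1 := bern_sum_bound n0 H0 e1; have b2 := bern_sum_bound n0 H0 e2.
set E : R := n%:R / H%:R ^+ 2 + _ in b1 b2.
have cE : n%:R * (d / 2) = \sum_(0 <= i < n) (d / 2).
  by rewrite sumr_const_nat subn0 mulr_natl.
have up : \sum_(0 <= i < n) psi (f i) <=
   H%:R / 2 * (\sum_(0 <= i < n) (bern (f i + 0) - bern (f i + - d))) + n%:R * (d / 2).
  rewrite cE mulr_sumr -big_split /=.
  apply: ler_sum => i _; have := bern_left (f i) d01; rewrite addr0.
  move: (bern _ - bern _) => z hz.
  have : H%:R / 2 * (2 * d * psi (f i) - d ^+ 2) <= H%:R / 2 * z by rewrite ler_pM2l // divr_gt0.
  rewrite (_ : H%:R / 2 * (2 * d * psi (f i) - d ^+ 2) = psi (f i) - d / 2); first by qlra.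
  by rewrite /d; field; rewrite gt_eqF.
have lo : H%:R / 2 * (\sum_(0 <= i < n) (bern (f i + d) - bern (f i + 0))) - n%:R * (d / 2) <=
    \sum_(0 <= i < n) psi (f i).
  rewrite cE mulr_sumr -sumrB /=.
  apply: ler_sum => i _; have := bern_right (f i) d01; rewrite addr0.
  move: (bern _ - bern _) => z hz.
  have : H%:R / 2 * z <= H%:R / 2 * (2 * d * psi (f i) + d ^+ 2) by rewrite ler_pM2l // divr_gt0.
  rewrite (_ : H%:R / 2 * (2 * d * psi (f i) + d ^+ 2) = psi (f i) + d / 2); first by qlra.
  by rewrite /d; field; rewrite gt_eqF.
have fin : H%:R / 2 * E + n%:R * (d / 2) <=
  70 * 16 * M * (n%:R / H%:R + n%:R * (Num.sqrt lam * Num.sqrt H%:R) + (Num.sqrt lam)^-1).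
  rewrite /E; set Z := n%:R * (_ * _); set Y := (Num.sqrt lam)^-1.
  rewrite (_ : H%:R / 2 * _ = n%:R / H%:R / 2 + 70 * 4 * M * (4 * Z + 3 * Y)); last first.
    by field; rewrite gt_eqF.
  have Z0 : 0 <= Z by rewrite !mulr_ge0.
  have Y0 : 0 <= Y by rewrite invr_ge0.
  rewrite /d; have : 0 <= n%:R / H%:R :> R by rewrite divr_ge0.
  rewrite (_ : n%:R * (H%:R^-1 / 2) = n%:R / H%:R / 2); last by ring.
  by move=> w0; exact: psi_vdc_aux2.
have hE : 0 <= H%:R / 2 :> R by rewrite divr_ge0.
rewrite ler_norml; apply/andP; split.
  apply: le_trans lo; move: b2; rewrite ler_norml => /andP[b2 _].
  have := ler_wpM2l hE b2; qlra.
apply: (le_trans up); move: b1; rewrite ler_norml => /andP[_ b1].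
have := ler_wpM2l hE b1; qlra.
Qed.

End PsiVdc.
End PsiSums.

(** * Sawtooth sums along a circular arc *)

Section Arcs.
Variable R : realType.

(** The discrete form of the second derivative - X^2 / s^3 of s = sqrt (X^2 - w^2). Rationalizing a
    - b = (2 w - 1) / (a + b) and its analogues gives the second difference as 2 / (b + c) + 4 w (2
    w - 1) / P, where P = (a + b)(b + c)(a + c) lies between S^3 and 8 S^3. *)
Lemma circle_second_diff (X S w a b c : R) : 0 < S -> 1 <= w ->
  a ^+ 2 + (w - 1) ^+ 2 = X ^+ 2 -> b ^+ 2 + w ^+ 2 = X ^+ 2 ->
  c ^+ 2 + (w + 1) ^+ 2 = X ^+ 2 ->
  S / 2 <= a <= S -> S / 2 <= b <= S -> S / 2 <= c <= S ->
  X ^+ 2 / (2 * S ^+ 3) <= (b - a) - (c - b) <= 16 * (X ^+ 2 / (2 * S ^+ 3)).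
Proof.
move=> S0 w1 ha hb hc /andP[a1 a2] /andP[b1 b2] /andP[c1 c2].
have a0 : 0 < a by qlra.
have b0 : 0 < b by qlra.
have c0 : 0 < c by qlra.
have S3 : 0 < S ^+ 3 by rewrite exprn_gt0.
have w0 : 0 <= w by qlra.
have ab : a - b = (2 * w - 1) / (a + b).
  by rewrite (_ : 2 * w - 1 = (a - b) * (a + b)) ?mulfK ?gt_eqF //; qlra.
have bc : b - c = (2 * w + 1) / (b + c).
  by rewrite (_ : 2 * w + 1 = (b - c) * (b + c)) ?mulfK ?gt_eqF //; qlra.
have ac : a - c = 4 * w / (a + c).
  by rewrite (_ : 4 * w = (a - c) * (a + c)) ?mulfK ?gt_eqF //; qlra.
clear ha hc; pose P := (a + b) * (b + c) * (a + c).
have P0 : 0 < P by rewrite !mulr_gt0 //; qlra.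
have PS : P <= 8 * S ^+ 3.
  rewrite (_ : 8 * S ^+ 3 = (2 * S) * (2 * S) * (2 * S)); last by ring.
  by rewrite /P; apply: ler_pM; [apply: mulr_ge0; qlra|qlra|apply: ler_pM; qlra|qlra].
have SP : S ^+ 3 <= P.
  rewrite (_ : S ^+ 3 = S * S * S); last by ring.
  by rewrite /P; apply: ler_pM; [apply: mulr_ge0; qlra|qlra|apply: ler_pM; qlra|qlra].
have E : (b - a) - (c - b) = 2 / (b + c) + (2 * w - 1) * (4 * w) / P.
  rewrite (_ : b - a - (c - b) = (b - c) - (a - b)); last by ring.
  rewrite bc ab.
  rewrite (_ : (2 * w + 1) / (b + c) - (2 * w - 1) / (a + b) =
     2 / (b + c) + (2 * w - 1) * (a - c) / ((a + b) * (b + c))); last first.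
    by field; rewrite !gt_eqF //; qlra.
  by rewrite ac /P; field; rewrite !gt_eqF //; qlra.
rewrite E; clear ab bc ac E; apply/andP; split.
  have h1 : S^-1 <= 2 / (b + c).
    by rewrite -div1r ler_pdivrMr // mulrAC ler_pdivlMr; qlra.
  have h2 : w ^+ 2 * 4 / (8 * S ^+ 3) <= (2 * w - 1) * (4 * w) / P.
    apply: ler_pM; rewrite ?mulr_ge0 ?invr_ge0 ?w0 ?(ltW S0) //.
    - by rewrite mulr_ge0 // ltW.
    - by rewrite expr2; nra.
    - by rewrite lef_pV2 ?posrE // mulr_gt0.
  apply: le_trans (lerD h1 h2).
  rewrite (_ : S^-1 + _ = (2 * S ^+ 2 + w ^+ 2) / (2 * S ^+ 3)); last by field; rewrite gt_eqF.
  rewrite ler_pM2r ?invr_gt0 ?mulr_gt0 // -hb lerD2r.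
  have : b ^+ 2 <= S ^+ 2 by rewrite ler_pXn2r ?nnegrE //; qlra.
  by have := sqr_ge0 S; qlra.
have h1 : 2 / (b + c) <= 2 / S.
  by rewrite ler_pM2l // lef_pV2 ?posrE //; qlra.
have h2 : (2 * w - 1) * (4 * w) / P <= (2 * w) * (4 * w) / S ^+ 3.
  apply: ler_pM.
  - by apply: mulr_ge0; qlra.
  - by rewrite invr_ge0 ltW.
  - by apply: ler_wpM2r; qlra.
  - by rewrite lef_pV2 ?posrE.
apply: (le_trans (lerD h1 h2)).
rewrite (_ : 2 / S + _ = (2 * S ^+ 2 + 8 * w ^+ 2) / S ^+ 3); last by field; rewrite gt_eqF.
rewrite (_ : 16 * _ = (8 * X ^+ 2) / S ^+ 3); last by field; rewrite gt_eqF.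
rewrite ler_pM2r ?invr_gt0 // -hb.
have : (S / 2) ^+ 2 <= b ^+ 2 by rewrite ler_pXn2r ?nnegrE //; qlra.
by rewrite exprMn exprVn; qlra.
Qed.

Definition semi (X : R) (w : nat) : R := Num.sqrt (X ^+ 2 - w%:R ^+ 2).

Lemma semi_sqr (X : R) (w : nat) : w%:R <= X -> semi X w ^+ 2 + w%:R ^+ 2 = X ^+ 2.
Proof.
move=> wX; rewrite sqr_sqrtr ?subrK // subr_ge0 ler_pXn2r ?nnegrE //.
exact: le_trans wX.
Qed.

Lemma semi_mono (X : R) (w : nat) : semi X w.+1 <= semi X w.
Proof. by rewrite ler_wsqrtr // lerD2l lerN2 ler_pXn2r ?nnegrE // ler_nat. Qed.

Section Piece.
Variables (X beta g S : R) (p r H : nat).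
Hypotheses (S0 : 0 < S) (b1 : 1 <= beta).
Hypothesis rX : forall w, (w < r)%N -> w%:R <= X.
Hypothesis Sr : forall w, (p <= w < r)%N -> S / 2 <= semi X w <= S.

Lemma arc_piece (lam : R) : (0 < H)%N -> lam = X ^+ 2 / (2 * S ^+ 3) / beta ->
  `|\sum_(p <= w < r) psi (semi X w / beta + g)| <= 70 * 16 * 16 *
     ((r - p)%:R / H%:R + (r - p)%:R * (Num.sqrt lam * Num.sqrt H%:R) + (Num.sqrt lam)^-1).
Proof.
move=> H0 lE; case: (leqP r p) => rp.
  rewrite big_geq // normr0; apply: mulr_ge0; first by [].
  by rewrite !addr_ge0 ?mulr_ge0 ?invr_ge0 ?sqrtr_ge0.
have S0' := S0; have b1' := b1.
have S3 : 0 < S ^+ 3 by rewrite exprn_gt0.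
have X0 : 0 < X ^+ 2.
  have pr : (p <= p < r)%N by nlia.
  have /andP[h _] := Sr pr; rewrite -(semi_sqr (rX rp)).
  by rewrite ltr_pwDl ?sqr_ge0 // exprn_gt0 //; qlra.
have lam0 : 0 < lam by rewrite lE !divr_gt0 // ?mulr_gt0 //; qlra.
rewrite -{1}[p]add0n big_addn.
apply: (@psi_vdc R (fun i => semi X (i + p) / beta + g)) => //; first by rewrite ler1n.
move=> i hi.
have wr : ((i + p).+2 < r)%N by nlia.
have := @circle_second_diff X S (i + p).+1%:R (semi X (i + p)) (semi X (i + p).+1) (semi X (i + p).+2) S0.
rewrite ler1n; move=> /(_ isT).
have -> : (i + p).+1%:R - 1 = (i + p)%:R :> R by rewrite -natr1 addrK.
rewrite natr1 !semi_sqr; try by apply: rX; nlia.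
move=> /(_ erefl erefl erefl).
move=> /(_ (Sr _) (Sr _) (Sr _)) h.
have {h} /andP[h1 h2] := h ltac:(nlia) ltac:(nlia) ltac:(nlia).
rewrite !addSn (_ : _ - _ - _ = ((semi X (i + p).+1 - semi X (i + p)) - (semi X (i + p).+2 - semi X (i + p).+1)) / beta); last by ring.
have bp : 0 < beta^-1 by rewrite invr_gt0; qlra.
by rewrite lE mulrA !ler_pM2r // h1 h2.
Qed.

End Piece.

(** The piece at height S = X / q with H of size y / q. The three terms are at most 2, 2 and 4 times
    y^2 / q, and the decay in q makes the dyadic sum geometric. *)
Lemma piece_numeric (y X q beta n h lam : R) : 1 <= y -> X = y ^+ 3 -> 1 <= q -> q ^+ 2 <= y ->
  1 <= beta <= 4 * y -> 0 <= n <= 2 * X / q ^+ 2 -> y / q <= h <= 2 * y / q ->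
  lam = X ^+ 2 / (2 * (X / q) ^+ 3) / beta ->
  n / h + n * (Num.sqrt lam * Num.sqrt h) + (Num.sqrt lam)^-1 <= 8 * y ^+ 2 / q.
Proof.
move=> y1 XE q1 qy /andP[b1 b4] /andP[n0 n1] /andP[h1 h2] lE.
have yp : 0 < y by qlra.
have qp : 0 < q by qlra.
have hp : 0 < h by apply: lt_le_trans h1; rewrite divr_gt0.
have bp : 0 < beta by qlra.
have {}lE : lam = q ^+ 3 / (2 * beta * y ^+ 3) by rewrite lE XE; field; rewrite !gt_eqF.
have lp : 0 < lam by rewrite lE divr_gt0 ?exprn_gt0 // !mulr_gt0 // exprn_gt0.
have t1 : n / h <= 2 * y ^+ 2 / q.
  rewrite ler_pdivrMr //; apply: (le_trans n1).
  rewrite (_ : 2 * X / q ^+ 2 = 2 * y ^+ 2 / q * (y / q)); last by rewrite XE; field; rewrite gt_eqF.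
  by rewrite ler_pM2l // divr_gt0 // mulr_gt0 // exprn_gt0.
have t2 : Num.sqrt lam * Num.sqrt h <= q / y.
  rewrite -sqrtrM ?(ltW lp) // -[leRHS]ger0_norm ?divr_ge0 ?(ltW qp) ?(ltW yp) //.
  rewrite -sqrtr_sqr ler_wsqrtr //.
  apply: (@le_trans _ _ (lam * (2 * y / q))); first by rewrite ler_pM2l.
  rewrite lE (_ : _ * (2 * y / q) = (q / y) ^+ 2 / beta); last by field; rewrite !gt_eqF.
  by rewrite ler_pdivrMr // ler_peMr // sqr_ge0.
have t3 : n * (Num.sqrt lam * Num.sqrt h) <= 2 * y ^+ 2 / q.
  rewrite (_ : 2 * y ^+ 2 / q = (2 * X / q ^+ 2) * (q / y)); last by rewrite XE; field; rewrite !gt_eqF.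
  by apply: ler_pM => //; rewrite mulr_ge0.
have t4 : (Num.sqrt lam)^-1 <= 4 * y ^+ 2 / q.
  rewrite -[leLHS]div1r ler_pdivrMr ?sqrtr_gt0 //.
  rewrite -(@ler_pXn2r _ 2) ?nnegrE ?mulr_ge0 ?invr_ge0 ?sqr_ge0 ?sqrtr_ge0 ?(ltW qp) ?(ltW yp) //.
  rewrite expr1n [leRHS]exprMn sqr_sqrtr ?(ltW lp) // lE.
  rewrite (_ : (4 * y ^+ 2 / q) ^+ 2 * _ = 8 * y * q / beta); last by field; rewrite !gt_eqF.
  rewrite ler_pdivlMr // mul1r; apply: (le_trans b4).
  have : y * 1 <= y * q by rewrite ler_pM2l.
  qlra.
rewrite (_ : 8 * y ^+ 2 / q = 2 * y ^+ 2 / q + 2 * y ^+ 2 / q + 4 * y ^+ 2 / q); last by ring.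
by apply: lerD => //; apply: lerD.
Qed.

(** The curvature is unbounded towards the end of the arc, hence the dyadic cut by s_w: the piece
    between X / 2^(k+1) and X / 2^k costs A y^2 / 2^k. Once 4^k > y, at most y^2 + 1 integers w are
    left, and these are counted trivially. *)
Theorem arc_psi_sum (X y beta g : R) (W : nat) : 1 <= y -> X = y ^+ 3 ->
  1 <= beta <= 4 * y -> (forall w, (w < W)%N -> w%:R <= X) ->
  `|\sum_(0 <= w < W) psi (semi X w / beta + g)| <= (70 * 16 * 16 * 16 + 2) * y ^+ 2.
Proof.
move=> y1 XE b14 WX.
have yp : 0 < y by qlra.
have Xp : 0 < X by rewrite XE exprn_gt0.
(* Because X - w <= (X^2 - w^2) / X = s_w^2 / X. *)
have count p (S : R) : 0 <= S -> (p < W)%N -> semi X p <= S -> (W - p)%:R <= S ^+ 2 / X + 1.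
  move=> Sp pW hS; have pX := WX p pW.
  have hp := semi_sqr pX.
  have h1 : (W.-1)%:R <= X :> R by apply: WX; nlia.
  have -> : (W - p)%:R = W.-1%:R - p%:R + 1 :> R.
    rewrite -[in RHS](@natrB _ _ p); last by nlia.
    by rewrite natr1; congr _%:R; nlia.
  rewrite lerD2r ler_pdivlMr //.
  have h2 : semi X p ^+ 2 <= S ^+ 2 by rewrite ler_pXn2r ?nnegrE // sqrtr_ge0.
  have p0 : 0 <= p%:R :> R by [].
  apply: (@le_trans _ _ ((X - p%:R) * X)); first by rewrite ler_pM2r // lerD2r.
  by move: h2 hp; rewrite !expr2; nra.
have psi1 (x : R) : `|psi x| <= 1.
  have /andP[f0 f1] := fr_itv x; rewrite /psi ler_norml; apply/andP; split; qlra.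
have triv p : `|\sum_(p <= w < W) psi (semi X w / beta + g)| <= (W - p)%:R.
  apply: (le_trans (ler_norm_sum _ _ _)).
  by rewrite -sumr_const_nat; apply: ler_sum => i _.
pose A : R := 70 * 16 * 16 * 8.
have A0 : 0 <= A by rewrite /A; apply: mulr_ge0.
have base k p : (p <= W)%N -> y < (2 ^+ k) ^+ 2 ->
    (forall w, (p <= w < W)%N -> semi X w <= X / 2 ^+ k) ->
    `|\sum_(p <= w < W) psi (semi X w / beta + g)| <= 2 * y ^+ 2.
  move=> pW yk small; apply: (le_trans (triv p)).
  case: (leqP W p) => Wp.
    have -> : (W - p)%N = 0%N by nlia.
    by rewrite mulr_ge0 ?sqr_ge0.
  have q0 : 0 < 2 ^+ k :> R by rewrite exprn_gt0.
  have Xk : 0 <= X / 2 ^+ k by rewrite divr_ge0 // ltW.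
  apply: (le_trans (count p _ Xk Wp (small p _))); first by nlia.
  have : (X / 2 ^+ k) ^+ 2 / X <= y ^+ 2.
    rewrite (_ : (X / 2 ^+ k) ^+ 2 / X = y ^+ 2 * (y / (2 ^+ k) ^+ 2)).
      by rewrite ler_piMr ?sqr_ge0 // ler_pdivrMr ?exprn_gt0 // mul1r ltW.
    by rewrite XE; field; rewrite !gt_eqF.
  have : 1 <= y ^+ 2 by apply: exprn_ege1.
  qlra.
have main j : forall k p, (p <= W)%N -> y < (2 ^+ (k + j)) ^+ 2 ->
    (forall w, (p <= w < W)%N -> semi X w <= X / 2 ^+ k) ->
    `|\sum_(p <= w < W) psi (semi X w / beta + g)| <= 2 * A * y ^+ 2 / 2 ^+ k + 2 * y ^+ 2.
  elim: j => [|j IH] k p pW yk small.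
    rewrite addn0 in yk; apply: (le_trans (base k p pW yk small)).
    by rewrite lerDr divr_ge0 ?exprn_ge0 // mulr_ge0 ?sqr_ge0 // mulr_ge0.
  have [yk'|yk'] := ltP y ((2 ^+ k) ^+ 2).
    apply: (le_trans (base k p pW yk' small)).
    by rewrite lerDr divr_ge0 ?exprn_ge0 // mulr_ge0 ?sqr_ge0 // mulr_ge0.
  set q : R := 2 ^+ k in small yk' *.
  have q1 : 1 <= q by rewrite /q; apply: exprn_ege1; qlra.
  have qp : 0 < q by qlra.
  have Sp : 0 < X / q by rewrite divr_gt0.
  have [r [/andP[pr rW] r1 r2]] := @nonincreasing_split R (semi X) p W (X / q / 2) pW
     (fun i _ _ => semi_mono X i).
  rewrite (@big_cat_nat _ _ _ r) //=; apply: (le_trans (ler_normD _ _)).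
  have h2 : `|\sum_(r <= w < W) psi (semi X w / beta + g)| <= 2 * A * y ^+ 2 / 2 ^+ k.+1 + 2 * y ^+ 2.
    apply: IH => //; first by rewrite addSnnS.
    move=> w hw; apply: (le_trans (r2 w hw)).
    by rewrite exprS invfM mulrA mulrAC.
  pose H := (Num.truncn (y / q)).+1.
  have yq : 1 <= y / q.
    rewrite ler_pdivlMr // mul1r; apply: le_trans yk'.
    by rewrite expr2 ler_peMl // ltW.
  have H1 : y / q <= H%:R by rewrite ltW // truncnS_gt.
  have H2 : H%:R <= 2 * y / q.
    have : (Num.truncn (y / q))%:R <= y / q by rewrite truncn_le // (le_trans _ yq).
    by rewrite /H -natr1; qlra.
  have n1 : (r - p)%:R <= 2 * X / q ^+ 2.
    case: (ltnP p W) => pW'; last first.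
      have -> : (r - p)%N = 0%N by nlia.
      by rewrite divr_ge0 ?sqr_ge0 ?mulr_ge0 ?(ltW Xp).
    apply: (@le_trans _ _ (W - p)%:R); first by rewrite ler_nat; nlia.
    apply: (le_trans (count p (X / q) (ltW Sp) pW' (small p _))); first by nlia.
    rewrite (_ : (X / q) ^+ 2 / X = X / q ^+ 2); last by field; rewrite !gt_eqF.
    suff : 1 <= X / q ^+ 2 by qlra.
    rewrite ler_pdivlMr ?exprn_gt0 // mul1r; apply: (le_trans yk').
    by rewrite XE exprS ler_peMr ?(ltW yp) //; apply: exprn_ege1.
  have h1 : `|\sum_(p <= w < r) psi (semi X w / beta + g)| <= A * y ^+ 2 / q.
    have b1 : 1 <= beta by case/andP: b14.
    have := @arc_piece X beta g (X / q) p r H Sp b1 (fun w hw => WX w (leq_trans hw rW)).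
    move=> /(_ _ _ isT erefl) h; apply: (le_trans (h _)).
      by move=> w hw; rewrite ltW ?r1 //=; apply: small; nlia.
    have := @piece_numeric y X q beta (r - p)%:R H%:R _ y1 XE q1 yk' b14.
    rewrite n1 H1 H2 ler0n => /(_ _ isT isT erefl) h'.
    rewrite /A -!(mulrA (70 * 16 * 16)) ler_pM2l; last by rewrite !mulr_gt0.
    by apply: (le_trans h'); rewrite mulrA.
  apply: (le_trans (lerD h1 h2)).
  rewrite [2 ^+ k.+1]exprS -/q addrA lerD2r.
  rewrite (_ : _ / q + _ / (2 * q) = 2 * A * y ^+ 2 / q) //.
  by field; rewrite gt_eqF.
pose j := (Num.truncn y).+1.
have yj : y < (2 ^+ (0 + j)) ^+ 2.
  rewrite add0n; apply: (lt_le_trans (truncnS_gt y)); rewrite -/j.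
  rewrite -natrX -natrX ler_nat -expnM.
  by apply: (leq_trans (ltnW (ltn_expl j (isT : (1 < 2)%N)))); rewrite leq_exp2l //; nlia.
have := main j 0%N 0%N (leq0n _) yj.
rewrite expr0 !divr1 => h; apply: (le_trans (h _)).
  move=> w hw; have wX := WX w ltac:(nlia).
  rewrite -[leRHS]ger0_norm ?(ltW Xp) // -sqrtr_sqr ler_wsqrtr //.
  by rewrite gerBl sqr_ge0.
by rewrite -mulrDl ler_wpM2r ?sqr_ge0 // lerD2r /A; qlra.
Qed.

End Arcs.

(** * Divisor sums and the lattice points of the six-dimensional ball *)

Section SixDimBall.
Variable R : realType.

Definition theta (K : nat) (g : R -> R) (t : R) : R :=
  \sum_(z <- zrange K) g (t - z%:~R ^+ 2).

(** Iterating [theta] convolves with the representation counts. As g and the counts vanish on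
    negative arguments, only 0 <= m <= t contributes, and any window M >= t holds all of it. *)
Lemma iter_thetaE (K M d : nat) (g : R -> R) (t : R) :
  (forall s, s < 0 -> g s = 0) -> t <= M%:R ->
  iter d (theta K) g t = \sum_(m <- zrange M) (nsq K d m)%:~R * g (t - m%:~R).
Proof.
move=> g0; elim: d t => [|d IH] t tM /=.
  rewrite (bigD1_seq 0) ?zrange_uniq ?mem_zrange //= mul1r subr0 big1 ?addr0 //.
  by move=> m /negPf ->; rewrite mul0r.
transitivity (\sum_(z <- zrange K) \sum_(m <- zrange M)
   (nsq K d (m - z ^+ 2))%:~R * g (t - m%:~R)); last first.
  rewrite exchange_big; apply: eq_bigr => m _.
  by rewrite rmorph_sum /= mulr_suml.
rewrite /theta; apply: eq_bigr => z _.
rewrite IH; last first.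
  by apply: le_trans tM; rewrite gerBl sqr_ge0.
rewrite (bigID (fun m : int => (0 <= m) && (m%:~R <= t - z%:~R ^+ 2))) /=.
rewrite [X in _ + X]big1 ?addr0; last first.
  move=> m; rewrite negb_and -!ltNge => /orP[m0|m0].
    by rewrite nsq_lt0 // mul0r.
  by rewrite g0 ?mulr0 // subr_lt0.
rewrite [RHS](bigID (fun m : int => (z ^+ 2 <= m) && (m%:~R <= t))) /=.
rewrite [X in _ = _ + X]big1 ?addr0; last first.
  move=> m; rewrite negb_and -!ltNge => /orP[m0|m0].
    by rewrite nsq_lt0 ?mul0r // subr_lt0.
  by rewrite g0 ?mulr0 // subr_lt0.
rewrite -(@big_bij _ _ _ (zrange M) (zrange M)
   (fun m : int => (0 <= m) && (m%:~R <= t - z%:~R ^+ 2)) _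
   (fun m => m + z ^+ 2) (fun m => m - z ^+ 2)
   (fun m => (nsq K d (m - z ^+ 2))%:~R * g (t - m%:~R))) ?zrange_uniq //.
- apply: eq_bigr => m _; rewrite addrK rmorphD rmorphXn /=.
  by congr (_ * g _); ring.
- move=> m _ /andP[m0 mt].
  have mt' : (m + z ^+ 2)%:~R <= t by rewrite rmorphD rmorphXn /= -lerBrDr.
  have z0 : 0 <= z ^+ 2 by exact: sqr_ge0.
  split; last by rewrite addrK.
    rewrite mem_zrange ger0_norm; last by rewrite addr_ge0.
    by rewrite -(ler_int R); apply: (le_trans mt').
  by rewrite mt' andbT lerDr.
- move=> m _ /andP[m0 mt].
  have z0 : 0 <= z ^+ 2 by exact: sqr_ge0.
  split; last by rewrite subrK.
    rewrite mem_zrange ger0_norm; last by rewrite subr_ge0.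
    rewrite -(ler_int R); apply: le_trans tM; apply: le_trans mt.
    by rewrite ler_int gerBl.
  by rewrite subr_ge0 m0 rmorphB rmorphXn /= lerD2r.
Qed.

Definition step0 (t : R) : R := if 0 <= t then 1 else 0.

Lemma step0_lt0 (t : R) : t < 0 -> step0 t = 0.
Proof. by rewrite /step0 ltNge => /negPf ->. Qed.

Definition lin6 (d b : nat) : int := (16 * chi b%:Z - 4 * chi d%:Z) * (d * d)%N%:Z.

(** For a fixed cofactor b the squares d^2 run over d <= T / b; this inner sum yields the cubic main
    term and the sawtooth functions of t / b. *)
Lemma sum_e6 (K T : nat) : (T <= K)%N ->
  \sum_(0 <= n < T.+1) e6 K n%:Z =
  1 + \sum_(1 <= b < T.+1) \sum_(1 <= d < (T %/ b).+1) lin6 d b.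
Proof.
move=> TK; rewrite /e6 big_split /=; congr (_ + _).
  by rewrite big_ltn //= big_nat big1 ?addr0 // => i /andP[i0 _]; case: eqP => //; lia.
pose F (p : int * int) : int := (16 * chi p.2 - 4 * chi p.1) * p.1 ^+ 2.
pose s' := [seq (b, d) | b <- index_iota 1 T.+1, d <- index_iota 1 T.+1].
have us' : uniq s'.
  by apply: allpairs_uniq; rewrite ?iota_uniq // => -[a b] [c d] _ _ [-> ->].
transitivity (\sum_(0 <= n < T.+1) \sum_(1 <= b < T.+1) \sum_(1 <= d < T.+1)
   (if (d * b == n)%N then lin6 d b else 0)).
  rewrite big_nat [RHS]big_nat; apply: eq_bigr => n /andP[_ nT].
  transitivity (\sum_(p <- s' | (p.2 * p.1 == n)%N) lin6 p.2 p.1); last first.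
    by rewrite big_mkcond /s' big_allpairs_dep.
  pose f (p : nat * nat) : int * int := (p.2%:Z, p.1%:Z).
  pose g (p : int * int) : nat * nat := (absz p.2, absz p.1).
  rewrite -(@big_bij _ _ _ s' (pairs K) (fun p => (p.2 * p.1 == n)%N) _ f g F)
    ?pairs_uniq //.
  - move=> [b d]; rewrite mem_allpairs_pair !mem_index_iota /f /g /isfact mem_pairs /=.
    move=> h1 /eqP h2; split => //; last by lia.
    by apply/andP; split; lia.
  - move=> [d e] _ /and3P[/= d0 e0 /eqP h].
    rewrite mem_allpairs_pair !mem_index_iota /f /g /=; split.
    + by apply/andP; split; nia.
    + by apply/eqP; nia.
    + by congr (_, _); lia.
rewrite exchange_big /=; apply: eq_big_nat => b /andP[b0 bT].
rewrite exchange_big /=.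
rewrite [RHS](@big_nat_widen _ _ _ _ _ T.+1); last by rewrite ltnS leq_div.
rewrite [RHS]big_mkcond; apply: eq_big_nat => d /andP[d0 dT] /=.
rewrite ltnS leq_divRL //; case: leqP => dbT.
  rewrite (bigD1_seq (d * b)%N) ?iota_uniq ?mem_index_iota //= eqxx big1 ?addr0 // => n.
  by rewrite eq_sym => /negPf ->.
rewrite big_nat big1 // => n /andP[_ nT]; case: eqP => //; lia.
Qed.

Lemma sum_sqr_psi (m : nat) (y : R) : m%:R <= y < m%:R + 1 -> 1 <= y ->
  `|\sum_(1 <= d < m.+1) (d * d)%N%:R - (y ^+ 3 / 3 - y ^+ 2 * psi y)| <= 2 * y.
Proof.
move=> my y1.
have -> : \sum_(1 <= d < m.+1) (d * d)%N%:R = m%:R * (m%:R + 1) * (2 * m%:R + 1) / 6 :> R.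
  elim: m {my} => [|m IH]; first by rewrite big_nil !mul0r.
  by rewrite big_nat_recr //= IH natrM -natr1; field.
have fE : psi y = y - m%:R - 2^-1 by rewrite /psi (@frE _ _ m%:Z) -?pmulrn.
have -> : m%:R = y - psi y - 2^-1 by rewrite fE; ring.
have /andP[p1 p2] : - (1/2) <= psi y <= 1/2.
  by rewrite fE; case/andP: my => ? ?; apply/andP; split; qlra.
set p := psi y in p1 p2 *.
rewrite (_ : _ - _ = y * p ^+ 2 - p ^+ 3 / 3 - (y - p) / 12); last by field.
have q0 : 0 <= p ^+ 2 by exact: sqr_ge0.
have q1 : p ^+ 2 <= 1/4 by rewrite expr2; nra.
have y0 : 0 <= y * p ^+ 2 by rewrite mulr_ge0 //; qlra.
have y2 : y * p ^+ 2 <= y * (1/4) by rewrite ler_wpM2l //; qlra.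
have c1 : p ^+ 3 <= 1 by rewrite exprS; nra.
have c2 : -1 <= p ^+ 3 by rewrite exprS; nra.
by rewrite ler_norml; apply/andP; split; qlra.
Qed.

(** For y >= 0, 1/2 - omega y is the sum of chi(d) over 1 <= d <= y, namely the floor of (y + 3) / 4
    minus that of (y + 1) / 4. *)
Definition omega (y : R) : R := psi ((y + 3) / 4) - psi ((y + 1) / 4).

Lemma sum_chi_sqr (j : nat) :
  \sum_(1 <= d < (4 * j).+1) chi d%:Z * (d * d)%N%:Z = - 8 * (j * j)%N%:Z.
Proof.
elim: j => [|j IH]; first by rewrite big_nil.
rewrite (_ : (4 * j.+1).+1 = (4 * j).+1.+4); last by lia.
do 4! rewrite big_nat_recr //=; rewrite IH.
have -> : chi (4 * j).+1%:Z = 1 by have [k [r [h r4 ->]]] := chiE (4 * j).+1%:Z; do ![case: eqP => ?]; lia.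
have -> : chi (4 * j).+2%:Z = 0 by have [k [r [h r4 ->]]] := chiE (4 * j).+2%:Z; do ![case: eqP => ?]; lia.
have -> : chi (4 * j).+3%:Z = -1 by have [k [r [h r4 ->]]] := chiE (4 * j).+3%:Z; do ![case: eqP => ?]; lia.
have -> : chi (4 * j).+4%:Z = 0 by have [k [r [h r4 ->]]] := chiE (4 * j).+4%:Z; do ![case: eqP => ?]; lia.
lia.
Qed.

Lemma sum_chi_omega (m : nat) (y : R) : m%:R <= y < m%:R + 1 -> 1 <= y ->
  `|(\sum_(1 <= d < m.+1) chi d%:Z * (d * d)%N%:Z)%:~R + y ^+ 2 * omega y| <= 4 * y.
Proof.
move=> /andP[my ym] y1.
have mE := divn_eq m 4; have m4 := ltn_pmod m (isT : (0 < 4)%N).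
set j := (m %/ 4)%N in mE; set r := (m %% 4)%N in mE m4.
have {}mE : m = (4 * j + r)%N by rewrite mulnC.
have jR : 0 <= j%:R :> R by [].
have mR : m%:R = 4 * j%:R + r%:R :> R by rewrite mE natrD natrM.
have S0 := sum_chi_sqr j.
have c1 : chi (4 * j).+1%:Z = 1 by have [k [i [h r4 ->]]] := chiE (4 * j).+1%:Z; do ![case: eqP => ?]; lia.
have c2 : chi (4 * j).+2%:Z = 0 by have [k [i [h r4 ->]]] := chiE (4 * j).+2%:Z; do ![case: eqP => ?]; lia.
have c3 : chi (4 * j).+3%:Z = -1 by have [k [i [h r4 ->]]] := chiE (4 * j).+3%:Z; do ![case: eqP => ?]; lia.
have omE (a b : int) : a%:~R <= (y + 3) / 4 < a%:~R + 1 -> b%:~R <= (y + 1) / 4 < b%:~R + 1 ->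
    omega y = 2^-1 - (a%:~R - b%:~R).
  by move=> ha hb; rewrite /omega /psi (frE ha) (frE hb); field.
have nz (k : nat) : k%:Z%:~R = k%:R :> R by rewrite -pmulrn.
have j0 : j%:Z%:~R = j%:R :> R by rewrite -pmulrn.
have j1 : (j%:Z + 1)%:~R = j%:R + 1 :> R by rewrite intrD -pmulrn.
have V0 : (\sum_(1 <= d < (4 * j).+1) chi d%:Z * (d * d)%N%:Z)%:~R = - 8 * j%:R ^+ 2 :> R.
  by rewrite S0 intrM -pmulrn natrM expr2; congr (_ * _).
have V1 : (\sum_(1 <= d < (4 * j).+2) chi d%:Z * (d * d)%N%:Z)%:~R =
    8 * j%:R ^+ 2 + 8 * j%:R + 1 :> R.
  rewrite big_nat_recr //= c1 mul1r intrD V0 nz natrM.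
  by rewrite (_ : (4 * j).+1%:R = 4 * j%:R + 1 :> R) -?natr1 ?natrM //; ring.
have V2 : (\sum_(1 <= d < (4 * j).+3) chi d%:Z * (d * d)%N%:Z)%:~R =
    8 * j%:R ^+ 2 + 8 * j%:R + 1 :> R.
  by rewrite big_nat_recr //= c2 mul0r addr0.
have V3 : (\sum_(1 <= d < (4 * j).+4) chi d%:Z * (d * d)%N%:Z)%:~R =
    - 8 * (j%:R + 1) ^+ 2 :> R.
  rewrite big_nat_recr //= c3 mulN1r intrB V2 nz natrM.
  have -> : (4 * j).+3%:R = 4 * j%:R + 3 :> R by rewrite -addn3 natrD natrM.
  ring.
pose u := y - m%:R.
have yE : y = m%:R + u by rewrite /u; ring.
have u0 : 0 <= u by rewrite /u; qlra.
have u1 : u < 1 by rewrite /u; qlra.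
clear S0 c1 c2 c3.
have q0 : 0 <= j%:R * u by rewrite mulr_ge0.
have q1 : u * u <= u by rewrite ler_piMr // ltW.
have q2 : 0 <= u * u by rewrite mulr_ge0.
have q3 : j%:R * u <= j%:R by rewrite ler_piMr // ltW.
case: r m4 mE mR => [|[|[|[|//]]]] _ mE mR; rewrite {1}mE ?addn0 ?addn1 ?addn2 ?addn3.
- rewrite (omE j%:Z j%:Z) ?j0; try (clear q0 q1 q2 q3; apply/andP; split; qlra).
  rewrite V0 subrr subr0 yE mR ler_norml !expr2; apply/andP; split; qlra.
- rewrite (omE (j%:Z + 1) j%:Z) ?j0 ?j1; try (clear q0 q1 q2 q3; apply/andP; split; qlra).
  rewrite V1 yE mR ler_norml !expr2; apply/andP; split; qlra.
- rewrite (omE (j%:Z + 1) j%:Z) ?j0 ?j1; try (clear q0 q1 q2 q3; apply/andP; split; qlra).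
  rewrite V2 yE mR ler_norml !expr2; apply/andP; split; qlra.
- rewrite (omE (j%:Z + 1) (j%:Z + 1)) ?j1; try (clear q0 q1 q2 q3; apply/andP; split; qlra).
  rewrite V3 subrr subr0 yE mR ler_norml !expr2; apply/andP; split; qlra.
Qed.

Lemma sum_inv_sqr_le (A B : nat) : (0 < A)%N ->
  \sum_(A.+1 <= b < B.+1) (b%:R ^+ 2)^-1 <= A%:R^-1 :> R.
Proof.
move=> A0; case: (leqP B A) => BA; first by rewrite big_geq // invr_ge0.
suff : \sum_(A.+1 <= b < B.+1) (b%:R ^+ 2)^-1 <= A%:R^-1 - B%:R^-1 :> R.
  by move/le_trans; apply; rewrite gerBl invr_ge0.
have {BA} : (A <= B)%N by exact: ltnW.
elim: B => [|B IH]; first by move=> h; exfalso; nlia.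
rewrite leq_eqVlt => /predU1P[->|AB]; first by rewrite big_geq // subrr.
rewrite big_nat_recr //=; apply: (le_trans (lerD (IH AB) (lexx _))).
have B1 : 1 <= B%:R :> R by rewrite ler1n; nlia.
have A1 : 1 <= A%:R :> R by rewrite ler1n.
rewrite -subr_ge0 (_ : _ - _ = (B%:R * B.+1%:R ^+ 2)^-1).
  by rewrite invr_ge0 mulr_ge0 // sqr_ge0.
by rewrite -natr1; field; rewrite !gt_eqF //; qlra.
Qed.

Lemma sum_inv_le (T : nat) : \sum_(1 <= b < T.+1) b%:R^-1 <= 2 * Num.sqrt T%:R :> R.
Proof.
elim: T => [|T IH]; first by rewrite big_nil mulr_ge0.
rewrite big_nat_recr //=; apply: (le_trans (lerD IH (lexx _))).
have b0 : 0 < Num.sqrt (T.+1%:R : R) by rewrite sqrtr_gt0.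
have b1 : 1 <= Num.sqrt (T.+1%:R : R) by rewrite -[leLHS]sqrtr1 ler_sqrt // ler1n.
have h : Num.sqrt (T.+1%:R : R) ^+ 2 = Num.sqrt T%:R ^+ 2 + 1 by rewrite !sqr_sqrtr // natr1.
have := @invr_step R (Num.sqrt T%:R) (Num.sqrt T.+1%:R).
rewrite sqrtr_ge0 ler_sqrt // ler_nat leqnSn => /(_ isT b0 h).
move=> k2; have k1 : T.+1%:R^-1 <= (Num.sqrt (T.+1%:R : R))^-1.
  rewrite lef_pV2 ?posrE // -{2}(@sqr_sqrtr _ (T.+1%:R : R)) // expr2.
  by rewrite ler_peMr // ltW.
apply: (le_trans (lerD (lexx _) (le_trans k1 k2))).
by rewrite mulrBr addrCA subrr addr0.
Qed.

(** L is L(3, chi). Consecutive partial sums differ by at most (T + 1)^(-3) <= T^(-2) - (T +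
    1)^(-2), so the intervals of radius T^(-2) around them are nested, and L is the supremum of
    their left ends. *)
Lemma dirichlet_L3 : exists L : R, forall T, (0 < T)%N ->
  `|\sum_(1 <= b < T.+1) (chi b%:Z)%:~R / b%:R ^+ 3 - L| <= (T%:R ^+ 2)^-1.
Proof.
pose S T : R := \sum_(1 <= b < T.+1) (chi b%:Z)%:~R / b%:R ^+ 3.
pose e (T : nat) : R := (T%:R ^+ 2)^-1.
have step T : (0 < T)%N -> `|S T.+1 - S T| <= e T - e T.+1.
  move=> T0; rewrite /S big_nat_recr //= [_ + _ - _]addrAC subrr add0r normrM.
  have T1 : 1 <= T%:R :> R by rewrite ler1n.
  have c1 : `|(chi T.+1%:Z)%:~R| <= 1 :> R.
    by have [k [r [_ _ ->]]] := chiE T.+1%:Z; do ![case: eqP => ?]; rewrite ?normrN ?normr1 ?normr0.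
  apply: (@le_trans _ _ (1 / T.+1%:R ^+ 3)).
    apply: ler_pM => //; rewrite ger0_norm // invr_ge0 exprn_ge0 //.
  rewrite -subr_ge0 /e -natr1.
  rewrite (_ : _ - _ - _ = (2 * T%:R ^+ 2 + 3 * T%:R + 1 - T%:R ^+ 2) / (T%:R ^+ 2 * (T%:R + 1) ^+ 3)).
    by apply: divr_ge0; [have := sqr_ge0 (T%:R : R); qlra|rewrite mulr_ge0 ?sqr_ge0 ?exprn_ge0].
  by field; apply/andP; split; rewrite gt_eqF //; qlra.
have up T j : (0 < T)%N -> S (T + j)%N + e (T + j)%N <= S T + e T /\
                           S T - e T <= S (T + j)%N - e (T + j)%N.
  move=> T0; elim: j => [|j [h1 h2]]; first by rewrite addn0.
  have := step (T + j)%N ltac:(nlia); rewrite addnS ler_norml => /andP[h3 h4].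
  by split; qlra.
have cross T T' : (0 < T)%N -> (0 < T')%N -> S T - e T <= S T' + e T'.
  move=> T0 T0'.
  have [a1 a2] := up T T' T0; have [b1 b2] := up T' T T0'.
  have : 0 <= e (T + T')%N by rewrite invr_ge0 sqr_ge0.
  by rewrite addnC in b1 b2; qlra.
pose A : set R := [set x | exists2 T, (0 < T)%N & x = S T - e T].
have A0 : A !=set0 by exists (S 1%N - e 1%N); exists 1%N.
have ubA T : (0 < T)%N -> ubound A (S T + e T).
  by move=> T0 x [T' T0' ->]; exact: cross.
have supA : has_sup A by split => //; exists (S 1%N + e 1%N); exact: ubA.
exists (sup A) => T T0.
have h1 : S T - e T <= sup A by apply: sup_upper_bound => //; exists T.
have h2 : sup A <= S T + e T by apply: ge_sup => //; exact: ubA.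
by rewrite ler_norml -/(S T) -/(e T); apply/andP; split; qlra.
Qed.

End SixDimBall.

Section BallSix.
Variable R : realType.

(** For cofactor b the sum of [lin6] over d <= t / b is its cubic term minus (t / b)^2 times this,
    up to an error of order t / b. *)
Definition coef6 (t : R) (b : nat) : R :=
  16 * (chi b%:Z)%:~R * psi (t / b%:R) - 4 * omega (t / b%:R).

Definition osc6 (B : nat) (t : R) : R :=
  if 0 <= t then - t ^+ 2 * \sum_(1 <= b < B.+1) coef6 t b / b%:R ^+ 2 else 0.

Definition ball6 (K : nat) : R -> R := iter 6 (theta K) (@step0 R).

Lemma norm_psi (x : R) : `|psi x| <= 1 / 2.
Proof. by have /andP[f0 f1] := fr_itv x; rewrite /psi ler_norml; apply/andP; split; qlra. Qed.

Lemma norm_chi (m : int) : `|(chi m)%:~R| <= 1 :> R.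
Proof.
have [k [r [_ _ ->]]] := chiE m.
by do ![case: eqP => ?]; rewrite ?mulrN1z ?normrN ?normr1 ?normr0 // ?ler01.
Qed.

Lemma norm_coef6 (t : R) (b : nat) : `|coef6 t b| <= 12.
Proof.
rewrite /coef6 /omega; apply: (le_trans (ler_normB _ _)).
have h1 : `|16 * (chi b%:Z)%:~R * psi (t / b%:R)| <= 16 * (1 * (1/2)) :> R.
  rewrite -mulrA normrM ger0_norm // ler_pM2l // normrM.
  by apply: ler_pM => //; [exact: norm_chi|exact: norm_psi].
have h2 : `|4 * (psi ((t / b%:R + 3) / 4) - psi ((t / b%:R + 1) / 4))| <= 4 * (1/2 + 1/2).
  rewrite normrM ger0_norm // ler_pM2l //; apply: (le_trans (ler_normB _ _)).
  by apply: lerD; exact: norm_psi.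
qlra.
Qed.

Lemma ball6E (K : nat) (t : R) : 0 <= t <= K%:R ->
  ball6 K t = (\sum_(0 <= n < (Num.truncn t).+1) e6 K n%:Z)%:~R.
Proof.
move=> /andP[t0 tK]; set T := Num.truncn t.
have T1 : T%:R <= t by rewrite truncn_le.
have T2 : t < T.+1%:R by exact: truncnS_gt.
have TK : (T <= K)%N by rewrite -(ler_nat R); apply: le_trans tK.
rewrite /ball6 (iter_thetaE _ _ (@step0_lt0 R) tK).
move: (nsq K 6) (@nsq_lt0 K 6) (fun n => @six_squares K n) => N N0 N6.
rewrite (bigID (fun m : int => (0 <= m) && (m%:~R <= t))) /=.
rewrite [X in _ + X]big1 ?addr0; last first.
  move=> m; rewrite negb_and -!ltNge => /orP[m0|m0].
    by rewrite N0 // mul0r.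
  by rewrite step0_lt0 ?mulr0 // subr_lt0.
have us : uniq [seq n%:Z | n <- index_iota 0 T.+1].
  by rewrite map_inj_uniq ?iota_uniq // => a b [].
transitivity (\sum_(m <- [seq n%:Z | n <- index_iota 0 T.+1]) (N m)%:~R : R); last first.
  rewrite big_map rmorph_sum /=; apply: eq_big_nat => n /andP[_ nT].
  by rewrite -N6 //; apply: leq_trans TK.
rewrite -(@big_bij _ _ _ (zrange K) [seq n%:Z | n <- index_iota 0 T.+1]
  (fun m : int => (0 <= m) && (m%:~R <= t)) xpredT id id (fun m => (N m)%:~R)) ?zrange_uniq //.
- apply: eq_bigr => m /andP[_ mt]; rewrite /step0 subr_ge0 mt mulr1 //.
- move=> m _ /andP[m0 mt]; split => //; apply/mapP; exists (absz m); last by lia.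
  rewrite mem_index_iota /= -(ltr_nat R); apply: le_lt_trans T2; apply: le_trans mt.
  by rewrite pmulrn; move: m0; case: m => //.
- move=> m /mapP[n]; rewrite mem_index_iota => /andP[_ nT] -> _; split => //.
    by rewrite mem_zrange; lia.
  by rewrite /= -pmulrn; apply: le_trans T1; rewrite ler_nat -ltnS.
Qed.

Lemma quot_itv (T b : nat) (t : R) : (0 < b)%N -> T%:R <= t < T.+1%:R ->
  (T %/ b)%:R <= t / b%:R < (T %/ b)%:R + 1.
Proof.
move=> b0 /andP[h1 h2]; have bR : 0 < b%:R :> R by rewrite ltr0n.
rewrite ler_pdivlMr // ltr_pdivrMr // -natrM natr1 -natrM; apply/andP; split.
  by apply: le_trans h1; rewrite ler_nat leq_divM.
by apply: (lt_le_trans h2); rewrite ler_nat; exact: ltn_ceil.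
Qed.

Lemma tail_diff (w : nat -> R) (T B : nat) : (0 < T)%N -> (0 < B)%N ->
  (forall b, `|w b| <= 12) ->
  `|\sum_(1 <= b < T.+1) w b / b%:R ^+ 2 - \sum_(1 <= b < B.+1) w b / b%:R ^+ 2|
    <= 12 * (T%:R^-1 + B%:R^-1).
Proof.
move=> T0 B0 w12.
wlog TB : T B T0 B0 / (T <= B)%N.
  move=> h; case: (leqP T B) => TB; first exact: h.
  by rewrite distrC [_^-1 + _]addrC; apply: h => //; exact: ltnW.
rewrite (@big_cat_nat _ _ _ T.+1 1 B.+1) //= opprD addrA subrr sub0r normrN.
apply: (le_trans (ler_norm_sum _ _ _)).
apply: (@le_trans _ _ (12 * \sum_(T.+1 <= b < B.+1) (b%:R ^+ 2)^-1)).
  rewrite mulr_sumr; apply: ler_sum => b _; rewrite normrM normfV.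
  by rewrite (ger0_norm (sqr_ge0 _)) ler_wpM2r ?invr_ge0 ?sqr_ge0.
rewrite ler_pM2l //; apply: (le_trans (sum_inv_sqr_le R B T0)).
by rewrite lerDl invr_ge0.
Qed.

Lemma sum_inv_sqr2 (B : nat) : \sum_(1 <= b < B.+1) (b%:R ^+ 2)^-1 <= 2 :> R.
Proof.
case: B => [|B]; first by rewrite big_nil.
rewrite big_ltn // expr1n invr1.
have := @sum_inv_sqr_le R 1 B.+1 isT; rewrite invr1 => h.
by apply: (le_trans (lerD (lexx _) h)); qlra.
Qed.

Lemma norm_osc_sum (t : R) (B : nat) :
  `|\sum_(1 <= b < B.+1) coef6 t b / b%:R ^+ 2| <= 24.
Proof.
apply: (le_trans (ler_norm_sum _ _ _)).
apply: (@le_trans _ _ (12 * \sum_(1 <= b < B.+1) (b%:R ^+ 2)^-1)).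
  rewrite mulr_sumr; apply: ler_sum => b _; rewrite normrM normfV.
  by rewrite (ger0_norm (sqr_ge0 _)) ler_wpM2r ?invr_ge0 ?sqr_ge0 // norm_coef6.
by have := sum_inv_sqr2 B; qlra.
Qed.

Theorem ball6_approx : exists c C : R, 0 <= C /\
  forall (K : nat) (y X t : R), 1 <= y -> X = y ^+ 3 -> X <= K%:R -> 0 <= t <= X ->
  `|ball6 K t - c * t ^+ 3 - osc6 (Num.truncn y) t| <= C * y ^+ 5.
Proof.
have [L hL] := dirichlet_L3 R.
(* The main coefficient collects 16 chi(b) (t / b)^3 / 3 over b; the sums twisted by chi(d) have no
   cubic term. *)
exists (16 / 3 * L), (200 + `|16 / 3 * L|); split; first by rewrite addr_ge0 ?ler0n.
move=> K y X t y1 XE XK /andP[t0 tX]; set c := 16 / 3 * L; set B := Num.truncn y.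
have y5 : 1 <= y ^+ 5 by apply: exprn_ege1.
have y3 : y ^+ 3 <= y ^+ 5 by rewrite ler_weXn2l.
rewrite ball6E; last by rewrite t0 (le_trans tX).
set T := Num.truncn t.
have T1 : T%:R <= t by rewrite truncn_le.
have T2 : t < T.+1%:R by exact: truncnS_gt.
have TK : (T <= K)%N by rewrite -(ler_nat R); apply: (le_trans T1); apply: le_trans XK.
rewrite sum_e6 // intrD /osc6 t0.
set Z := \sum_(1 <= b < B.+1) _.
have hZ : `|Z| <= 24 by exact: norm_osc_sum.
case: (posnP T) => [T0|T0].
  rewrite T0 big_geq //; have t1 : t < 1 by move: T2; rewrite T0.
  rewrite addr0 -pmulrn.
  have h3 : `|c * t ^+ 3| <= `|c|.
    rewrite normrM ler_piMr // normrX ger0_norm //.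
    by rewrite exprn_ile1 // ltW.
  have h2 : `|- t ^+ 2 * Z| <= 24.
    rewrite normrM normrN normrX ger0_norm // -[leRHS]mul1r.
    by apply: ler_pM => //; rewrite ?exprn_ge0 // exprn_ile1 // ltW.
  apply: (le_trans (ler_normB _ _)); apply: (le_trans (lerD (ler_normB _ _) (lexx _))).
  rewrite normr1; apply: (@le_trans _ _ ((200 + `|c|) * 1)); first by qlra.
  by rewrite ler_wpM2l ?addr_ge0 ?ler0n.
have t1 : 1 <= t by apply: le_trans T1; rewrite ler1n.
have TR : 1 <= T%:R :> R by rewrite ler1n.
have B0 : (0 < B)%N by rewrite truncn_gt0.
have B1 : y < B.+1%:R by exact: truncnS_gt.
have BR : 1 <= B%:R :> R by rewrite ler1n.
pose Q b : R := \sum_(1 <= d < (T %/ b).+1) (d * d)%N%:R.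
pose Rb b : R := (\sum_(1 <= d < (T %/ b).+1) chi d%:Z * (d * d)%N%:Z)%:~R.
pose E b : R := 16 * (chi b%:Z)%:~R * (Q b - ((t / b%:R) ^+ 3 / 3 - (t / b%:R) ^+ 2 * psi (t / b%:R)))
  - 4 * (Rb b + (t / b%:R) ^+ 2 * omega (t / b%:R)).
have hE b : (1 <= b < T.+1)%N -> `|E b| <= 48 * t * b%:R^-1.
  move=> /andP[b0 bT]; have bR : 0 < b%:R :> R by rewrite ltr0n.
  have itv := quot_itv b0 (introT andP (conj T1 T2)).
  have yb : 1 <= t / b%:R.
    by rewrite ler_pdivlMr // mul1r; apply: le_trans T1; rewrite ler_nat.
  have h1 := sum_sqr_psi itv yb; have h2 := sum_chi_omega itv yb.
  rewrite /E; apply: (le_trans (ler_normB _ _)).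
  have h3 : `|16 * (chi b%:Z)%:~R * (Q b - ((t / b%:R) ^+ 3 / 3 - (t / b%:R) ^+ 2 * psi (t / b%:R)))|
     <= 16 * (1 * (2 * (t / b%:R))).
    rewrite -mulrA normrM ger0_norm // ler_pM2l // normrM.
    by apply: ler_pM => //; exact: norm_chi.
  have h4 : `|4 * (Rb b + (t / b%:R) ^+ 2 * omega (t / b%:R))| <= 4 * (4 * (t / b%:R)).
    by rewrite normrM ger0_norm // ler_pM2l.
  by apply: (le_trans (lerD h3 h4)); rewrite -(mulrA 48); qlra.
pose S : R := \sum_(1 <= b < T.+1) (chi b%:Z)%:~R / b%:R ^+ 3.
pose W : R := \sum_(1 <= b < T.+1) coef6 t b / b%:R ^+ 2.
have main : (\sum_(1 <= b < T.+1) \sum_(1 <= d < (T %/ b).+1) lin6 d b)%:~R =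
    16 / 3 * t ^+ 3 * S - t ^+ 2 * W + \sum_(1 <= b < T.+1) E b.
  rewrite rmorph_sum /= /S /W !mulr_sumr -sumrB -big_split /=.
  apply: eq_big_nat => b /andP[b0 _].
  have bR : b%:R != 0 :> R by rewrite pnatr_eq0 -lt0n.
  have -> : (\sum_(1 <= d < (T %/ b).+1) lin6 d b)%:~R =
      16 * (chi b%:Z)%:~R * Q b - 4 * Rb b.
    rewrite /Rb /Q !rmorph_sum /= !mulr_sumr -sumrB; apply: eq_bigr => d _.
    by rewrite /lin6 intrM intrB !intrM -!pmulrn; ring.
  by rewrite /E /coef6; field.
rewrite main.
have p1 : `|16 / 3 * t ^+ 3 * (S - L)| <= 24 * y ^+ 5.
  rewrite normrM (ger0_norm (_ : 0 <= 16 / 3 * t ^+ 3)); last by rewrite mulr_ge0 // exprn_ge0.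
  apply: (@le_trans _ _ (16 / 3 * t ^+ 3 * (T%:R ^+ 2)^-1)).
    by rewrite ler_wpM2l ?hL // mulr_ge0 // exprn_ge0.
  rewrite -mulrA; have : t ^+ 3 / T%:R ^+ 2 <= 4 * t.
    rewrite ler_pdivrMr ?exprn_gt0 //; last by qlra.
    have tT : t <= 2 * T%:R by rewrite -natr1 in T2; qlra.
    have : t ^+ 2 <= (2 * T%:R) ^+ 2 by rewrite ler_pXn2r ?nnegrE //; qlra.
    rewrite exprMn => h.
    by rewrite exprS (mulrC 4) -mulrA ler_wpM2l //; qlra.
  by move: tX; rewrite XE; qlra.
(* Moving the cutoff from T to B costs t^2 (1 / T + 1 / B), and X^2 / B is what fixes the error at
   order y^5. *)
have p2 : `|t ^+ 2 * (W - Z)| <= 48 * y ^+ 5.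
  rewrite normrM (ger0_norm (sqr_ge0 t)).
  have := @tail_diff (coef6 t) T B T0 B0 (norm_coef6 t); rewrite -/W -/Z => h.
  apply: (@le_trans _ _ (t ^+ 2 * (12 * (T%:R^-1 + B%:R^-1)))); first by rewrite ler_wpM2l ?sqr_ge0.
  have a1 : t ^+ 2 / T%:R <= 2 * t.
    rewrite ler_pdivrMr; last by qlra.
    have tT : t <= 2 * T%:R by rewrite -natr1 in T2; qlra.
    by rewrite expr2 (mulrC 2) -mulrA ler_wpM2l.
  have a2 : t ^+ 2 / B%:R <= 2 * y ^+ 5.
    rewrite ler_pdivrMr; last by qlra.
    have tT : y <= 2 * B%:R by rewrite -natr1 in B1; qlra.
    apply: (@le_trans _ _ (X ^+ 2)); first by rewrite ler_pXn2r ?nnegrE //; qlra.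
    rewrite XE -exprM (exprS y 5) [leRHS](_ : _ = (2 * B%:R) * y ^+ 5); last by ring.
    by rewrite ler_wpM2r //; qlra.
  by move: a1 a2 tX; rewrite XE; qlra.
(* The crude bound 2 sqrt T for the harmonic sum is affordable: t sqrt T <= y^3 y^2. *)
have p3 : `|\sum_(1 <= b < T.+1) E b| <= 96 * y ^+ 5.
  apply: (le_trans (ler_norm_sum _ _ _)).
  apply: (@le_trans _ _ (48 * t * \sum_(1 <= b < T.+1) b%:R^-1)).
    by rewrite mulr_sumr !big_nat; apply: ler_sum => b; exact: hE.
  apply: (@le_trans _ _ (48 * t * (2 * y ^+ 2))); last first.
    have : t * y ^+ 2 <= y ^+ 3 * y ^+ 2 by rewrite ler_wpM2r ?sqr_ge0 // -XE.
    by rewrite -exprD; qlra.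
  apply: ler_wpM2l; first by rewrite mulr_ge0.
  apply: (le_trans (sum_inv_le R T)); rewrite ler_pM2l //.
  rewrite -[leRHS]ger0_norm ?sqr_ge0 // -sqrtr_sqr ler_wsqrtr //.
  apply: (le_trans T1); apply: (le_trans tX); rewrite XE -exprM.
  by rewrite ler_weXn2l.
rewrite -pmulrn.
rewrite (_ : _ - _ - _ = 1 + 16 / 3 * t ^+ 3 * (S - L) - t ^+ 2 * (W - Z) + \sum_(1 <= b < T.+1) E b); last first.
  by rewrite /c; ring.
apply: (le_trans (ler_normD _ _)); apply: (le_trans (lerD (ler_normB _ _) (lexx _))).
apply: (le_trans (lerD (lerD (ler_normD _ _) (lexx _)) (lexx _))).
rewrite normr1.
have : 0 <= `|c| * y ^+ 5 by rewrite mulr_ge0 //; qlra.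
qlra.
Qed.

End BallSix.

(** * Euler-Maclaurin summation of powers of a semicircle *)

Section EulerMaclaurin.
Variable R : realType.

Lemma is_derive_cvg (f : R -> R) (x l : R) :
  (h^-1 *: (f (h + x) - f x) @[h --> 0^']) --> l -> is_derive x 1 f l.
Proof.
move=> fl.
have e : (fun h : R => h^-1 *: ((f \o shift x) (h *: 1) - f x)) =
         (fun h : R => h^-1 *: (f (h + x) - f x)).
  by apply/funext => h /=; rewrite /GRing.scale /= mulr1.
apply: DeriveDef; first by rewrite /derivable e; exact: (cvgP l).
by rewrite /derive e; apply: cvg_lim.
Qed.

(** Holds at every t: [Num.sqrt] is 0 on negative numbers, and an exponent of at least 3 makes the
    junction at 0 differentiable. Semicircle powers extended by zero can thus be handled on the
    whole line. *)
Lemma is_derive_sqrtX (k : nat) (t : R) :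
  is_derive t 1 (fun t => Num.sqrt t ^+ k.+3) (k.+3%:R / 2 * Num.sqrt t ^+ k.+1).
Proof.
have [t0|t0|t0] := ltgtP t 0.
- rewrite (_ : Num.sqrt t = 0) ?expr0n ?mulr0 /=; last by rewrite ltr0_sqrtr.
  have d0 := is_derive_cst (0 : R) t (1 : R); apply: near_eq_is_derive d0.
  have : \forall x \near t, x < 0 by exact: lt_nbhsl.
  by apply: filterS => x x0; rewrite ltr0_sqrtr // expr0n.
- have d := is_derive1_sqrt t0.
  have d2 := @is_deriveX _ _ Num.sqrt k.+3 t 1 _ d.
  have -> : (fun t => Num.sqrt t ^+ k.+3) = (@Num.sqrt R) ^+ k.+3.
    by apply/funext => x; rewrite exprfctE.
  apply: (is_derive_eq d2); rewrite /GRing.scale /=.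
  have s0 : Num.sqrt t != 0 by rewrite gt_eqF // sqrtr_gt0.
  by rewrite (exprS _ k.+1); field.
- rewrite t0 sqrtr0 expr0n mulr0 /=; apply: is_derive_cvg.
  have h : Num.sqrt h ^+ k.+1 @[h --> (0 : R)] --> (0 : R).
    have -> : 0 = Num.sqrt 0 ^+ k.+1 :> R by rewrite sqrtr0 expr0n.
    rewrite {1}sqrtr0 expr0n /=.
    exact: (continuous_comp (@sqrt_continuous R 0) (@exprn_continuous R k.+1 _)).
  have {}h : Num.sqrt h ^+ k.+1 @[h --> (0 : R)^'] --> (0 : R) by exact: cvg_within_filter h.
  apply: cvg_trans h; apply: near_eq_cvg.
  have := @nbhs_dnbhs_neq R (0 : R); apply: filterS => h h0.
  rewrite addr0 sqrtr0 expr0n subr0 /GRing.scale /=.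
  have [h1|h1|h1] := ltgtP h 0; last by rewrite h1 eqxx in h0.
    by rewrite ltr0_sqrtr // !expr0n mulr0.
  have hE : h = Num.sqrt h ^+ 2 by rewrite sqr_sqrtr // ltW.
  have : 0 < Num.sqrt h by rewrite sqrtr_gt0.
  move: (Num.sqrt h) hE => s -> s0.
  by rewrite (exprS _ k.+2) (exprS _ k.+1); field; rewrite gt_eqF.
Qed.

Lemma odd_kernel (D D' : R -> R) (M : R) :
  (forall h : R, 0 <= h <= 1/2 -> is_derive h 1 D (D' h)) -> D 0 = 0 ->
  (forall h : R, 0 <= h <= 1/2 -> `|D' h| <= M) ->
  forall h : R, 0 <= h <= 1/2 -> `|D h| <= M / 2.
Proof.
move=> dD D0 bD h h01.
have z01 : 0 <= (0 : R) <= 1/2 by apply/andP; split; qlra.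
have := @mvt_bound R D D' 0 (1/2) M dD bD h 0 h01 z01.
rewrite D0 !subr0 => /le_trans; apply.
have M0 : 0 <= M by apply: (le_trans _ (bD _ z01)).
by case/andP: h01 => h0 h1; rewrite ger0_norm // ler_wpM2l //; qlra.
Qed.

Lemma is_derive_shift (f df : R -> R) (n h : R) :
  is_derive (n + h) 1 f (df (n + h)) -> is_derive h 1 (fun h : R => f (n + h)) (df (n + h)).
Proof.
move=> d.
have d2 : is_derive h 1 (fun h : R => n + h) (0 + 1) by exact: is_deriveD.
by have := is_derive1_comp d d2; rewrite add0r mulr1.
Qed.

Lemma is_derive_reflect (f df : R -> R) (n h : R) :
  is_derive (n - h) 1 f (df (n - h)) -> is_derive h 1 (fun h : R => f (n - h)) (- df (n - h)).
Proof.
move=> d.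
have d2 : is_derive h 1 (fun h : R => n - h) (0 - 1) by exact: is_deriveB.
by have := @is_derive1_comp R f (fun h : R => n - h) h _ _ d d2; rewrite sub0r mulrN1.
Qed.

Section Local.
Variables (G f0 f1 f2 : R -> R) (n M : R).
Hypothesis dG : forall x : R, n - 1/2 <= x <= n + 1/2 -> is_derive x 1 G (f0 x).
Hypothesis df0 : forall x : R, n - 1/2 <= x <= n + 1/2 -> is_derive x 1 f0 (f1 x).

Let itvp (h : R) : 0 <= h <= 1/2 -> n - 1/2 <= n + h <= n + 1/2.
Proof. by move=> /andP[? ?]; apply/andP; split; qlra. Qed.
Let itvm (h : R) : 0 <= h <= 1/2 -> n - 1/2 <= n - h <= n + 1/2.
Proof. by move=> /andP[? ?]; apply/andP; split; qlra. Qed.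

(** [D0 h] is the error of the midpoint rule on [n - h, n + h]. Differentiating twice leads to f1 (n
    + h) - f1 (n - h), so the oscillation of f1 over the cell controls the error. *)
Lemma midpoint_bound : (forall x y : R, n - 1/2 <= x <= n + 1/2 ->
    n - 1/2 <= y <= n + 1/2 -> `|f1 x - f1 y| <= M) ->
  `|G (n + 1/2) - G (n - 1/2) - f0 n| <= M.
Proof.
move=> osc.
pose hf : R := 1/2.
have h12 : 0 <= hf <= 1/2 by rewrite /hf; apply/andP; split; qlra.
pose D2 (h : R) := f1 (n + h) - f1 (n - h).
pose D1 (h : R) := f0 (n + h) + f0 (n - h) - 2 * f0 n.
pose D0 (h : R) := G (n + h) - G (n - h) - h * (2 * f0 n).
have b1 : forall h : R, 0 <= h <= 1/2 -> `|D1 h| <= M / 2.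
  apply: (@odd_kernel D1 D2).
  - move=> h hh; have e1 := is_derive_shift (df0 (itvp hh)); have e2 := is_derive_reflect (df0 (itvm hh)).
    have e3 : is_derive h 1 (cst (2 * f0 n)) 0 by exact: is_derive_cst.
    by apply: (is_derive_eq (is_deriveB (is_deriveD e1 e2) e3)); rewrite /D2 subr0.
  - by rewrite /D1 addr0 subr0; ring.
  - by move=> h hh; apply: osc; [exact: itvp|exact: itvm].
have b0 : forall h : R, 0 <= h <= 1/2 -> `|D0 h| <= M / 2 / 2.
  apply: (@odd_kernel D0 D1) => //.
  - move=> h hh; have e1 := is_derive_shift (dG (itvp hh)); have e2 := is_derive_reflect (dG (itvm hh)).
    have e3 : is_derive h 1 (fun h : R => h * (2 * f0 n)) (2 * f0 n).
      by apply: is_derive_eq; rewrite scaler0 add0r /GRing.scale /= mulr1.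
    by apply: (is_derive_eq (is_deriveB (is_deriveB e1 e2) e3)); rewrite /D1 opprK.
  - by rewrite /D0 addr0 subr0; ring.
have M0 : 0 <= M by apply: (le_trans _ (osc n n _ _)) => //; apply/andP; split; qlra.
have := b0 _ h12; rewrite /D0 /hf (_ : 1/2 * (2 * f0 n) = f0 n); last by field.
by move/le_trans; apply; qlra.
Qed.

Hypothesis df1 : forall x : R, n - 1/2 <= x <= n + 1/2 -> is_derive x 1 f1 (f2 x).

(** The next Taylor term is f2 n / 24; it is expressed through f1 (n + 1/2) - f1 (n - 1/2) because
    this telescopes over n. *)
Lemma midpoint3_bound : (forall x y : R, n - 1/2 <= x <= n + 1/2 ->
    n - 1/2 <= y <= n + 1/2 -> `|f2 x - f2 y| <= M) ->
  `|G (n + 1/2) - G (n - 1/2) - f0 n - (f1 (n + 1/2) - f1 (n - 1/2)) / 24| <= M.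
Proof.
move=> osc.
pose hf : R := 1/2.
have h12 : 0 <= hf <= 1/2 by rewrite /hf; apply/andP; split; qlra.
have nn : n - 1/2 <= n <= n + 1/2 by apply/andP; split; qlra.
pose D3 (h : R) := f2 (n + h) + f2 (n - h) - 2 * f2 n.
pose D2 (h : R) := f1 (n + h) - f1 (n - h) - h * (2 * f2 n).
pose D1 (h : R) := f0 (n + h) + f0 (n - h) - (2 * f0 n + h ^+ 2 * f2 n).
pose D0 (h : R) := G (n + h) - G (n - h) - (h * (2 * f0 n) + h ^+ 3 * (f2 n / 3)).
have b2 : forall h : R, 0 <= h <= 1/2 -> `|D2 h| <= 2 * M / 2.
  apply: (@odd_kernel D2 D3).
  - move=> h hh; have e1 := is_derive_shift (df1 (itvp hh)); have e2 := is_derive_reflect (df1 (itvm hh)).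
    have e3 : is_derive h 1 (fun h : R => h * (2 * f2 n)) (2 * f2 n).
      by apply: is_derive_eq; rewrite scaler0 add0r /GRing.scale /= mulr1.
    by apply: (is_derive_eq (is_deriveB (is_deriveB e1 e2) e3)); rewrite /D3 opprK.
  - by rewrite /D2 addr0 subr0; ring.
  - move=> h hh; rewrite /D3 (_ : _ - _ = (f2 (n + h) - f2 n) + (f2 (n - h) - f2 n)); last by ring.
    apply: (le_trans (ler_normD _ _)).
    have := osc _ _ (itvp hh) nn; have := osc _ _ (itvm hh) nn; qlra.
have b1 : forall h : R, 0 <= h <= 1/2 -> `|D1 h| <= 2 * M / 2 / 2.
  apply: (@odd_kernel D1 D2) => //.
  - move=> h hh; have e1 := is_derive_shift (df0 (itvp hh)); have e2 := is_derive_reflect (df0 (itvm hh)).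
    have e3 : is_derive h 1 (fun h : R => 2 * f0 n + h ^+ 2 * f2 n) (h * (2 * f2 n)).
      by apply: is_derive_eq; rewrite scaler0 !add0r /GRing.scale /= !mulr1; ring.
    by apply: (is_derive_eq (is_deriveB (is_deriveD e1 e2) e3)); rewrite /D2.
  - by rewrite /D1 addr0 subr0; ring.
have b0 : forall h : R, 0 <= h <= 1/2 -> `|D0 h| <= 2 * M / 2 / 2 / 2.
  apply: (@odd_kernel D0 D1) => //.
  - move=> h hh; have e1 := is_derive_shift (dG (itvp hh)); have e2 := is_derive_reflect (dG (itvm hh)).
    have e3 : is_derive h 1 (fun h : R => h * (2 * f0 n) + h ^+ 3 * (f2 n / 3)) (2 * f0 n + h ^+ 2 * f2 n).
      by apply: is_derive_eq; rewrite !scaler0 !add0r /GRing.scale /= !mulr1; field.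
    by apply: (is_derive_eq (is_deriveB (is_deriveB e1 e2) e3)); rewrite /D1 opprK.
  - by rewrite /D0 addr0 subr0; ring.
have M0 : 0 <= M by apply: (le_trans _ (osc n n _ _)).
have := b0 _ h12; have := b2 _ h12; rewrite /hf.
rewrite (_ : _ - _ - _ - _ = D0 (1/2) - D2 (1/2) / 24); last by rewrite /D0 /D2; field.
move=> k2 k0; apply: (le_trans (ler_normB _ _)).
rewrite normrM (ger0_norm (_ : 0 <= 24^-1)) //.
qlra.
Qed.

End Local.

Lemma telescope_zrange (F : R -> R) (N : nat) :
  \sum_(z <- zrange N) (F (z%:~R + 1/2) - F (z%:~R - 1/2)) =
  F (N%:R + 1/2) - F (- N%:R - 1/2).
Proof.
pose u k := F (k%:R - N%:R - 1/2).
rewrite /zrange big_map.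
transitivity (\sum_(0 <= k < (2 * N).+1) (u k.+1 - u k)).
  rewrite /index_iota subn0; apply: eq_bigr => k _.
  rewrite /u intrB -!pmulrn -natr1; congr (F _ - F _).
  by field.
rewrite telescope_sumr // /u; congr (F _ - F _); last by rewrite sub0r.
by rewrite -natr1 natrM; field.
Qed.


Definition semic (c : R) (p : nat) (x : R) : R := Num.sqrt (c - x ^+ 2) ^+ p.

Lemma is_derive_semic (c x : R) (k : nat) :
  is_derive x 1 (semic c k.+3) (- k.+3%:R * x * semic c k.+1 x).
Proof.
have d2 : is_derive x 1 (fun x : R => c - x ^+ 2) (- (2 * x)).
  by apply: is_derive_eq; rewrite /GRing.scale /=; ring.
have := @is_derive1_comp R (fun t => Num.sqrt t ^+ k.+3) (fun x : R => c - x ^+ 2) x _ _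
   (is_derive_sqrtX k _) d2.
rewrite (_ : _ * - (2 * x) = - k.+3%:R * x * semic c k.+1 x) //.
by rewrite /semic; field.
Qed.

Lemma exists_primitive (f : R -> R) (b : R) : 0 < b -> continuous f ->
  exists F : R -> R, forall x : R, - b < x < b -> is_derive x 1 F (f x).
Proof.
move=> b0 cf.
have intf : lebesgue_measure.-integrable `[- b, b] (EFin \o f).
  apply: continuous_compact_integrable; first exact: segment_compact.
  exact: continuous_subspaceT.
exists (fun x0 : R => \int[lebesgue_measure]_(t in `[- b, x0]) f t) => x /andP[bx xb].
have [d1 d2] := continuous_FTC1_closed xb intf bx (cf x).
by rewrite derive1E in d2; exact: (DeriveDef d1 d2).
Qed.

Lemma continuous_semic (c : R) (k : nat) : continuous (semic c k.+3).
Proof.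
move=> x; apply: differentiable_continuous; apply/derivable1_diffP.
exact: (@ex_derive _ _ _ _ _ _ _ (is_derive_semic c x k)).
Qed.

Lemma semic_eq0 (c x : R) (k : nat) : c <= x ^+ 2 -> semic c k.+1 x = 0.
Proof. by move=> cx; rewrite /semic ler0_sqrtr ?subr_le0 // expr0n. Qed.

(** After scaling by r >= 1, the cells summed over reach at most (r + 3/2) / r < 5. Constancy
    outside [-1, 1] makes the boundary values of the primitive exact. *)
Lemma semic_primitive (k : nat) : exists (H : R -> R), 
  [/\ forall x : R, -5 < x < 5 -> is_derive x 1 H (semic 1 k.+3 x),
      forall x : R, 1 <= x < 5 -> H x = H 1 & forall x : R, -5 < x <= -1 -> H x = H (-1)].
Proof.
have [H hH] := @exists_primitive (semic 1 k.+3) 5 (ltr0Sn _ _) (@continuous_semic 1 k).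
exists H; split => // x /andP[x1 x5].
  have hx : 1 <= x <= x by rewrite x1 lexx.
  have h1 : 1 <= (1 : R) <= x by rewrite x1 lexx.
  have dz (z : R) : 1 <= z <= x -> is_derive z 1 H (semic 1 k.+3 z).
    by move=> /andP[z1 zx]; apply: hH; apply/andP; split; qlra.
  have bz (z : R) : 1 <= z <= x -> `|semic 1 k.+3 z| <= 0.
    move=> /andP[z1 zx]; rewrite semic_eq0 ?normr0 //.
    by rewrite -[leLHS](expr1n _ 2) ler_pXn2r ?nnegrE //; qlra.
  have := @mvt_bound R H _ 1 x 0 dz bz x 1 hx h1.
  by rewrite mul0r normr_le0 subr_eq0 => /eqP.
have hx : x <= x <= -1 by rewrite x5 lexx.
have h1 : x <= (-1 : R) <= -1 by rewrite x5 lexx.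
have dz (z : R) : x <= z <= -1 -> is_derive z 1 H (semic 1 k.+3 z).
  by move=> /andP[z1 zx]; apply: hH; apply/andP; split; qlra.
have bz (z : R) : x <= z <= -1 -> `|semic 1 k.+3 z| <= 0.
  move=> /andP[z1 zx]; rewrite semic_eq0 ?normr0 //.
  by rewrite -sqrrN -[leLHS](expr1n _ 2) ler_pXn2r ?nnegrE //; qlra.
have := @mvt_bound R H _ x (-1) 0 dz bz x (-1) hx h1.
by rewrite mul0r normr_le0 subr_eq0 => /eqP.
Qed.

Section Oscillation.
Variables (r x y : R).
Hypotheses (r1 : 1 <= r) (xy : `|x - y| <= 1).
Let a := Num.sqrt (r ^+ 2 - x ^+ 2).
Let b := Num.sqrt (r ^+ 2 - y ^+ 2).

Lemma sqrt_semi_le (z : R) : Num.sqrt (r ^+ 2 - z ^+ 2) <= r.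
Proof.
rewrite -[leRHS]ger0_norm; last by move: r1; qlra.
by rewrite -sqrtr_sqr ler_wsqrtr // gerBl sqr_ge0.
Qed.

Lemma sqr_sqrt_max (t : R) : Num.sqrt t ^+ 2 = Num.max t 0.
Proof.
have [t0|t0] := leP t 0; first by rewrite ler0_sqrtr // expr0n.
by rewrite sqr_sqrtr // ltW.
Qed.

Lemma sqr_semi_diff : `|a ^+ 2 - b ^+ 2| <= 3 * r.
Proof.
rewrite /a /b !sqr_sqrt_max.
have xy' := xy; have r1' := r1; move: xy'; rewrite ler_norml => /andP[d1 d2].
have key u v : v - 1 <= u -> u <= v + 1 -> r ^+ 2 - u ^+ 2 <= 3 * r + Num.max (r ^+ 2 - v ^+ 2) 0.
  move=> h1 h2; have [rv|rv] := leP (r ^+ 2 - v ^+ 2) 0.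
    have [vr|vr] := leP 0 v.
      have : r <= v by rewrite -(@ler_pXn2r _ 2) ?nnegrE //; qlra.
      rewrite !expr2; nra.
    have : r <= - v by rewrite -(@ler_pXn2r _ 2) ?nnegrE ?sqrrN //; qlra.
    rewrite !expr2; nra.
  have : v <= r by rewrite leNgt; apply/negP => h; move: rv; rewrite !expr2; nra.
  have : - r <= v by rewrite leNgt; apply/negP => h; move: rv; rewrite !expr2; nra.
  rewrite !expr2; nra.
have k1 := key x y ltac:(qlra) ltac:(qlra).
have k2 := key y x ltac:(qlra) ltac:(qlra).
have mxP (u : R) : (Num.max u 0 = u \/ Num.max u 0 = 0) /\ 0 <= Num.max u 0.
  by rewrite le_max lexx orbT; split => //; rewrite /Num.max; case: ifP; [right|left].
have [[e1|e1] p1] := mxP (r ^+ 2 - x ^+ 2); have [[e2|e2] p2] := mxP (r ^+ 2 - y ^+ 2);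
  by rewrite ler_norml; apply/andP; split; qlra.
Qed.

Let a0 : 0 <= a. Proof. exact: sqrtr_ge0. Qed.
Let b0 : 0 <= b. Proof. exact: sqrtr_ge0. Qed.
Let ar : a <= r. Proof. exact: sqrt_semi_le. Qed.
Let br : b <= r. Proof. exact: sqrt_semi_le. Qed.

Lemma semi_pow_diff2 (j : nat) : `|a ^+ j.+2 - b ^+ j.+2| <= j.+1%:R * (3 * r) * r ^+ j.
Proof.
have r0 : 0 <= r by move: r1; qlra.
elim: j => [|j IH]; first by rewrite mul1r expr0 mulr1 sqr_semi_diff.
rewrite (_ : _ - _ = a * (a ^+ j.+2 - b ^+ j.+2) + b ^+ j.+1 * (b * (a - b))); last by rewrite !exprS; ring.
apply: (le_trans (ler_normD _ _)).
rewrite (_ : j.+2%:R * (3 * r) * r ^+ j.+1 =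
  j.+1%:R * (3 * r) * r ^+ j.+1 + 3 * r * r ^+ j.+1); last by rewrite -[j.+2%:R]natr1; ring.
apply: lerD.
  rewrite normrM (ger0_norm a0).
  rewrite (_ : _ * r ^+ j.+1 = r * (j.+1%:R * (3 * r) * r ^+ j)); last by rewrite exprS; ring.
  by apply: ler_pM.
rewrite normrM ger0_norm ?exprn_ge0 // mulrC.
apply: ler_pM; rewrite ?exprn_ge0 ?normr_ge0 //; last by rewrite ler_pXn2r ?nnegrE.
apply: le_trans sqr_semi_diff; rewrite subr_sqr mulrC !normrM.
by rewrite (ger0_norm b0) (ger0_norm (addr_ge0 a0 b0)) ler_wpM2l // lerDr.
Qed.

(** Rests on |a - b|^2 <= |a^2 - b^2|. Compared with [semi_pow_diff2] it loses half a power of r,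
    the price of the vertical tangents at the ends of the semicircle. *)
Lemma semi_pow_diff1 (j : nat) :
  `|a ^+ j.+1 - b ^+ j.+1| <= j.+1%:R * r ^+ j * (2 * Num.sqrt r).
Proof.
have r0 : 0 <= r by move: r1; qlra.
have ab : `|a - b| <= 2 * Num.sqrt r.
  rewrite -(@ler_pXn2r _ 2) ?nnegrE ?mulr_ge0 ?sqrtr_ge0 // exprMn sqr_sqrtr //.
  apply: (@le_trans _ _ (3 * r)); last by rewrite ler_wpM2r // -natrX ler_nat.
  apply: le_trans sqr_semi_diff; rewrite subr_sqr normrM expr2 ler_wpM2l //.
  rewrite (ger0_norm (addr_ge0 a0 b0)) ler_norml; apply/andP; split; move: a0 b0; qlra.
elim: j => [|j IH]; first by rewrite !expr1 expr0 !mul1r.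
rewrite (_ : _ - _ = a * (a ^+ j.+1 - b ^+ j.+1) + b ^+ j.+1 * (a - b)); last by rewrite !exprS; ring.
apply: (le_trans (ler_normD _ _)).
rewrite (_ : j.+2%:R * r ^+ j.+1 * (2 * Num.sqrt r) = j.+1%:R * r ^+ j.+1 * (2 * Num.sqrt r)
   + r ^+ j.+1 * (2 * Num.sqrt r)); last by rewrite -[j.+2%:R]natr1; ring.
apply: lerD.
  rewrite normrM (ger0_norm a0).
  rewrite (_ : _ * r ^+ j.+1 * _ = r * (j.+1%:R * r ^+ j * (2 * Num.sqrt r))); last by rewrite exprS; ring.
  by apply: ler_pM.
rewrite normrM ger0_norm ?exprn_ge0 //.
by apply: ler_pM; rewrite ?exprn_ge0 ?normr_ge0 // ler_pXn2r ?nnegrE.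
Qed.

End Oscillation.

Lemma zrange_shrink (F : int -> R) (K N : nat) :
  (forall z, (`|z|%R > K%:Z) || (`|z|%R > N%:Z) -> F z = 0) ->
  \sum_(z <- zrange K) F z = \sum_(z <- zrange N) F z.
Proof.
move=> F0.
rewrite (bigID (fun z : int => `|z|%R <= N%:Z)) /= [X in _ + X]big1 ?addr0; last first.
  by move=> z; rewrite -ltNge => h; apply: F0; rewrite h orbT.
rewrite [RHS](bigID (fun z : int => `|z|%R <= K%:Z)) /= [X in _ = _ + X]big1 ?addr0; last first.
  by move=> z; rewrite -ltNge => h; apply: F0; rewrite h.
apply: (@big_bij _ _ _ (zrange K) (zrange N) _ _ id id F); rewrite ?zrange_uniq //.
  by move=> z; rewrite !mem_zrange => -> ->.
by move=> z; rewrite !mem_zrange => -> ->.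
Qed.

Lemma size_zrange N : size (zrange N) = (2 * N).+1.
Proof. by rewrite size_map size_iota. Qed.

(* The primitive of sqrt(r^2 - x^2)^p is x |-> r^(p+1) H(x / r). *)
Lemma semic_sum_aux (k : nat) (H : R -> R) :
  (forall x : R, -5 < x < 5 -> is_derive x 1 H (semic 1 k.+3 x)) ->
  (forall x : R, 1 <= x < 5 -> H x = H 1) -> (forall x : R, -5 < x <= -1 -> H x = H (-1)) ->
  forall r : R, 1 <= r ->
  exists (G : R -> R) (N : nat), [/\ r < N%:R <= r + 1,
    forall n : int, n \in zrange N -> forall x : R, n%:~R - 1/2 <= x <= n%:~R + 1/2 ->
       is_derive x 1 G (semic (r ^+ 2) k.+3 x) &
    G (N%:R + 1/2) - G (- N%:R - 1/2) = (H 1 - H (-1)) * r ^+ k.+4].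
Proof.
move=> dH H1 H2 r r1; have r0 : 0 < r by qlra.
pose N := (Num.truncn r).+1.
have N1 : r < N%:R by exact: truncnS_gt.
have N2 : N%:R <= r + 1.
  have : (Num.truncn r)%:R <= r by rewrite truncn_le // ltW.
  by rewrite /N -natr1; qlra.
exists (fun x => r ^+ k.+4 * H (x / r)), N; split; first by rewrite N1 N2.
- move=> n nN x /andP[x1 x2].
  have hx : -5 < x / r < 5.
    move: nN; rewrite mem_zrange -(ler_int R) intr_norm -pmulrn ler_norml => /andP[n1 n2].
    by rewrite ltr_pdivlMr // ltr_pdivrMr //; apply/andP; split; qlra.
  have d1 : is_derive x 1 (fun x : R => x / r) (r^-1).
    by apply: is_derive_eq; rewrite scaler0 add0r /GRing.scale /= mulr1.
  have d2 := @is_derive1_comp R H (fun x : R => x / r) x _ _ (dH _ hx) d1.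
  have d3 : is_derive x 1 (fun x => r ^+ k.+4 * H (x / r)) (r ^+ k.+4 * (semic 1 k.+3 (x / r) / r)).
    apply: (is_derive_eq (is_deriveZ (r ^+ k.+4) d2)) => //.
  rewrite (_ : semic (r ^+ 2) k.+3 x = r ^+ k.+4 * (semic 1 k.+3 (x / r) / r)) //.
  rewrite /semic (_ : r ^+ 2 - x ^+ 2 = r ^+ 2 * (1 - (x / r) ^+ 2)); last by field; rewrite gt_eqF.
  rewrite sqrtrM ?sqr_ge0 // sqrtr_sqr ger0_norm ?(ltW r0) // exprMn (exprS r k.+3).
  by field; rewrite gt_eqF.
- rewrite (H1 ((N%:R + 1/2) / r)); last by rewrite ler_pdivlMr // ltr_pdivrMr //; apply/andP; split; qlra.
  rewrite (H2 ((- N%:R - 1/2) / r)); last by rewrite ltr_pdivlMr // ler_pdivrMr //; apply/andP; split; qlra.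
  by ring.
Qed.

Lemma sum_norm_zrange (F : int -> R) (N : nat) (M : R) :
  (forall z, z \in zrange N -> `|F z| <= M) ->
  `|\sum_(z <- zrange N) F z| <= (2 * N%:R + 1) * M.
Proof.
move=> FM; apply: (le_trans (ler_norm_sum _ _ _)).
apply: (@le_trans _ _ (\sum_(z <- zrange N) M)).
  by rewrite big_seq [leRHS]big_seq; apply: ler_sum.
by rewrite big_const_seq count_predT size_zrange iter_addr_0 -[M *+ _]mulr_natl -[(2 * N).+1%:R]natr1 natrM.
Qed.

(* Euler-Maclaurin to third order: the boundary singularity is mild for p >= 6. *)
Theorem semic_sum6 (k : nat) : exists b C : R, 0 <= C /\
  forall (c : R) (K : nat), 0 <= c -> Num.sqrt c <= K%:R ->
  `|\sum_(z <- zrange K) semic c k.+4.+2 z%:~R - b * Num.sqrt c ^+ k.+4.+3|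
    <= C * Num.sqrt (1 + c) ^+ k.+4.
Proof.
have [H [dH H1 H2]] := semic_primitive k.+3.
pose b := H 1 - H (-1); pose p : R := k.+4.+2%:R.
exists b, (1 + `|b| + 5 * (6 * p ^+ 3)).
have p6 : 6 <= p by rewrite /p ler_nat.
have p3 : 0 <= p ^+ 3 by rewrite exprn_ge0 //; qlra.
split; first by rewrite !addr_ge0 ?mulr_ge0.
move=> c K c0 cK.
have s1 : 1 <= Num.sqrt (1 + c) by rewrite -[leLHS]sqrtr1 ler_sqrt; qlra.
have s4 : 1 <= Num.sqrt (1 + c) ^+ k.+4 by apply: exprn_ege1.
pose r : R := Num.sqrt c; rewrite -/r in cK *.
have r2 : r ^+ 2 = c by rewrite sqr_sqrtr.
have rge0 : 0 <= r by exact: sqrtr_ge0.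
have rs : r <= Num.sqrt (1 + c) by rewrite ler_sqrt; qlra.
(* For r < 1 only z = 0 contributes a bounded amount, which the error term absorbs since it is
   stated with sqrt (1 + c) >= 1. *)
have [r1|r1] := ltP r 1.
  rewrite (bigD1_seq 0) ?zrange_uniq ?mem_zrange //= [X in _ + X - _]big1 ?addr0; last first.
    move=> z z0; apply: semic_eq0; rewrite -r2.
    apply: (@le_trans _ _ 1); first by rewrite exprn_ile1 // ltW.
    by rewrite -rmorphXn /= -[1]/(1%:~R) ler_int; move: z0; clear; nia.
  rewrite /semic expr0n subr0 -/r.
  have h1 : `|r ^+ k.+4.+2| <= 1 by rewrite ger0_norm ?exprn_ge0 // exprn_ile1 // ltW.
  have h2 : `|b * r ^+ k.+4.+3| <= `|b|.
    by rewrite normrM ler_piMr // ger0_norm ?exprn_ge0 // exprn_ile1 // ltW.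
  apply: (le_trans (ler_normB _ _)).
  apply: (@le_trans _ _ ((1 + `|b| + 5 * (6 * p ^+ 3)) * 1)); first by qlra.
  by rewrite ler_wpM2l // !addr_ge0 // !mulr_ge0.
have r0 : 0 < r by qlra.
have [G [N [/andP[N1 N2] dG GE]]] := semic_sum_aux dH H1 H2 r1.
rewrite (@zrange_shrink _ K N); last first.
  move=> z hz; apply: semic_eq0; rewrite -r2.
  have : r <= `|z%:~R|.
    case/orP: hz; rewrite -(ltr_int R) intr_norm -pmulrn => hz.
      by apply: (le_trans cK); exact: ltW.
    by apply: ltW; apply: lt_trans hz.
  by move=> h; rewrite -(@ler_pXn2r _ 2) ?nnegrE // in h; rewrite -[leRHS]real_normK ?num_real.
pose f1 (x : R) : R := - k.+4.+2%:R * x * semic (r ^+ 2) k.+4 x.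
pose f2 (x : R) : R := p * (p - 2) * x ^+ 2 * semic (r ^+ 2) k.+2 x - p * semic (r ^+ 2) k.+4 x.
have d1 (x : R) : is_derive x 1 f1 (f2 x).
  have e1 := is_derive_semic (r ^+ 2) x k.+1.
  have e2 : is_derive x 1 (fun x : R => - k.+4.+2%:R * x) (- k.+4.+2%:R).
    by apply: is_derive_eq; rewrite /GRing.scale /= mulr1.
  apply: (is_derive_eq (is_deriveM e2 e1)); rewrite /GRing.scale /= /f2.
  have -> : k.+4%:R = p - 2 :> R by rewrite /p -[k.+4.+2%:R]natr1 -[k.+4.+1%:R]natr1; ring.
  by rewrite -/p; ring.
(* Writing x^2 as r^2 - (r^2 - x^2) leaves only constants times powers of the ordinate, whose
   oscillation is known. *)
have f2E (x : R) : f2 x = p * (p - 2) * r ^+ 2 * semic (r ^+ 2) k.+2 x - p * (p - 1) * semic (r ^+ 2) k.+4 x.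
  rewrite /f2 /semic (exprS _ k.+3) (exprS _ k.+2) [_ * (_ * _)]mulrA -expr2 sqr_sqrt_max.
  have [h|h] := leP (r ^+ 2 - x ^+ 2) 0; first by rewrite ler0_sqrtr // !expr0n !(mulr0,mul0r) subrr.
  ring.
pose M : R := 6 * p ^+ 3 * r ^+ k.+3.
have osc (x y : R) : `|x - y| <= 1 -> `|f2 x - f2 y| <= M.
  move=> xy; rewrite !f2E.
  have h1 := semi_pow_diff2 r1 xy k; have h2 := semi_pow_diff2 r1 xy k.+2.
  set a1 := Num.sqrt _ in h1 h2; set b1 := Num.sqrt (_ - y ^+ 2) in h1 h2.
  rewrite (_ : _ - _ - _ = p * (p - 2) * r ^+ 2 * (a1 ^+ k.+2 - b1 ^+ k.+2) -
     p * (p - 1) * (a1 ^+ k.+4 - b1 ^+ k.+4)); last by rewrite /semic; ring.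
  apply: (le_trans (ler_normB _ _)); rewrite !normrM.
  rewrite (ger0_norm (_ : 0 <= p)); last by qlra.
  rewrite (ger0_norm (_ : 0 <= p - 2)); last by qlra.
  rewrite (ger0_norm (_ : 0 <= p - 1)); last by qlra.
  rewrite (ger0_norm rge0) -(expr2 r).
  have k1 : k.+1%:R <= p :> R by rewrite ler_nat; nlia.
  have k3 : k.+3%:R <= p :> R by rewrite ler_nat; nlia.
  have rk : 0 <= r ^+ k.+3 by rewrite exprn_ge0.
  have t1 : p * (p - 2) * r ^+ 2 * `|a1 ^+ k.+2 - b1 ^+ k.+2| <= p * p * p * 3 * r ^+ k.+3.
    apply: (@le_trans _ _ (p * (p - 2) * r ^+ 2 * (k.+1%:R * (3 * r) * r ^+ k))).
      by rewrite ler_wpM2l // !mulr_ge0 ?sqr_ge0 //; qlra.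
    rewrite (_ : _ * (_ * r ^+ k) = p * (p - 2) * k.+1%:R * 3 * r ^+ k.+3); last by rewrite !exprS; ring.
    rewrite ler_wpM2r // ler_wpM2r //; apply: ler_pM => //; first by rewrite mulr_ge0 //; qlra.
    by rewrite ler_wpM2l //; qlra.
  have t2 : p * (p - 1) * `|a1 ^+ k.+4 - b1 ^+ k.+4| <= p * p * p * 3 * r ^+ k.+3.
    apply: (@le_trans _ _ (p * (p - 1) * (k.+3%:R * (3 * r) * r ^+ k.+2))).
      by rewrite ler_wpM2l // !mulr_ge0 //; qlra.
    rewrite (_ : _ * (_ * r ^+ k.+2) = p * (p - 1) * k.+3%:R * 3 * r ^+ k.+3); last by rewrite (exprS r k.+2); ring.
    rewrite ler_wpM2r // ler_wpM2r //; apply: ler_pM => //; first by rewrite mulr_ge0 //; qlra.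
    by rewrite ler_wpM2l //; qlra.
  by apply: (le_trans (lerD t1 t2)); rewrite /M -mulrDl !exprS expr0; qlra.
have M0 : 0 <= M by apply: mulr_ge0; [apply: mulr_ge0|apply: exprn_ge0].
(* Since N > r, the telescoped correction vanishes at both ends. *)
have f1N : f1 (N%:R + 1/2) = 0 /\ f1 (- N%:R - 1/2) = 0.
  have h : r ^+ 2 <= (N%:R + 1/2) ^+ 2 by rewrite ler_pXn2r ?nnegrE //; qlra.
  by split; rewrite /f1 semic_eq0 ?mulr0 // (_ : - N%:R - 1/2 = - (N%:R + 1/2)) ?sqrrN //; ring.
have := @sum_norm_zrange (fun n => G (n%:~R + 1/2) - G (n%:~R - 1/2) - semic (r ^+ 2) k.+4.+2 n%:~R
   - (f1 (n%:~R + 1/2) - f1 (n%:~R - 1/2)) / 24) N M.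
rewrite sumrB sumrB -mulr_suml (telescope_zrange G) (telescope_zrange f1) GE.
have [-> ->] := f1N; rewrite subrr mul0r subr0 -/b distrC -r2.
move=> h; apply: (le_trans (h _)).
  move=> n nN; apply: (@midpoint3_bound G (semic (r ^+ 2) k.+4.+2) f1 f2).
  - exact: dG.
  - by move=> x _; exact: is_derive_semic.
  - move=> x y /andP[x1 x2] /andP[y1 y2]; apply: osc.
    by rewrite ler_norml; apply/andP; split; move: x1 x2 y1 y2; clear; qlra.
apply: (@le_trans _ _ ((5 * r) * M)).
  by rewrite ler_wpM2r //; qlra.
rewrite (_ : 5 * r * M = 5 * (6 * p ^+ 3) * r ^+ k.+4); last by rewrite /M (exprS r k.+3); ring.
have q0 : 0 <= 5 * (6 * p ^+ 3) by apply: mulr_ge0 => //; apply: mulr_ge0.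
apply: ler_pM => //; first exact: exprn_ge0.
  by rewrite lerDr addr_ge0.
by rewrite r2 ler_pXn2r ?nnegrE // (le_trans rge0).
Qed.

(** Only the midpoint rule is used here: for exponent 3 the second derivative is unbounded at the
    ends of the semicircle. The error is r^(-3/2) times the size of the main term, enough for the
    sum over w, where r = X. *)
Theorem semic_sum3 (k : nat) : exists b C : R, 0 <= C /\
  forall (r : R) (K : nat), 1 <= r -> r <= K%:R ->
  `|\sum_(z <- zrange K) semic (r ^+ 2) k.+3 z%:~R - b * r ^+ k.+4|
    <= C * (r ^+ k.+2 * Num.sqrt r).
Proof.
have [H [dH H1 H2]] := semic_primitive k.
pose b := H 1 - H (-1); pose p : R := k.+3%:R.
exists b, (5 * p * (1 + 6 * p)).
have p3 : 3 <= p by rewrite /p ler_nat.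
split; first by rewrite !mulr_ge0 //; qlra.
move=> r K r1 rK; have r0 : 0 < r by qlra.
have [G [N [/andP[N1 N2] dG GE]]] := semic_sum_aux dH H1 H2 r1.
rewrite (@zrange_shrink _ K N); last first.
  move=> z hz; apply: semic_eq0.
  have : r <= `|z%:~R|.
    case/orP: hz; rewrite -(ltr_int R) intr_norm -pmulrn => hz.
      by apply: (le_trans rK); exact: ltW.
    by apply: ltW; apply: lt_trans hz.
  by move=> h; rewrite -(@ler_pXn2r _ 2) ?nnegrE // ?(ltW r0) // in h; rewrite -[leRHS]real_normK ?num_real.
pose f1 (x : R) : R := - k.+3%:R * x * semic (r ^+ 2) k.+1 x.
have sr1 : 1 <= Num.sqrt r by rewrite -[leLHS]sqrtr1 ler_sqrt //; qlra.
have rk : 0 <= r ^+ k.+1 by rewrite exprn_ge0 // ltW.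
pose M : R := p * (1 + 6 * p) * (r ^+ k.+1 * Num.sqrt r).
have osc (x y : R) : `|x - y| <= 1 -> `|y| <= 3 * r -> `|f1 x - f1 y| <= M.
  move=> xy y3; have h1 := semi_pow_diff1 r1 xy k; have h2 := sqrt_semi_le r1 x.
  rewrite /f1 /semic; set a1 := Num.sqrt (_ - x ^+ 2) in h1 h2 *; set b1 := Num.sqrt (_ - y ^+ 2) in h1 *.
  rewrite -/p (_ : _ - _ = - p * ((x - y) * a1 ^+ k.+1 + y * (a1 ^+ k.+1 - b1 ^+ k.+1))); last by ring.
  rewrite normrM normrN (ger0_norm (_ : 0 <= p)) /M -?mulrA; last by qlra.
  rewrite ler_wpM2l; [|qlra|].
    exact: erefl.
  apply: (le_trans (ler_normD _ _)); rewrite !normrM.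
  have a0 : 0 <= a1 by exact: sqrtr_ge0.
  have t1 : `|x - y| * `|a1 ^+ k.+1| <= r ^+ k.+1 * Num.sqrt r.
    apply: (@le_trans _ _ (1 * r ^+ k.+1)); last by rewrite mul1r ler_peMr.
    apply: ler_pM => //; rewrite ger0_norm ?exprn_ge0 // ler_pXn2r ?nnegrE //; qlra.
  have t2 : `|y| * `|a1 ^+ k.+1 - b1 ^+ k.+1| <= 6 * p * (r ^+ k.+1 * Num.sqrt r).
    apply: (@le_trans _ _ (3 * r * (k.+1%:R * r ^+ k * (2 * Num.sqrt r)))).
      by apply: ler_pM.
    rewrite (_ : _ * _ = 6 * k.+1%:R * (r ^+ k.+1 * Num.sqrt r)); last by rewrite exprS; ring.
    rewrite ler_wpM2r ?mulr_ge0 //.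
    by rewrite ler_wpM2l // ler_nat; nlia.
  by apply: (le_trans (lerD t1 t2)); rewrite -[X in X + _]mul1r -mulrDl.
have M0 : 0 <= M by rewrite /M !mulr_ge0 //; qlra.
have := @sum_norm_zrange (fun n => G (n%:~R + 1/2) - G (n%:~R - 1/2) - semic (r ^+ 2) k.+3 n%:~R) N M.
rewrite sumrB (telescope_zrange G) GE -/b distrC.
move=> h; apply: (le_trans (h _)).
  move=> n nN; apply: (@midpoint_bound G (semic (r ^+ 2) k.+3) f1).
  - exact: dG.
  - by move=> x _; exact: is_derive_semic.
  - move=> x y /andP[x1 x2] /andP[y1 y2]; apply: osc.
      by rewrite ler_norml; apply/andP; split; qlra.
    move: nN; rewrite mem_zrange -(ler_int R) intr_norm -pmulrn ler_norml => /andP[n1 n2].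
    by rewrite ler_norml; apply/andP; split; qlra.
apply: (@le_trans _ _ ((5 * r) * M)).
  by rewrite ler_wpM2r //; qlra.
by rewrite le_eqVlt; apply/orP; left; apply/eqP; rewrite /M (exprS r k.+1); ring.
Qed.

End EulerMaclaurin.

Ltac nonneg := lazymatch goal with
  | |- is_true (0 <= _ ^+ _) => apply: exprn_ge0; nonneg
  | |- is_true (0 <= _ * _) => apply: mulr_ge0; nonneg
  | |- is_true (0 <= _ + _) => apply: addr_ge0; nonneg
  | |- is_true (0 <= _^-1) => rewrite invr_ge0; nonneg
  | |- _ => first [done | qlra]
  end.

(** * Adding the remaining coordinates and summing over the arc *)

Section LatticeSum.
Variable R : realType.
Implicit Types (g f : R -> R) (K d : nat).

Lemma theta_lt0 K g (t : R) : (forall s, s < 0 -> g s = 0) -> t < 0 -> theta K g t = 0.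
Proof.
move=> g0 t0; apply: big1 => z _; apply: g0.
by have := sqr_ge0 (z%:~R : R); qlra.
Qed.

Lemma iter_theta_lt0 K d g : (forall s, s < 0 -> g s = 0) ->
  forall t : R, t < 0 -> iter d (theta K) g t = 0.
Proof. by move=> g0; elim: d => [|d IH] //= t t0; apply: theta_lt0. Qed.

Lemma theta_lin K (a : R) f g (t : R) :
  theta K (fun s => a * f s + g s) t = a * theta K f t + theta K g t.
Proof. by rewrite /theta big_split /= mulr_sumr. Qed.

Lemma eq_theta K f g (t : R) : (forall s, s <= t -> f s = g s) -> theta K f t = theta K g t.
Proof. by move=> fg; apply: eq_bigr => z _; apply: fg; rewrite gerBl sqr_ge0. Qed.

Lemma iter_theta_lin K d (a : R) f g (t : R) :
  iter d (theta K) (fun s => a * f s + g s) t =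
  a * iter d (theta K) f t + iter d (theta K) g t.
Proof.
elim: d t => [|d IH] t //=.
by rewrite (@eq_theta _ _ _ t (fun s _ => IH s)) theta_lin.
Qed.

Lemma le_sum_zrange (F : int -> R) K (r M : R) : 0 <= r -> 0 <= M ->
  (forall z, z%:~R ^+ 2 <= r ^+ 2 -> `|F z| <= M) ->
  (forall z, r ^+ 2 < z%:~R ^+ 2 -> F z = 0) ->
  `|\sum_(z <- zrange K) F z| <= (2 * r + 1) * M.
Proof.
move=> r0 M0 FM F0; set N := Num.truncn r.
have N1 : N%:R <= r by rewrite truncn_le.
have rN : r < N.+1%:R by exact: truncnS_gt.
pose G z : R := if `|z|%R <= K%:Z then F z else 0.
have -> : \sum_(z <- zrange K) F z = \sum_(z <- zrange K) G z.
  by rewrite big_seq [RHS]big_seq; apply: eq_bigr => z; rewrite mem_zrange /G => ->.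
rewrite (@zrange_shrink _ G K N); last first.
  move=> z /orP[h|h]; rewrite /G; first by rewrite leNgt h.
  case: ifP => // _; apply: F0; rewrite -[ltRHS]real_normK ?num_real // ltr_pXn2r ?nnegrE //.
  by apply: (lt_le_trans rN); rewrite -intr_norm pmulrn ler_int; move: h; clear; lia.
apply: (@le_trans _ _ ((2 * N%:R + 1) * M)); last by apply: ler_wpM2r => //; qlra.
apply: sum_norm_zrange => z zN; rewrite /G; case: ifP => _; last by rewrite normr0.
apply: FM; rewrite -[leLHS]real_normK ?num_real // ler_pXn2r ?nnegrE //.
by apply: le_trans N1; rewrite -intr_norm pmulrn ler_int -mem_zrange.
Qed.

Lemma theta_bound K g (t M : R) : 0 <= t -> 0 <= M -> (forall s, s < 0 -> g s = 0) ->
  (forall s, 0 <= s <= t -> `|g s| <= M) -> `|theta K g t| <= (2 * Num.sqrt t + 1) * M.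
Proof.
move=> t0 M0 g0 gM; apply: le_sum_zrange => //; rewrite ?sqrtr_ge0 // => z; rewrite sqr_sqrtr // => h.
  by apply: gM; rewrite subr_ge0 h gerBl sqr_ge0.
by apply: g0; rewrite subr_lt0.
Qed.

Lemma iter_theta_bound K d g (r M : R) : 0 <= r -> 0 <= M -> (forall s, s < 0 -> g s = 0) ->
  (forall s, 0 <= s <= r ^+ 2 -> `|g s| <= M) ->
  forall t, 0 <= t <= r ^+ 2 -> `|iter d (theta K) g t| <= (2 * r + 1) ^+ d * M.
Proof.
move=> r0 M0 g0 gM; elim: d => [|d IH] t /andP[t0 tr] /=.
  by rewrite mul1r; apply: gM; rewrite t0 tr.
have B0 : 0 <= (2 * r + 1) ^+ d * M by rewrite mulr_ge0 // exprn_ge0 //; qlra.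
apply: (le_trans (@theta_bound K _ t _ t0 B0 _ _)).
- by move=> s; apply: iter_theta_lt0.
- by move=> s /andP[s0 st]; apply: IH; rewrite s0 (le_trans st).
- rewrite exprS -mulrA ler_wpM2r //.
  have : Num.sqrt t <= r by rewrite -[leRHS]ger0_norm // -sqrtr_sqr ler_wsqrtr.
  by qlra.
Qed.

(** By [semic_sum6] each [theta] raises the exponent of the main term by one, while it multiplies
    the previous error by at most 2 sqrt t + 1. The error therefore stays three powers of sqrt (1 +
    t) below the main term. *)
Lemma theta_main (j : nat) : exists b C : R, 0 <= C /\
  forall (K : nat) (t : R), 0 <= t -> Num.sqrt t <= K%:R ->
  `|iter j (theta K) (fun s => Num.sqrt s ^+ 6) t - b * Num.sqrt t ^+ j.+4.+2|
    <= C * Num.sqrt (1 + t) ^+ j.+3.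
Proof.
elim: j => [|j [b [C [C0 IH]]]].
  by exists 1, 0; split => // K t t0 tK; rewrite mul1r subrr normr0 mul0r.
have [b' [C' [C'0 h]]] := semic_sum6 R j.
exists (b * b'), (`|b| * C' + 3 * C).
split=> [|K t t0 tK]; first by rewrite addr_ge0 ?mulr_ge0.
rewrite iterS; set g := iter j _ _.
have g0 s : s < 0 -> g s = 0.
  by apply: iter_theta_lt0 => u u0; rewrite ltr0_sqrtr // expr0n.
pose e s := g s - b * Num.sqrt s ^+ j.+4.+2.
have e0 s : s < 0 -> e s = 0.
  by move=> s0; rewrite /e g0 // ltr0_sqrtr // expr0n mulr0 subrr.
have -> : theta K g t = b * (\sum_(z <- zrange K) semic t j.+4.+2 z%:~R) + theta K e t.
  rewrite -(@theta_lin K b (fun s => Num.sqrt s ^+ j.+4.+2) e); apply: eq_theta => s _.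
  by rewrite /e addrC subrK.
have h1 := h t K t0 tK.
set S := \sum_(z <- _) _ in h1 *.
have r1 : 1 <= Num.sqrt (1 + t) by rewrite -[leLHS]sqrtr1 ler_sqrt; qlra.
have rt : Num.sqrt t <= Num.sqrt (1 + t) by rewrite ler_sqrt; qlra.
have Q0 : 0 <= C * Num.sqrt (1 + t) ^+ j.+3 by rewrite mulr_ge0 // exprn_ge0 //; qlra.
have h2 : `|theta K e t| <= (2 * Num.sqrt t + 1) * (C * Num.sqrt (1 + t) ^+ j.+3).
  apply: theta_bound => // s /andP[s0 st].
  apply: (le_trans (IH K s s0 _)).
    by apply: le_trans tK; rewrite ler_wsqrtr.
  by rewrite ler_wpM2l // ler_pXn2r ?nnegrE ?sqrtr_ge0 // ler_wsqrtr // lerD2l.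
rewrite (_ : _ - _ = b * (S - b' * Num.sqrt t ^+ j.+4.+3) + theta K e t); last by ring.
apply: (le_trans (ler_normD _ _)); rewrite [leRHS]mulrDl; apply: lerD.
  by rewrite normrM -mulrA ler_wpM2l.
apply: (le_trans h2); rewrite (_ : 3 * C * _ = 3 * Num.sqrt (1 + t) * (C * Num.sqrt (1 + t) ^+ j.+3)).
  by rewrite ler_wpM2r //; qlra.
by rewrite (exprS _ j.+3); ring.
Qed.

Lemma abel_sum_le (u v : nat -> R) (M : R) (n : nat) :
  (forall k, 0 <= u k) -> (forall k, u k.+1 <= u k) -> 
  (forall m, (m <= n)%N -> `|\sum_(0 <= k < m) v k| <= M) ->
  `|\sum_(0 <= k < n) u k * v k| <= u 0 * M.
Proof.
move=> u0 ud.
have M0 : (forall m, (m <= n)%N -> `|\sum_(0 <= k < m) v k| <= M) -> 0 <= M.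
  by move=> h; apply: le_trans (h 0%N _).
move=> h; have {}M0 := M0 h.
have E m : \sum_(0 <= k < m) u k * v k =
  u m * \sum_(0 <= k < m) v k + \sum_(0 <= k < m) (u k - u k.+1) * \sum_(0 <= i < k.+1) v i.
  elim: m => [|m IH]; first by rewrite !big_nil mulr0 addr0.
  by rewrite big_nat_recr //= IH [in RHS]big_nat_recr //= [X in _ = _ + X]big_nat_recr //= big_nat_recr //=; ring.
rewrite E; apply: (le_trans (ler_normD _ _)).
have -> : u 0 * M = u n * M + \sum_(0 <= k < n) (u k - u k.+1) * M.
  rewrite -mulr_suml -mulrDl; congr (_ * _).
  have := @telescope_sumr R 0 n u (leq0n _).
  have -> : \sum_(0 <= k < n) (u k - u k.+1) = - \sum_(0 <= k < n) (u k.+1 - u k).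
    by rewrite -sumrN; apply: eq_bigr => i _; rewrite opprB.
  by move=> ->; ring.
apply: lerD; first by rewrite normrM ger0_norm // ler_wpM2l // h.
apply: (le_trans (ler_norm_sum _ _ _)); rewrite big_nat [leRHS]big_nat; apply: ler_sum => k /andP[_ kn].
by rewrite normrM ger0_norm ?subr_ge0 // ler_wpM2l ?subr_ge0 // h.
Qed.

Lemma sum_zrange_abs (F : nat -> R) (W : nat) :
  \sum_(z <- zrange W) F `|z|%N = 2 * \sum_(0 <= w < W.+1) F w - F 0.
Proof.
rewrite /zrange big_map (_ : iota 0 (2 * W).+1 = index_iota 0 (2 * W).+1); last by rewrite /index_iota subn0.
rewrite (@big_cat_nat _ _ _ W) //=; last by lia.
have -> : \sum_(0 <= i < W) F `|i%:Z - W%:Z|%N = \sum_(0 <= i < W) F i.+1.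
  rewrite big_nat_rev /= big_nat [RHS]big_nat; apply: eq_bigr => i /andP[_ iW]; congr F; lia.
have -> : \sum_(W <= i < (2 * W).+1) F `|i%:Z - W%:Z|%N = \sum_(0 <= i < W.+1) F i.
  rewrite -{1}[W]add0n big_addn (_ : ((2 * W).+1 - W = W.+1)%N); last by lia.
  by apply: eq_bigr => i _; congr F; lia.
by rewrite big_nat_recl //=; ring.
Qed.

(* Abel summation against the decreasing weight (s_w - a)_+^2 reduces this to the sums of psi
   along the arc. *)
Lemma osc6_sum : exists D : R, 0 <= D /\
  forall (y X a : R), 1 <= y -> X = y ^+ 3 -> 0 <= a ->
  `|\sum_(w <- zrange (Num.truncn X)) osc6 (Num.truncn y) (Num.sqrt (X ^+ 2 - w%:~R ^+ 2) - a)|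
    <= D * (X ^+ 2 * y ^+ 2).
Proof.
have [A [A0 hA]] : exists A : R, 0 <= A /\
   forall (X y beta g : R) (W : nat), 1 <= y -> X = y ^+ 3 ->
    1 <= beta <= 4 * y -> (forall w, (w < W)%N -> w%:R <= X) ->
    `|\sum_(0 <= w < W) psi (semi X w / beta + g)| <= A * y ^+ 2.
  exists (70 * 16 * 16 * 16 + 2); split; last exact: arc_psi_sum.
  by apply: addr_ge0 => //; do !apply: mulr_ge0.
exists (2 * (2 * (24 * A)) + 24); split; first by qlra.
move=> y X a y1 XE a0; set W := Num.truncn X; set B := Num.truncn y.
have X1 : 1 <= X by rewrite XE exprn_ege1.
have WX : W%:R <= X by rewrite truncn_le; qlra.
have By : B%:R <= y by rewrite truncn_le; qlra.
have y2 : 1 <= y ^+ 2 by exact: exprn_ege1.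
pose u (w : nat) : R := if 0 <= semi X w - a then (semi X w - a) ^+ 2 else 0.
have u0 w : 0 <= u w by rewrite /u; case: ifP => // _; exact: sqr_ge0.
have ud w : u w.+1 <= u w.
  rewrite /u; have h := semi_mono X w; case: ifP => h1; last by case: ifP => // _; exact: sqr_ge0.
  by rewrite ifT; [rewrite ler_pXn2r ?nnegrE //|]; qlra.
have uX : u 0%N <= X ^+ 2.
  rewrite /u; case: ifP => h; last exact: sqr_ge0.
  have X0 : 0 <= X by qlra.
  rewrite ler_pXn2r ?nnegrE //.
  have -> : semi X 0 = X by rewrite /semi expr0n subr0 sqrtr_sqr ger0_norm.
  by qlra.
pose F (w : nat) : R := osc6 B (semi X w - a).
have FE w : F w = - \sum_(1 <= b < B.+1) (u w * coef6 (semi X w - a) b) / b%:R ^+ 2.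
  rewrite /F /osc6 /u; case: ifP => h.
    by rewrite mulNr mulr_sumr; congr (- _); apply: eq_bigr => b _; rewrite mulrA.
  by rewrite big1 ?oppr0 // => b _; rewrite !mul0r.
rewrite (_ : \sum_(w <- _) _ = \sum_(w <- zrange W) F `|w|%N); last first.
  apply: eq_bigr => w _; rewrite /F /semi; congr (osc6 _ (Num.sqrt (_ - _) - _)).
  by rewrite -[LHS]real_normK ?num_real // -intr_norm pmulrn abszE.
rewrite sum_zrange_abs.
have h0 : `|F 0%N| <= 24 * X ^+ 2.
  rewrite /F /osc6; case: ifP => h; last by rewrite normr0 mulr_ge0 // sqr_ge0.
  rewrite normrM normrN mulrC ler_pM ?norm_osc_sum // ger0_norm ?sqr_ge0 //.
  by move: uX; rewrite /u h.
have hb b : (1 <= b < B.+1)%N ->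
    `|\sum_(0 <= w < W.+1) u w * coef6 (semi X w - a) b| <= X ^+ 2 * (24 * A * y ^+ 2).
  move=> /andP[b1 bB].
  have bR : 1 <= b%:R :> R by rewrite ler1n.
  have bY : b%:R <= y by apply: le_trans By; rewrite ler_nat.
  apply: (@le_trans _ _ (u 0%N * (24 * A * y ^+ 2))); last first.
    by rewrite ler_wpM2r //; nonneg.
  apply: abel_sum_le => // m mW.
  have mX w : (w < m)%N -> w%:R <= X.
    by move=> wm; apply: le_trans WX; rewrite ler_nat; nlia.
  (* The function [omega] brings in sawtooths with denominator 4 b, hence the range beta <= 4 y in
     the arc bound. *)
  pose S (beta c : R) := \sum_(0 <= w < m) psi (semi X w / beta + c).
  have -> : \sum_(0 <= w < m) coef6 (semi X w - a) b =
     16 * (chi b%:Z)%:~R * S b%:R (- a / b%:R) -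
     4 * (S (4 * b%:R) ((3 - a / b%:R) / 4) - S (4 * b%:R) ((1 - a / b%:R) / 4)).
    rewrite /S -sumrB 2!mulr_sumr -sumrB; apply: eq_bigr => w _; rewrite /coef6 /omega.
    have bn : b%:R != 0 :> R by rewrite gt_eqF //; qlra.
    by congr (_ * psi _ - _ * (psi _ - psi _)); field.
  have b14 : 1 <= (b%:R : R) <= 4 * y by apply/andP; split; qlra.
  have b44 : 1 <= (4 * b%:R : R) <= 4 * y by apply/andP; split; qlra.
  have s1 := @hA X y b%:R (- a / b%:R) m y1 XE b14 mX.
  have s2 := @hA X y (4 * b%:R) ((3 - a / b%:R) / 4) m y1 XE b44 mX.
  have s3 := @hA X y (4 * b%:R) ((1 - a / b%:R) / 4) m y1 XE b44 mX.
  rewrite -/(S _ _) in s1; rewrite -/(S _ _) in s2; rewrite -/(S _ _) in s3.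
  apply: (le_trans (ler_normB _ _)).
  have s4 : `|16 * (chi b%:Z)%:~R * S b%:R (- a / b%:R)| <= 16 * (A * y ^+ 2).
    rewrite -mulrA normrM ger0_norm // ler_wpM2l // normrM -[leRHS]mul1r.
    by apply: ler_pM => //; exact: norm_chi.
  have s5 : `|4 * (S (4 * b%:R) ((3 - a / b%:R) / 4) - S (4 * b%:R) ((1 - a / b%:R) / 4))|
      <= 4 * (A * y ^+ 2 + A * y ^+ 2).
    rewrite normrM ger0_norm // ler_wpM2l //; apply: (le_trans (ler_normB _ _)).
    exact: lerD.
  by apply: (le_trans (lerD s4 s5)); qlra.
have hs : `|\sum_(0 <= w < W.+1) F w| <= 2 * (X ^+ 2 * (24 * A * y ^+ 2)).
  rewrite (eq_bigr _ (fun w _ => FE w)) sumrN normrN exchange_big /=.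
  apply: (le_trans (ler_norm_sum _ _ _)).
  apply: (@le_trans _ _ (\sum_(1 <= b < B.+1) X ^+ 2 * (24 * A * y ^+ 2) * (b%:R ^+ 2)^-1)).
    rewrite big_nat [leRHS]big_nat; apply: ler_sum => b bB.
    rewrite -mulr_suml normrM (ger0_norm (_ : 0 <= (b%:R ^+ 2)^-1)) ?invr_ge0 ?sqr_ge0 //.
    by rewrite ler_wpM2r ?invr_ge0 ?sqr_ge0 // hb.
  rewrite -mulr_sumr mulrC ler_wpM2r ?sum_inv_sqr2 //.
  by nonneg.
apply: (le_trans (ler_normB _ _)); rewrite normrM ger0_norm //.
rewrite [leRHS]mulrDl; apply: lerD.
  by apply: (@le_trans _ _ (2 * (2 * (X ^+ 2 * (24 * A * y ^+ 2))))); [rewrite ler_wpM2l|qlra].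
by apply: (le_trans h0); rewrite ler_wpM2l // ler_peMr ?sqr_ge0.
Qed.

(** The sum over s stays innermost. Each [theta] replaces the shift a by a + z^2, still nonnegative,
    so the hypothesis for all a reproduces itself; only the 2 r + 1 values |z| <= r matter. *)
Lemma theta_osc_sum K d (O : R -> R) (s : seq R) (r D : R) : 0 <= r -> 0 <= D ->
  (forall t, t < 0 -> O t = 0) -> (forall t, t \in s -> t <= r ^+ 2) ->
  (forall a, 0 <= a -> `|\sum_(t <- s) O (t - a)| <= D) ->
  forall a, 0 <= a -> `|\sum_(t <- s) iter d (theta K) O (t - a)| <= (2 * r + 1) ^+ d * D.
Proof.
move=> r0 D0 O0 sr h; elim: d => [|d IH] a a0 /=; first by rewrite mul1r h.
rewrite /theta exchange_big /= exprS -mulrA; apply: le_sum_zrange => //.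
- by rewrite mulr_ge0 // exprn_ge0 //; qlra.
- move=> z _; under eq_bigr do rewrite -addrA -opprD.
  by apply: IH; rewrite addr_ge0 ?sqr_ge0.
- move=> z rz; rewrite big_seq big1 // => t ts; apply: iter_theta_lt0 => //.
  by have := sr t ts; qlra.
Qed.

Theorem weighted_lattice_sum (q : nat) : (3 <= q)%N -> exists c C : R, 0 <= C /\
  forall (x y : R) (K : nat), 1 <= x -> 1 <= y -> x ^+ 2 = y ^+ 3 -> x ^+ 2 <= K%:R ->
  `|\sum_(w <- zrange (Num.truncn (x ^+ 2)))
      iter (2 * q) (theta K) (@step0 R) (Num.sqrt ((x ^+ 2) ^+ 2 - w%:~R ^+ 2))
    - c * x ^+ (2 * q + 2)| <= C * (x ^+ (2 * q) / y).
Proof.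
move=> q3; have [k ->] : exists k, q = k.+3 by exists (q - 3)%N; lia.
have [c0 [C0 [C00 hball]]] := ball6_approx R.
have [D [D0 hosc]] := osc6_sum.
have [b1 [C1 [C10 hmain]]] := theta_main (2 * k).
have [b2 [C2 [C20 hw]]] := semic_sum3 R k.
exists (c0 * b1 * b2).
exists (`|c0| * `|b1| * C2 + `|c0| * (3 * C1 * 2 ^+ (2 * k).+3) + 3 ^+ (2 * k) * D + 3 ^+ (2 * k) * C0 * 3).
split; first by nonneg.
move=> x y K x1 y1 xy xK.
have x0 : 0 < x by qlra.
have y0 : 0 < y by qlra.
pose X := x ^+ 2; rewrite -/X in xK *.
have X1 : 1 <= X by exact: exprn_ege1.
have X0 : 0 <= X by qlra.
have xX : x <= X by rewrite /X expr2 ler_peMr // ltW.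
set W := Num.truncn X.
have WX : W%:R <= X by rewrite truncn_le.
have XW : X < W.+1%:R by exact: truncnS_gt.
pose s (w : int) : R := Num.sqrt (X ^+ 2 - w%:~R ^+ 2).
have s0 w : 0 <= s w by exact: sqrtr_ge0.
have sX w : s w <= X by exact: sqrt_semi_le.
pose B := Num.truncn y.
pose e (t : R) := ball6 K t - c0 * Num.sqrt t ^+ 6 - osc6 B t.
have osc0 (t : R) : t < 0 -> osc6 B t = 0 by move=> t0; rewrite /osc6 leNgt t0.
have e0 (t : R) : t < 0 -> e t = 0.
  move=> t0; rewrite /e osc0 // ltr0_sqrtr // expr0n mulr0 !subr0.
  by apply: iter_theta_lt0 t0; exact: step0_lt0.
have eM (t : R) : 0 <= t <= x ^+ 2 -> `|e t| <= C0 * y ^+ 5.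
  move=> tX; have := hball K y X t y1 xy xK tX; rewrite /e.
  have -> // : t ^+ 3 = Num.sqrt t ^+ 6.
  by rewrite (exprM _ 2 3) sqr_sqrtr //; case/andP: tX.
have split6 (t : R) : iter (2 * k.+3) (theta K) (@step0 R) t =
   c0 * iter (2 * k) (theta K) (fun u => Num.sqrt u ^+ 6) t +
   (iter (2 * k) (theta K) (osc6 B) t + iter (2 * k) (theta K) e t).
  rewrite (_ : (2 * k.+3 = 2 * k + 6)%N); last by nlia.
  rewrite iterD -/(ball6 K) -[X in _ + (X + _)]mul1r -!iter_theta_lin.
  congr (iter _ _ _ t); apply/funext => u; rewrite /e; ring.
rewrite (eq_bigr _ (fun w _ => split6 (s w))) !big_split /= -mulr_sumr.
(* The sums of the main term, of the oscillating term, and of the error of the six-dimensional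
   formula. *)
set S1 := \sum_(w <- _) _; set S2 := \sum_(w <- _) _; set S3 := \sum_(w <- _) _.
have yx : y <= x.
  rewrite leNgt; apply/negP => xy'.
  have : x ^+ 3 < y ^+ 3 by rewrite ltr_pXn2r ?nnegrE // ltW.
  by rewrite -xy ltNge (exprS x 2) ler_peMl // sqr_ge0.
pose Q := x ^+ (2 * k.+3) / y; rewrite -/Q.
have Q0 : 0 <= Q by rewrite /Q; nonneg.
(* All Euler-Maclaurin errors have order x^(2k+5); y <= x puts them below the target. *)
have Qx : x ^+ (2 * k).+4.+1 <= Q.
  rewrite /Q ler_pdivlMr // (_ : (2 * k.+3 = (2 * k).+4.+2)%N); last by nlia.
  by rewrite [leRHS]exprSr ler_wpM2l // exprn_ge0 // ltW.
(* With X = y^3 the oscillating bound X^2 y^2 and the accumulated error X y^5 both equal y^8 = x^6 /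
   y, so each reaches the target exactly. *)
have Qy : x ^+ (2 * k) * (X ^+ 2 * y ^+ 2) = Q.
  rewrite /Q (_ : (2 * k.+3 = 2 * k + 2 + 2 + 2)%N); last by nlia.
  rewrite !exprD [X in _ * X / y]xy /X; field; exact: lt0r_neq0.
have Qy' : x ^+ (2 * k) * (y ^+ 5 * X) = Q.
  by have XE : X = y ^+ 3 := xy; rewrite -Qy XE; ring.
have cnt : 2 * W%:R + 1 <= 3 * X by qlra.
have x3 : (2 * x + 1) ^+ (2 * k) <= 3 ^+ (2 * k) * x ^+ (2 * k).
  by rewrite -exprMn; apply: lerXn2r; rewrite ?nnegrE; qlra.
have h3 : `|S3| <= 3 ^+ (2 * k) * C0 * 3 * Q.
  have M0 : 0 <= C0 * y ^+ 5 by nonneg.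
  apply: (@le_trans _ _ (3 * X * ((2 * x + 1) ^+ (2 * k) * (C0 * y ^+ 5)))).
    apply: le_trans (_ : (2 * W%:R + 1) * ((2 * x + 1) ^+ (2 * k) * (C0 * y ^+ 5)) <= _).
      apply: sum_norm_zrange => w _; apply: iter_theta_bound => //; first exact: ltW.
      by rewrite s0 sX.
    by rewrite ler_wpM2r // mulr_ge0 // exprn_ge0 //; qlra.
  apply: (@le_trans _ _ (3 * X * (3 ^+ (2 * k) * x ^+ (2 * k) * (C0 * y ^+ 5)))).
    by rewrite ler_wpM2l; [|nonneg|rewrite ler_wpM2r].
  by rewrite -Qy' le_eqVlt; apply/orP; left; apply/eqP; ring.
have h2 : `|S2| <= 3 ^+ (2 * k) * D * Q.
  have -> : S2 = \sum_(t <- [seq s w | w <- zrange W]) iter (2 * k) (theta K) (osc6 B) (t - 0).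
    by rewrite big_map; apply: eq_bigr => w _; rewrite subr0.
  apply: (le_trans (@theta_osc_sum K (2 * k) (osc6 B) _ x (D * (X ^+ 2 * y ^+ 2))
     (ltW x0) _ osc0 _ _ 0 (lexx 0))).
  - by nonneg.
  - by move=> t /mapP[w _ ->]; exact: sX.
  - by move=> a a0; rewrite big_map; exact: hosc.
  apply: (@le_trans _ _ (3 ^+ (2 * k) * x ^+ (2 * k) * (D * (X ^+ 2 * y ^+ 2)))).
    by rewrite ler_wpM2r //; nonneg.
  by rewrite -Qy le_eqVlt; apply/orP; left; apply/eqP; ring.
pose T := \sum_(w <- zrange W) semic (X ^+ 2) k.+3 w%:~R.
have h1 : `|S1 - b1 * T| <= 3 * C1 * 2 ^+ (2 * k).+3 * Q.
  rewrite /S1 /T mulr_sumr -sumrB.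
  have M0 : 0 <= C1 * (2 * x) ^+ (2 * k).+3 by rewrite mulr_ge0 // exprn_ge0 //; qlra.
  apply: (@le_trans _ _ ((2 * W%:R + 1) * (C1 * (2 * x) ^+ (2 * k).+3))).
    apply: sum_norm_zrange => w _.
    have -> : semic (X ^+ 2) k.+3 w%:~R = Num.sqrt (s w) ^+ (2 * k).+4.+2.
      rewrite (_ : ((2 * k).+4.+2 = 2 * k.+3)%N); last by nlia.
      by rewrite exprM sqr_sqrtr.
    have sx : Num.sqrt (s w) <= x.
      by rewrite -[leRHS]ger0_norm ?(ltW x0) // -sqrtr_sqr ler_wsqrtr.
    apply: (le_trans (hmain K (s w) (s0 w) _)); first by apply: (le_trans sx); apply: le_trans xK.
    have x20 : 0 <= 2 * x by qlra.
    rewrite ler_wpM2l // ler_pXn2r ?nnegrE ?sqrtr_ge0 // -[leRHS]ger0_norm //.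
    rewrite -sqrtr_sqr ler_wsqrtr // exprMn -/X; have := sX w; rewrite (_ : 2 ^+ 2 = 4 :> R); last by ring.
    by qlra.
  apply: (@le_trans _ _ (3 * X * (C1 * (2 * x) ^+ (2 * k).+3))); first by rewrite ler_wpM2r.
  apply: (@le_trans _ _ (3 * C1 * 2 ^+ (2 * k).+3 * x ^+ (2 * k).+4.+1)).
    by rewrite exprMn (_ : ((2 * k).+4.+1 = 2 + (2 * k).+3)%N) // exprD -/X le_eqVlt; apply/orP; left; apply/eqP; ring.
  by rewrite ler_wpM2l //; nonneg.
have h4 : `|T - b2 * x ^+ (2 * k.+3 + 2)| <= C2 * Q.
  have TE : T = \sum_(w <- zrange W.+1) semic (X ^+ 2) k.+3 w%:~R.
    apply: zrange_shrink => z hz; apply: semic_eq0.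
    rewrite -[leRHS]real_normK ?num_real // ler_pXn2r ?nnegrE //.
    apply: (le_trans (ltW XW)); rewrite -intr_norm pmulrn ler_int; move: hz; clear; lia.
  have := hw X W.+1 X1 (ltW XW); rewrite -TE.
  have -> : X ^+ k.+4 = x ^+ (2 * k.+3 + 2) by rewrite -exprM; congr (_ ^+ _); nlia.
  have -> : X ^+ k.+2 * Num.sqrt X = x ^+ (2 * k).+4.+1.
    by rewrite sqrtr_sqr ger0_norm ?(ltW x0) // -exprM -exprSr; congr (_ ^+ _); nlia.
  by move/le_trans; apply; rewrite ler_wpM2l.
rewrite (_ : _ - _ = c0 * b1 * (T - b2 * x ^+ (2 * k.+3 + 2)) + c0 * (S1 - b1 * T) + S2 + S3); last by ring.
rewrite [leRHS]mulrDl [X in _ <= X + _]mulrDl [X in _ <= X + _ + _]mulrDl.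
apply: (le_trans (ler_normD _ _)); apply: lerD => //.
apply: (le_trans (ler_normD _ _)); apply: lerD => //.
apply: (le_trans (ler_normD _ _)); apply: lerD.
  by rewrite !normrM -[leRHS]mulrA ler_wpM2l.
by rewrite normrM -[leRHS]mulrA ler_wpM2l.
Qed.

End LatticeSum.

(** * The lattice count of the dilated ball as a sum over slices *)

Section LatticePoints.
Variable R : realType.

Fixpoint vecs (K d : nat) : seq (d.-tuple int) :=
  if d is d'.+1 return seq (d.-tuple int)
  then [seq cons_tuple p.1 p.2 | p <- [seq (z, v) | z <- zrange K, v <- vecs K d']]
  else [:: [tuple]].

Lemma vecsS K d : vecs K d.+1 =
  [seq cons_tuple p.1 p.2 | p <- [seq (z, v) | z <- zrange K, v <- vecs K d]].
Proof. by []. Qed.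

Lemma vecs_uniq K d : uniq (vecs K d).
Proof.
elim: d => // d IH; rewrite vecsS map_inj_uniq.
  by apply: allpairs_uniq => // [|[a b] [c e] _ _ [-> ->]] //; exact: zrange_uniq.
move=> [z v] [z' v'] /(congr1 val) /= [-> h]; congr pair; exact: val_inj.
Qed.

Lemma mem_vecs K d (v : d.-tuple int) : (v \in vecs K d) = all (fun z => `|z| <= K%:Z) v.
Proof.
elim: d v => [|d IH] v; first by rewrite tuple0 /= inE eqxx.
case/tupleP: v => z v; rewrite vecsS; apply/mapP/andP => [[[z' v']]|[hz hv]].
  rewrite mem_allpairs_pair mem_zrange IH /= => /andP[h1 h2] /(congr1 val) /= [-> ->].
  by split.
by exists (z, v) => //; rewrite mem_allpairs_pair mem_zrange IH; apply/andP.
Qed.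

Definition norm2 d (v : d.-tuple int) : R := \sum_(i < d) (tnth v i)%:~R ^+ 2.

Lemma norm2_cons d z (v : d.-tuple int) : norm2 [tuple of z :: v] = z%:~R ^+ 2 + norm2 v.
Proof.
rewrite /norm2 big_ord_recl tnth0; congr (_ + _).
by apply: eq_bigr => i _; rewrite tnthS.
Qed.

Lemma iter_theta_vecs (K d : nat) (g : R -> R) (t : R) :
  iter d (theta K) g t = \sum_(v <- vecs K d) g (t - norm2 v).
Proof.
elim: d t => [|d IH] t; first by rewrite big_seq1 /norm2 big_ord0 subr0.
rewrite vecsS big_map big_allpairs iterS; apply: eq_bigr => z _; rewrite IH; apply: eq_bigr => v _.
by rewrite (norm2_cons z v) opprD addrA.
Qed.

Section Ball.
Variable q : nat.
Local Notation d := (2 * q)%N.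
Local Notation sq p := (\sum_(i < d) tnth p.1 i ^+ 2).

Lemma hballP (p : hspace R q) : hball p <-> sq p ^+ 2 + p.2 ^+ 2 <= 1.
Proof.
have S0 : 0 <= sq p by apply: sumr_ge0 => i _; rewrite sqr_ge0.
have -> : hball p <-> (sq p ^+ 2 + p.2 ^+ 2) `^ 4^-1 <= 1.
  by rewrite /hball /= /cygan_koranyi_norm /euclid_norm (exprM _ 2 2) sqr_sqrtr.
have B0 : 0 <= sq p ^+ 2 + p.2 ^+ 2 by rewrite addr_ge0 ?sqr_ge0.
split=> h; last first.
  have : (sq p ^+ 2 + p.2 ^+ 2) `^ 4^-1 <= 1 `^ 4^-1 by apply: ge0_ler_powR; rewrite ?nnegrE // invr_ge0.
  by rewrite powR1.
rewrite leNgt; apply/negP => h2.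
have : 1 `^ 4^-1 < (sq p ^+ 2 + p.2 ^+ 2) `^ 4^-1 by apply: gt0_ltr_powR; rewrite ?nnegrE.
by rewrite powR1 ltNge h.
Qed.

Lemma dilated_ballP (x : R) (p : hspace R q) : 0 < x ->
  (hdilation x @` @hball R q) p <-> sq p ^+ 2 + p.2 ^+ 2 <= x ^+ 4.
Proof.
move=> x0; have x4 : 0 < x ^+ 4 by rewrite exprn_gt0.
have key (r : hspace R q) : (sq (hdilation x r)) ^+ 2 + (hdilation x r).2 ^+ 2 =
    x ^+ 4 * (sq r ^+ 2 + r.2 ^+ 2).
  rewrite /hdilation /=; under eq_bigr do rewrite tnth_mktuple exprMn.
  by rewrite -mulr_sumr; ring.
split=> [[r /hballP h <-]|h].
  by rewrite key -[leRHS]mulr1 ler_pM2l.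
have e : hdilation x (hdilation x^-1 p) = p.
  case: p {h} => v w; rewrite /hdilation /=; congr pair.
    apply: eq_from_tnth => i; rewrite !tnth_mktuple mulrA divff ?mul1r // gt_eqF //.
  by rewrite mulrA -exprMn divff ?expr1n ?mul1r // gt_eqF.
exists (hdilation x^-1 p) => //; apply/hballP.
by rewrite -(ler_pM2l x4) -key e mulr1.
Qed.

(** The map [emb] identifies the lattice points of the dilated ball with the listed pairs (w, v)
    satisfying |v|^2 <= s_w; [step0] is the indicator of that inequality. *)
Lemma hcountE (x : R) (K : nat) : 1 <= x -> x ^+ 2 <= K%:R ->
  (hcount q x)%:R = \sum_(w <- zrange (Num.truncn (x ^+ 2)))
      iter d (theta K) (@step0 R) (Num.sqrt ((x ^+ 2) ^+ 2 - w%:~R ^+ 2)).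
Proof.
move=> x1 xK; set W := Num.truncn _; have X0 : 0 <= x ^+ 2 by exact: sqr_ge0.
pose s w : R := Num.sqrt ((x ^+ 2) ^+ 2 - w%:~R ^+ 2).
pose P (p : int * d.-tuple int) := 0 <= s p.1 - norm2 p.2.
pose l := [seq p <- [seq (w, v) | w <- zrange W, v <- vecs K d] | P p].
pose emb (p : int * d.-tuple int) : hspace R q := ([tuple (tnth p.2 i)%:~R | i < d], p.1%:~R).
have lu : uniq l.
  apply: filter_uniq; apply: allpairs_uniq; rewrite ?zrange_uniq ?vecs_uniq //.
  by move=> [a b] [c e] _ _ [-> ->].
have einj : injective emb.
  move=> [w v] [w' v'] [h1 /intr_inj -> ]; congr pair; apply: eq_from_tnth => i.
  have := congr1 (fun t : seq R => nth 0 t i) h1.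
  by rewrite -!(tnth_nth 0 [tuple _ | _ < _]) !tnth_mktuple => /intr_inj.
have -> : hcount q x = size l.
  rewrite /hcount -(size_map emb) -(undup_id (_ : uniq (map emb l))); last by rewrite map_inj_uniq.
  rewrite -card_fseq; congr (#|` _|); rewrite -[RHS]set_fsetK; congr fset_set.
  have lP (w : int) (v : d.-tuple int) : (norm2 v ^+ 2 + w%:~R ^+ 2 <= x ^+ 4) = ((w, v) \in l).
    have n0 : 0 <= norm2 v by apply: sumr_ge0 => i _; rewrite sqr_ge0.
    have x4 : x ^+ 4 = (x ^+ 2) ^+ 2 by rewrite -exprM.
    rewrite mem_filter mem_allpairs_pair mem_zrange /P /= mem_vecs subr_ge0.
    have wW : (`|w| <= W%:Z) = (w%:~R ^+ 2 <= (x ^+ 2) ^+ 2 :> R).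
      rewrite -[in RHS](@real_normK _ w%:~R) ?num_real // ler_pXn2r ?nnegrE //.
      by rewrite -intr_norm -abszE -pmulrn -truncn_ge_nat // ler_nat.
    rewrite wW x4; apply/idP/and3P => [h|[h1 h2 _]].
      have h2 : w%:~R ^+ 2 <= (x ^+ 2) ^+ 2 :> R by have := sqr_ge0 (norm2 v); qlra.
      have h1 : norm2 v <= s w.
        by rewrite -[leLHS]ger0_norm // -sqrtr_sqr ler_wsqrtr //; qlra.
      split=> //; apply/allP => z /tnthP[i ->].
      (* An integer is at most its square in absolute value, so bounding the square by K puts the
         coordinate in the window. *)
      have : (tnth v i)%:~R ^+ 2 <= K%:R :> R.
        apply: le_trans xK; apply: (@le_trans _ _ (norm2 v)).
          by rewrite /norm2 (bigD1 i) //= lerDl; apply: sumr_ge0 => j _; rewrite sqr_ge0.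
        rewrite -(@ler_pXn2r _ 2) ?nnegrE //; have := sqr_ge0 (w%:~R : R); qlra.
      rewrite -rmorphXn /= pmulrn ler_int; move: (tnth v i) => u; clear; nia.
    have := @ler_pXn2r _ 2 isT (norm2 v) (s w); rewrite !nnegrE n0 sqrtr_ge0 => /(_ isT isT).
    by rewrite h1 sqr_sqrtr ?subr_ge0 // lerBrDr => ->.
  have x0 : 0 < x by qlra.
  apply/seteqP; split => [p [[p1 p2] /(dilated_ballP _ x0) h]|p].
    rewrite /= inE; apply/mapP.
    pose v := [tuple Num.floor (tnth p.1 i) | i < d].
    have vE i : (tnth v i)%:~R = tnth p.1 i.
      by rewrite tnth_mktuple; apply/eqP; rewrite -intrEfloor.
    have wE : (Num.floor p.2)%:~R = p.2 by apply/eqP; rewrite -intrEfloor.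
    exists (Num.floor p.2, v).
      by rewrite -lP wE /norm2; under eq_bigr do rewrite vE.
    rewrite /emb /= wE [LHS]surjective_pairing; congr pair.
    by apply: eq_from_tnth => i; rewrite tnth_mktuple vE.
  rewrite /= inE => /mapP[[w v] vl ->]; split; first by split => [i|] /=; rewrite ?tnth_mktuple intr_int.
  apply/dilated_ballP => //; rewrite -lP in vl; move: vl; rewrite /norm2 /=.
  by under [in X in _ -> X]eq_bigr do rewrite tnth_mktuple.
rewrite -sum1_size natr_sum /l big_filter big_mkcond big_allpairs /=.
apply: eq_bigr => w _; rewrite iter_theta_vecs; apply: eq_bigr => v _.
by rewrite /P /step0 /=.
Qed.

End Ball.

End LatticePoints.

(** * Identifying the main coefficient with the volume *)

Section Volume.
Variables (R : realType) (q : nat).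
Local Notation T := (measurableTypeR R).
Local Notation d := (2 * q)%N.
Local Notation sq p := (\sum_(i < d) tnth p.1 i ^+ 2).

(** The image under the dilation by 1 / x of the half-open unit cube with lower corner p. Half-open
    sides make the cells of distinct lattice points disjoint. *)
Definition cell (x : R) (p : hspace R q) : set (d.-tuple T * T) :=
  [set t : d.-tuple T | forall i, [set` `[tnth p.1 i / x, (tnth p.1 i + 1) / x[] (tnth t i)] `*`
  [set` `[p.2 / x ^+ 2, (p.2 + 1) / x ^+ 2[].

Lemma cellP (x : R) (p r : hspace R q) : 0 < x -> cell x p r <->
  (forall i, tnth p.1 i <= tnth (hdilation x r).1 i < tnth p.1 i + 1) /\
  p.2 <= (hdilation x r).2 < p.2 + 1.
Proof.
move=> x0; have x20 : 0 < x ^+ 2 by rewrite exprn_gt0.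
have e (y a b : R) : 0 < y -> (a / y <= b < (a + 1) / y) = (a <= y * b < a + 1).
  by move=> y0; rewrite ler_pdivrMr // ltr_pdivlMr // (mulrC b).
rewrite /cell /=; split => -[h1 h2]; (split=> [i|]; [have := h1 i|move: h2]);
  by rewrite ?tnth_mktuple ?in_itv /= ?e.
Qed.

Lemma measurable_cell (x : R) p : measurable (cell x p).
Proof.
apply: measurableX; last exact: measurable_itv.
apply: (@measurable_box R d (fun i => [set` `[tnth p.1 i / x, (tnth p.1 i + 1) / x[])) => i.
exact: measurable_itv.
Qed.

Lemma hvol_cell (x : R) p : 0 < x -> hvol (cell x p) = (x ^- (d + 2))%:E.
Proof.
move=> x0; have x20 : 0 < x ^+ 2 by rewrite exprn_gt0.
have itvE (y a : R) : 0 < y -> lebesgue_measure [set` `[a / y, (a + 1) / y[] = (y^-1)%:E.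
  move=> y0; rewrite lebesgue_measure_itv /= lte_fin ltr_pM2r ?invr_gt0 // ltrDl ltr01.
  by rewrite -EFinB mulrDl mul1r addrC addKr.
rewrite /hvol /cell product_measure1E; last exact: measurable_itv; last first.
  apply: (@measurable_box R d (fun i => [set` `[tnth p.1 i / x, (tnth p.1 i + 1) / x[])) => i.
  exact: measurable_itv.
rewrite [X in (X * _)%E](@lebesgue_tuple_box R d
  (fun i => [set` `[tnth p.1 i / x, (tnth p.1 i + 1) / x[])); last by move=> i; exact: measurable_itv.
under eq_bigr do rewrite itvE //.
rewrite prodEFin prodr_const card_ord [X in (_ * X)%E](itvE _ p.2 x20) -EFinM; congr EFin.
by rewrite exprVn -invfM -exprD.
Qed.

Lemma trivIset_cell (x : R) (D : set (hspace R q)) : 0 < x -> D `<=` @hlattice R q ->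
  trivIset D (cell x).
Proof.
have e (a b c : R) : a \is a Num.int -> b \is a Num.int ->
    a <= c < a + 1 -> b <= c < b + 1 -> a = b.
  move=> /intrP[m ->] /intrP[n ->] hm hn.
  by rewrite -(@floor_def _ c m) ?intrD // (@floor_def _ c n) ?intrD.
move=> x0 DL p p' /DL[p1 p2] /DL[p1' p2'] [r [/(cellP _ _ x0)[h1 h2] /(cellP _ _ x0)[h1' h2']]].
rewrite [LHS]surjective_pairing [RHS]surjective_pairing; congr pair.
  by apply: eq_from_tnth => i; apply: e (h1 i) (h1' i).
exact: e h2 h2'.
Qed.

Lemma hvol_cells (x : R) (D : set (hspace R q)) : 0 < x -> finite_set D -> D `<=` @hlattice R q ->
  hvol (\bigcup_(p in D) cell x p) = (#|` fset_set D|%:R * x ^- (d + 2))%:E.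
Proof.
move=> x0 Df DL.
pose mu := [the {measure set (d.-tuple T * T) -> \bar R} of
  (@lebesgue_tuple R d \x @lebesgue_measure R)%E].
have -> : hvol (\bigcup_(p in D) cell x p) = \sum_(p \in D) hvol (cell x p).
  exact: (@measure_fin_bigcup _ R _ mu _ D (cell x) Df (trivIset_cell x0 DL)
    (fun p _ => measurable_cell x p)).
rewrite fsbig_finite //; under eq_bigr do rewrite hvol_cell //.
by rewrite sumEFin big_const_seq count_predT iter_addr_0 mulr_natl.
Qed.

(** Moving every coordinate by at most 1 changes V = |v|^2 by at most 3 d x (d the number of
    coordinates of v), hence V^2 by 6 d x V + 9 d^2 x^2, and w^2 by 2 x^2 + 1. As V <= x^2 and x >=
    1, the total is at most this constant times x^3. *)
Definition cellc : R := 9 * d%:R ^+ 2 + 6 * d%:R + 3.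

Lemma koranyi_perturb (x : R) (p r : hspace R q) : 1 <= x -> sq p <= x ^+ 2 -> `|p.2| <= x ^+ 2 ->
  (forall i, `|tnth r.1 i - tnth p.1 i| <= 1) -> `|r.2 - p.2| <= 1 ->
  sq r ^+ 2 + r.2 ^+ 2 <= sq p ^+ 2 + p.2 ^+ 2 + cellc * x ^+ 3.
Proof.
move=> x1 hp p2 hr r2.
have x0 : 0 < x by qlra.
have x2 : x <= x ^+ 2 by rewrite expr2 ler_peMr // ltW.
have x3 : x ^+ 2 <= x ^+ 3 by rewrite (exprS _ 2) ler_peMl // sqr_ge0.
have key (a b M : R) : `|a| <= M -> `|b - a| <= 1 -> b ^+ 2 <= a ^+ 2 + 2 * M + 1.
  by rewrite !ler_norml => /andP[? ?] /andP[? ?]; rewrite !expr2; nra.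
have S0 : 0 <= sq p by apply: sumr_ge0 => i _; rewrite sqr_ge0.
have S0' : 0 <= sq r by apply: sumr_ge0 => i _; rewrite sqr_ge0.
have s1 : sq r <= sq p + d%:R * (3 * x).
  have -> : d%:R * (3 * x) = \sum_(i < d) 3 * x by rewrite sumr_const card_ord mulr_natl.
  rewrite -big_split /=; apply: ler_sum => i _.
  have pi : `|tnth p.1 i| <= x.
    rewrite -(@ler_pXn2r _ 2) ?nnegrE ?(ltW x0) // real_normK ?num_real //.
    by apply: le_trans hp; rewrite (bigD1 i) //= lerDl; apply: sumr_ge0 => j _; rewrite sqr_ge0.
  by have := key _ _ _ pi (hr i); qlra.
have s2 := key _ _ _ p2 r2.
move: s1 S0 S0' hp; rewrite /cellc; move: (sq r) (sq p) => V' V s1 S0 S0' hp.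
have n0 : 0 <= d%:R :> R by [].
move: n0 s1; move: (d%:R : R) => n n0 s1.
have : V' ^+ 2 <= (V + n * (3 * x)) ^+ 2.
  by rewrite ler_pXn2r ?nnegrE // addr_ge0 // !mulr_ge0 // ltW.
have k1 : n * x * V <= n * x ^+ 3.
  by rewrite -mulrA ler_wpM2l // (exprS x 2) ler_wpM2l // ltW.
have k2 : n ^+ 2 * x ^+ 2 <= n ^+ 2 * x ^+ 3 by rewrite ler_wpM2l // sqr_ge0.
have -> : (V + n * (3 * x)) ^+ 2 = V ^+ 2 + 6 * (n * x * V) + 9 * (n ^+ 2 * x ^+ 2) by ring.
have -> : (9 * n ^+ 2 + 6 * n + 3) * x ^+ 3 = 9 * (n ^+ 2 * x ^+ 3) + 6 * (n * x ^+ 3) + 3 * x ^+ 3 by ring.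
by qlra.
Qed.

Lemma cellc_ge3 : 3 <= cellc.
Proof.
have n0 : 0 <= d%:R :> R by [].
have : 0 <= 9 * d%:R ^+ 2 :> R by rewrite mulr_ge0 // sqr_ge0.
by rewrite /cellc; qlra.
Qed.

Lemma koranyi_bounds (x : R) (p : hspace R q) : 0 <= x -> sq p ^+ 2 + p.2 ^+ 2 <= x ^+ 4 ->
  sq p <= x ^+ 2 /\ `|p.2| <= x ^+ 2.
Proof.
move=> x0; have -> : x ^+ 4 = (x ^+ 2) ^+ 2 by rewrite -exprM.
have S0 : 0 <= sq p by apply: sumr_ge0 => i _; rewrite sqr_ge0.
move=> h; have := sqr_ge0 (sq p); have := sqr_ge0 p.2 => h1 h2.
split; rewrite -(@ler_pXn2r _ 2) ?nnegrE ?sqr_ge0 ?normr_ge0 ?real_normK ?num_real //; qlra.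
Qed.

Local Notation vol := (fine (@hvol R q (@hball R q))).

(** Rounding down the coordinates of the dilated point gives the corner of a cell containing it. By
    [koranyi_perturb] that corner stays in the ball of radius x + [cellc], whose fourth power
    exceeds x^4 + [cellc] x^3. *)
Lemma hvol_le_hcount (x : R) : 1 <= x -> vol * x ^+ (d + 2) <= (hcount q (x + cellc))%:R.
Proof.
move=> x1; have x0 : 0 < x by qlra.
have c3 := cellc_ge3.
rewrite -ler_pdivlMr ?exprn_gt0 //.
set L := @hlattice R q `&` (hdilation (x + cellc) @` @hball R q).
have Lf : finite_set L by exact: finite_lattice_points.
have LL : L `<=` @hlattice R q by move=> p [].
have : (hvol (@hball R q) <= hvol (\bigcup_(p in L) cell x p))%E.
  apply: le_measure; rewrite ?inE.
  - exact: measurable_hball.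
  - by apply: fin_bigcup_measurable => // p _; exact: measurable_cell.
  move=> r rB.
  pose p : hspace R q := ([tuple (Num.floor (tnth (hdilation x r).1 i))%:~R | i < d],
     (Num.floor (hdilation x r).2)%:~R).
  have fl (t : R) : (Num.floor t)%:~R <= t < (Num.floor t)%:~R + 1.
    by have := floor_itv t; rewrite intrD.
  exists p; last first.
    by apply/cellP => //; split => [i|]; rewrite ?tnth_mktuple fl.
  split; first by split => [i|] /=; rewrite ?tnth_mktuple intr_int.
  apply/dilated_ballP; first by qlra.
  have h : sq (hdilation x r) ^+ 2 + (hdilation x r).2 ^+ 2 <= x ^+ 4.
    by apply/(dilated_ballP _ x0); exists r.
  have [h1 h2] := koranyi_bounds (ltW x0) h.
  have fl1 (t : R) : `|(Num.floor t)%:~R - t| <= 1.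
    by have := fl t => /andP[? ?]; rewrite ler_norml; apply/andP; split; qlra.
  have := @koranyi_perturb x (hdilation x r) p x1 h1 h2.
  move=> /(_ _ _)/le_trans; apply => [i||].
  - by rewrite tnth_mktuple fl1.
  - exact: fl1.
  - have x3 : 0 <= x ^+ 3 by rewrite exprn_ge0 // ltW.
    have cx : 0 <= cellc * x ^+ 3 by rewrite mulr_ge0 //; qlra.
    have k1 : 0 <= cellc ^+ 2 * x ^+ 2 by rewrite mulr_ge0 // sqr_ge0.
    have k2 : 0 <= cellc ^+ 3 * x by rewrite mulr_ge0 ?exprn_ge0 //; qlra.
    have k3 : 0 <= cellc ^+ 4 by rewrite exprn_ge0 //; qlra.
    apply: (@le_trans _ _ (x ^+ 4 + cellc * x ^+ 3)); first by qlra.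
    have -> : (x + cellc) ^+ 4 = x ^+ 4 + 4 * (cellc * x ^+ 3) + 6 * (cellc ^+ 2 * x ^+ 2)
       + 4 * (cellc ^+ 3 * x) + cellc ^+ 4 by ring.
    qlra.
rewrite hvol_cells // => h.
by rewrite -lee_fin fineK // hvol_ball_fin_num.
Qed.

(** The condition on x ensures (x - [cellc])^4 + [cellc] x^3 <= x^4, so every cell attached to a
    lattice point of the smaller ball lies inside the unit ball. *)
Lemma hcount_le_hvol (x : R) : 2 * cellc <= x ->
  (hcount q (x - cellc))%:R <= vol * x ^+ (d + 2).
Proof.
have c3 := cellc_ge3 => xc; have x0 : 0 < x by qlra.
rewrite -ler_pdivrMr ?exprn_gt0 //.
set L := @hlattice R q `&` (hdilation (x - cellc) @` @hball R q).
have Lf : finite_set L by exact: finite_lattice_points.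
have LL : L `<=` @hlattice R q by move=> p [].
have : (hvol (\bigcup_(p in L) cell x p) <= hvol (@hball R q))%E.
  apply: le_measure; rewrite ?inE.
  - by apply: fin_bigcup_measurable => // p _; exact: measurable_cell.
  - exact: measurable_hball.
  move=> r [p [_ /dilated_ballP h] /(cellP _ _ x0)[r1 r2]].
  have {}h := h ltac:(qlra).
  have xc0 : 0 <= x - cellc by qlra.
  have [h1 h2] := koranyi_bounds xc0 h.
  have xx : (x - cellc) ^+ 2 <= x ^+ 2 by rewrite ler_pXn2r ?nnegrE //; qlra.
  have e (a b : R) : a <= b < a + 1 -> `|b - a| <= 1.
    by move=> /andP[? ?]; rewrite ler_norml; apply/andP; split; qlra.
  have := @koranyi_perturb x p (hdilation x r) ltac:(qlra) (le_trans h1 xx) (le_trans h2 xx)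
    (fun i => e _ _ (r1 i)) (e _ _ r2).
  move=> k; have : (hdilation x @` @hball R q) (hdilation x r).
    apply/dilated_ballP => //; apply: (le_trans k).
    have x2 : 0 <= x ^+ 2 by exact: sqr_ge0.
    have k1 : cellc * x ^+ 2 * (2 * cellc) <= cellc * x ^+ 2 * x.
      by rewrite ler_wpM2l // mulr_ge0 //; qlra.
    have k2 : cellc ^+ 3 * (2 * cellc) <= cellc ^+ 3 * x.
      by rewrite ler_wpM2l // exprn_ge0 //; qlra.
    have k3 : 0 <= cellc ^+ 4 by rewrite exprn_ge0 //; qlra.
    apply: (@le_trans _ _ ((x - cellc) ^+ 4 + cellc * x ^+ 3)); first by qlra.
    have -> : (x - cellc) ^+ 4 = x ^+ 4 - 4 * (cellc * x ^+ 3) + 3 * (cellc * x ^+ 2 * (2 * cellc))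
       - 4 * (cellc ^+ 3 * x) + cellc ^+ 4 by ring.
    have e3 : cellc * x ^+ 2 * x = cellc * x ^+ 3 by ring.
    have e4 : cellc ^+ 3 * (2 * cellc) = 2 * cellc ^+ 4 by ring.
    qlra.
  move=> [r' r'B e']; rewrite (_ : r = r') //.
  have xn : x != 0 by rewrite gt_eqF.
  rewrite [LHS]surjective_pairing [RHS]surjective_pairing; congr pair.
    apply: eq_from_tnth => i; apply: (mulfI xn).
    by have := congr1 (fun p => tnth p.1 i) e'; rewrite !tnth_mktuple.
  by apply: (mulfI (expf_neq0 2 xn)); have := congr1 snd e'.
rewrite hvol_cells // => h.
by rewrite -lee_fin fineK // hvol_ball_fin_num.
Qed.

(** With t = 1 / x the two cell estimates enclose the volume between the values at t of two
    polynomials, [P (- cellc) (- C)] and [P cellc C], both equal to a at t = 0. *)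
Lemma hvol_unique (a C : R) : 0 <= C ->
  (forall x : R, 1 <= x -> `|(hcount q x)%:R - a * x ^+ (d + 2)| <= C * x ^+ d) -> vol = a.
Proof.
move=> C0 h; have c3 := cellc_ge3.
pose P (c e : R) : {poly R} := a *: (1 + c *: 'X) ^+ (d + 2) + e *: ((1 + c *: 'X) ^+ d * 'X^2).
have PE (c e t : R) : (P c e).[t] = a * (1 + c * t) ^+ (d + 2) + e * ((1 + c * t) ^+ d * t ^+ 2).
  by rewrite /P !(hornerE, horner_exp).
have P0 (c e : R) : (P c e).[t] @[t --> (0 : R)^'+] --> a.
  have -> : a = (P c e).[0] by rewrite PE mulr0 addr0 !expr1n !mulr1 expr0n !mulr0 addr0.
  by apply: cvg_at_right_filter; exact: continuous_horner.
have scale (c e t : R) : 0 < t ->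
   (P c e).[t] = (a * (t^-1 + c) ^+ (d + 2) + e * (t^-1 + c) ^+ d) / t^-1 ^+ (d + 2).
  move=> t0; have tn : t != 0 by rewrite gt_eqF.
  have -> : t^-1 + c = (1 + c * t) / t by field.
  rewrite PE !exprMn !exprVn invrK !(exprD _ d 2); have := expf_neq0 d tn => tdn.
  by field; rewrite tdn tn.
have c0 : 0 < cellc by qlra.
have near0 (b : R) : 0 < b -> \forall t \near (0 : R)^'+, 0 < t <= b.
  move=> b0; near=> t; apply/andP; split; near: t; [exact: nbhs_right_gt|exact: nbhs_right_le].
apply/eqP; rewrite eq_le; apply/andP; split.
  apply: (cvgr_to_ge (P0 cellc C)); apply: filterS (near0 1 ltr01) => t /andP[t0 t1].
  have x1 : 1 <= t^-1 by rewrite invf_ge1.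
  rewrite scale // ler_pdivlMr ?exprn_gt0 ?invr_gt0 //.
  apply: (le_trans (hvol_le_hcount x1)).
  by have := h (t^-1 + cellc) ltac:(qlra); rewrite ler_norml => /andP[_]; qlra.
have c20 : 0 < (2 * cellc)^-1 by rewrite invr_gt0; qlra.
apply: (cvgr_to_le (P0 (- cellc) (- C))); apply: filterS (near0 _ c20) => t /andP[t0 t1].
have x1 : 2 * cellc <= t^-1 by rewrite -[leLHS]invrK lef_pV2 ?posrE.
rewrite scale // ler_pdivrMr ?exprn_gt0 ?invr_gt0 //.
apply: le_trans (hcount_le_hvol x1).
by have := h (t^-1 - cellc) ltac:(qlra); rewrite ler_norml => /andP[]; qlra.
Unshelve. all: by end_near.
Qed.

End Volume.

(** * The choice y = x^(2/3) and the conclusion *)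

Lemma powR_ge1 (R : realType) (x a : R) : 0 <= a -> 1 <= x -> 1 <= x `^ a.
Proof.
move=> a0 x1; have : 1 `^ a <= x `^ a by apply: ge0_ler_powR; rewrite ?nnegrE //; qlra.
by rewrite powR1.
Qed.

Lemma hcount_asymptotics (R : realType) (q : nat) : (3 <= q)%N -> exists c C : R, 0 <= C /\
  forall x : R, 1 <= x ->
  `|(hcount q x)%:R - c * x ^+ (2 * q + 2)| <= C * (x ^+ (2 * q) / x `^ (2 / 3)).
Proof.
move=> q3; have [c [C [C0 h]]] := weighted_lattice_sum R q3.
exists c, C; split=> // x x1; have x0 : 0 < x by qlra.
have xK : x ^+ 2 <= (Num.truncn (x ^+ 2)).+1%:R by apply: ltW; exact: truncnS_gt.
rewrite (hcountE q x1 xK); apply: h => //; first by apply: powR_ge1 => //; qlra.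
rewrite -[RHS]powR_mulrn ?powR_ge0 // -powRrM (_ : 2 / 3 * 3%:R = 2%:R :> R); last by field.
by rewrite powR_mulrn // ltW.
Qed.

Theorem theorem1 (R : realType) (q : nat) (hq : (3 <= q)%N) :
  exists2 C : R, 0 < C &
    \forall x \near +oo,
      `|hdiscrepancy q x| <= C * x `^ ((2 * q)%:R - 2 / 3).
Proof.
have [c [C [C0 h]]] := @hcount_asymptotics R q hq.
have y1 (x : R) : 1 <= x -> 1 <= x `^ (2 / 3) by apply: powR_ge1; qlra.
(* An error of order x^(2q) already determines the coefficient, so the saving y >= 1 is simply
   discarded here. *)
have volE : fine (hvol (@hball R q)) = c.
  apply: (hvol_unique C0) => x x1; apply: (le_trans (h x x1)).
  have yp : 0 < x `^ (2 / 3) by rewrite (lt_le_trans ltr01 (y1 _ x1)).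
  rewrite ler_wpM2l // ler_pdivrMr // ler_peMr ?y1 // exprn_ge0 //; qlra.
exists (C + 1); first by qlra.
near=> x; have x1 : 1 <= x by near: x; exact: nbhs_pinfty_ge.
have x0 : 0 < x by qlra.
rewrite /hdiscrepancy volE powRD; last by rewrite (gt_eqF x0) implybT.
rewrite powRN powR_mulrn ?(ltW x0) //.
apply: (le_trans (h x x1)); apply: ler_wpM2r; last by qlra.
by rewrite mulr_ge0 ?invr_ge0 ?powR_ge0 // exprn_ge0 // ltW.
Unshelve. all: by end_near.
Qed.
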